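(* Let $1\le l\le m$, let $\mathcal T$ be an $m$-linear operator, let $\vec b=(b_1,\dots,b_l)\in \mathrm{BMO}(\mathbb R^n)^l$, and suppose that the iterated commutator $\mathcal T_{\vec b}$ satisfies the sparse domination hypothesis (SD) of the context with constants $C,\eta$. Let $\vec w=(w_1,\dots,w_m)\in A_{\vec 1}$, $u=\prod_{i=1}^mw_i^{1/m}$, and $v\in A_\infty$. Then there exists $t>1$ depending only on $v$ (with $v^{1/m}\in A_t$) such that for all bounded compactly supported $f_1,\dots,f_m$, $$\Big\|\frac{\mathcal T_{\vec b}(\vec f)}{v}\Big\|_{L^{\frac1m,\infty}(uv^{\frac1m})}\le C'\,K_0^{2l+6m}\,[v^{\frac1m}]_{A_t}^{2l+4m}\prod_{s=1}^l\|b_s\|_{\mathrm{BMO}}\Big\|\frac{\mathcal M_{L(\log L)}(\vec f)}{v}\Big\|_{L^{\frac1m,\infty}(uv^{\frac1m})},$$ where $$K_0=4C_np_0p_0'\Big([u]_{A_1}+2^{p_0-1}C_n^t[v^{\frac1m}]_{A_t}^2[u]_{A_1}^{p_0-1}\Big)+1,\qquad p_0=2^{n+3}(t-1)[u]_{A_1}+1,$$ $p_0'=p_0/(p_0-1)$, $C_n$ is a constant depending only on the dimension $n$, and $C'$ depends only on $n,m,l,C,\eta$.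
   Context: Cubes have sides parallel to the axes. $\langle g\rangle_Q=\frac1{|Q|}\int_Q g$. $\|b\|_{\mathrm{BMO}}=\sup_Q\langle|b-\langle b\rangle_Q|\rangle_Q$. $\|g\|_{L^{q,\infty}(\mu)}=\sup_{\lambda>0}\lambda\,\mu(\{|g|>\lambda\})^{1/q}$, with a weight identified with the measure it defines. Weights. $A_p$ are the Muckenhoupt classes, $[w]_{A_p}=\sup_Q\langle w\rangle_Q\langle w^{1-p'}\rangle_Q^{p-1}$ for $1<p<\infty$; $[w]_{A_1}$ is the least constant with $\langle w\rangle_Q\le [w]_{A_1}\operatorname{ess\,inf}_Qw$ for all cubes $Q$; $A_\infty=\bigcup_{p>1}A_p$. $\vec w\in A_{\vec 1}$ means $\sup_Q\big(\frac1{|Q|}\int_Q\prod_{i=1}^mw_i^{1/m}\big)\prod_{i=1}^m(\operatorname{ess\,inf}_Qw_i)^{-1/m}<\infty$. Iterated commutator. For an $m$-linear operator $\mathcal T$ acting on (suitable) functions on $\mathbb R^n$, and $\vec b=(b_1,\dots,b_l)$, set $[\mathcal T,\vec b]_{e_i}(\vec f)(x)=b_i(x)\mathcal T(f_1,\dots,f_m)(x)-\mathcal T(f_1,\dots,b_if_i,\dots,f_m)(x)$ and $\mathcal T_{\vec b}=[\cdots[[\mathcal T,\vec b]_{e_1},\vec b]_{e_2}\cdots,\vec b]_{e_l}$. Dyadic lattice: a collection $\mathcal D$ of cubes such that (i) if $Q\in\mathcal D$ then all dyadic descendants of $Q$ are in $\mathcal D$; (ii) any two $Q_1,Q_2\in\mathcal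 D$ have a common ancestor in $\mathcal D$; (iii) every compact set is contained in some $Q\in\mathcal D$. A subfamily $\mathcal S$ of a dyadic lattice is $\eta$-sparse, $\eta\in(0,1)$, if $|\bigcup_{P\in\mathcal S,P\subsetneq Q}P|\le(1-\eta)|Q|$ for all $Q\in\mathcal S$. Hypothesis (SD). There are constants $C>0$, $\eta\in(0,1)$ such that for all bounded compactly supported $f_1,\dots,f_m$ there are $3^n$ $\eta$-sparse families $\mathcal S_1,\dots,\mathcal S_{3^n}$ (each in a dyadic lattice) with, for a.e. $x\in\mathbb R^n$, $$|\mathcal T_{\vec b}(\vec f)(x)|\le C\sum_{j=1}^{3^n}\sum_{\vec\gamma\in\{1,2\}^l}\sum_{Q\in\mathcal S_j}\Big(\prod_{s=1}^l\mathcal U(b_s,f_s,Q,\gamma_s)(x)\Big)\Big(\prod_{s=l+1}^m\langle|f_s|\rangle_Q\Big)\chi_Q(x),$$ where $\mathcal U(b,f,Q,1)(x)=|b(x)-\langle b\rangle_Q|\langle|f|\rangle_Q$ and $\mathcal U(b,f,Q,2)(x)=\langle|(b-\langle b\rangle_Q)f|\rangle_Q$. Maximal function. $\|f\|_{L(\log L),Q}=\inf\{\lambda>0:\frac1{|Q|}\int_Q\phi(|f|/\lambda)\le1\}$ with $\phi(t)=t\log(e+t)$; $\mathcal M_{L(\log L)}(\vec f)(x)=\sup_{Q\ni x}\prod_{i=1}^m\|f_i\|_{L(\log L),Q}$. *)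

(* Defs.v *)
From HB Require Import structures.
From mathcomp Require Import all_boot all_order all_algebra.
From mathcomp Require Import all_classical all_reals all_analysis ess_sup_inf.

Set Implicit Arguments.
Unset Strict Implicit.
Unset Printing Implicit Defensive.
Import Order.TTheory GRing.Theory Num.Theory.
Import numFieldNormedType.Exports.

Local Open Scope classical_set_scope.
Local Open Scope ring_scope.

(* Lebesgue measure on R^n. [borel_lebesgue n] is the n-fold product of the
   one-dimensional Lebesgue measure, on the Borel sets of [n.-tuple R], and
   [lebesgue_outer] is its outer measure carried over to row vectors. The
   measurable sets of [Rn R n] are the Caratheodory-measurable ones, i.e. the
   completed (Lebesgue) sigma-algebra; its topology is that of ['rV[R]_n]. *)
Section borel_lebesgue.
Context {R : realType}.
Let T := measurableTypeR R.

Definition cons_pair n (p : n.-tuple T * T) : n.+1.-tuple T :=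
  [the n.+1.-tuple T of p.2 :: p.1].

Lemma measurable_cons_pair n : measurable_fun setT (@cons_pair n).
Proof. exact: measurable_cons. Qed.

Definition product_step n (mu : {measure set (n.-tuple T) -> \bar R}) :
  {measure set (n.+1.-tuple T) -> \bar R}.
Proof.
unshelve refine (pushforward (product_measure1 mu (@lebesgue_measure R))
  (@cons_pair n) : {measure set (n.+1.-tuple T) -> \bar R}).
exact: measurable_cons_pair.
Defined.

Fixpoint borel_lebesgue n : {measure set (n.-tuple T) -> \bar R} :=
  if n is n'.+1 then product_step (borel_lebesgue n')
  else dirac ([tuple] : 0.-tuple T).

Definition row_of_tuple n (t : n.-tuple T) : 'rV[R]_n := \row_i tnth t i.

Definition lebesgue_outer n (A : set 'rV[R]_n) : \bar R :=
  mu_ext (borel_lebesgue n) (@row_of_tuple n @^-1` A).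

Let lebesgue_outer0 n : @lebesgue_outer n set0 = 0%E.
Proof. by rewrite /lebesgue_outer preimage_set0 outer_measure0. Qed.

Let lebesgue_outer_ge0 n A : (0 <= @lebesgue_outer n A)%E.
Proof. exact: outer_measure_ge0. Qed.

Let le_lebesgue_outer n :
  {homo @lebesgue_outer n : A B / A `<=` B >-> (A <= B)%E}.
Proof. by move=> A B AB; apply: le_outer_measure; exact: preimage_subset. Qed.

Let lebesgue_outer_sigma_subadditive n :
  sigma_subadditive (@lebesgue_outer n).
Proof.
move=> F; rewrite /lebesgue_outer preimage_bigcup.
exact: outer_measure_sigma_subadditive.
Qed.

HB.instance Definition _ n := isOuterMeasure.Build R 'rV[R]_n
  (@lebesgue_outer n) (@lebesgue_outer0 n) (@lebesgue_outer_ge0 n)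
  (@le_lebesgue_outer n) (@lebesgue_outer_sigma_subadditive n).

End borel_lebesgue.

Definition Rn (R : realType) (n : nat) : Type := 'rV[R]_n.

HB.instance Definition _ (R : realType) n :=
  PointedTopological.copy (Rn R n) 'rV[R]_n.
HB.instance Definition _ (R : realType) n :=
  Measurable.copy (Rn R n) (caratheodory_type (@lebesgue_outer R n)).

Definition lebesgue (R : realType) (n : nat) : set (Rn R n) -> \bar R :=
  @lebesgue_outer R n.

HB.instance Definition _ (R : realType) n := isMeasure.Build _ (Rn R n) R
  (@lebesgue R n) (@caratheodory_measure0 R _ (@lebesgue_outer R n))
  (@caratheodory_measure_ge0 R _ (@lebesgue_outer R n))
  (@caratheodory_measure_sigma_additive R _ (@lebesgue_outer R n)).

Section cubes.
Context {R : realType} {n : nat}.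

(* Cubes are half-open, [a, a + h)^n with corner a and side h > 0. *)
Definition cube := {Q : 'rV[R]_n * R | 0 < Q.2}.

Definition corner (Q : cube) : 'rV[R]_n := (val Q).1.
Definition side (Q : cube) : R := (val Q).2.

Definition cset (Q : cube) : set (Rn R n) :=
  [set x : 'rV[R]_n | forall i,
    corner Q 0 i <= x 0 i < corner Q 0 i + side Q].

(* P is one of the (2 ^ k) ^ n cubes of the k-th dyadic subdivision of Q, for
   some k (k = 0 gives Q itself). *)
Definition dyadic_descendant (Q P : cube) : Prop :=
  exists (k : nat) (j : 'I_n -> 'I_(2 ^ k)),
    side P = side Q / 2 ^+ k /\
    forall i, corner P 0 i = corner Q 0 i + (j i)%:R * side P.

Definition dyadic_lattice (D : set cube) : Prop :=
  [/\ forall Q P, D Q -> dyadic_descendant Q P -> D P,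
      forall Q1 Q2, D Q1 -> D Q2 -> exists Q,
        [/\ D Q, dyadic_descendant Q Q1 & dyadic_descendant Q Q2]
    & forall K : set (Rn R n), compact K -> exists Q, D Q /\ K `<=` cset Q].

Definition sparse (eta : R) (S : set cube) : Prop :=
  forall Q, S Q ->
    (lebesgue (\bigcup_(P in [set P | S P /\ cset P `<` cset Q]) cset P)
      <= (1 - eta)%:E * lebesgue (cset Q))%E.

End cubes.
Arguments cube : clear implicits.

Section averages.
Context {R : realType} {n : nat}.
Local Notation mu := (@lebesgue R n).
Implicit Types (Q : cube R n) (b f g w : Rn R n -> R).

Definition avg Q g : \bar R :=
  ((\int[mu]_(x in cset Q) (g x)%:E) / mu (cset Q))%E.

Definition mean Q g : R := fine (avg Q g).

Definition bmo_norm b : \bar R :=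
  ereal_sup [set avg Q (fun x => `|b x - mean Q b|) | Q in [set: cube R n]].

Definition bmo b : Prop :=
  [/\ measurable_fun setT b,
      forall K : set (Rn R n), compact K -> mu.-integrable K (EFin \o b)
    & (bmo_norm b < +oo)%E].

Definition bounded_compact_support f : Prop :=
  [/\ measurable_fun setT f, exists M : R, forall x, `|f x| <= M
    & compact (closure [set x | f x != 0])].

(* The quasinorm of L^{q,oo}(w), w standing for the measure w dx. *)
Definition weak_norm (q : R) w (g : Rn R n -> \bar R) : \bar R :=
  ereal_sup [set (lam%:E *
    (\int[mu]_(x in [set x | lam%:E < `|g x|]) (w x)%:E) `^ q^-1)%E
    | lam in [set lam : R | 0 < lam]].

(* Local integrability is not required here: it follows from membership in
   any of the classes below. *)
Definition weight w : Prop :=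
  measurable_fun setT w /\ {ae mu, forall x, 0 < w x}.

Definition conj_exponent (p : R) : R := p / (p - 1).

Definition Ap_const (p : R) w : \bar R :=
  ereal_sup [set (avg Q w *
    (avg Q (fun x => w x `^ (1 - conj_exponent p))%R) `^ (p - 1))%E
    | Q in [set: cube R n]].

Definition Ap (p : R) w : Prop := weight w /\ (Ap_const p w < +oo)%E.

Definition Ainfty w : Prop := exists p : R, 1 < p /\ Ap p w.

Definition ess_inf_cube Q w : \bar R :=
  ess_inf mu (fun x => if x \in cset Q then (w x)%:E else +oo%E).

Definition A1_const w : \bar R :=
  ereal_inf [set c%:E | c in [set c : R |
    forall Q, (avg Q w <= c%:E * ess_inf_cube Q w)%E]].

Definition geometric_mean m (w : 'I_m -> Rn R n -> R) (x : Rn R n) : R :=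
  \prod_(i < m) w i x `^ m%:R^-1.

(* The inverse is that of extended reals, where 0^-1 = +oo, whereas
   [0 `^ r] = 0 for r < 0. *)
Definition A1_vec m (w : 'I_m -> Rn R n -> R) : Prop :=
  (forall i, weight (w i)) /\
  (ereal_sup [set avg Q (geometric_mean w) *
     \prod_(i < m) (ess_inf_cube Q (w i) `^ m%:R^-1)^-1
     | Q in [set: cube R n]] < +oo)%E.

Definition llogl (t : R) : R := t * ln (expR 1 + t).

Definition llogl_norm Q f : \bar R :=
  ereal_inf [set lam%:E | lam in [set lam : R |
    0 < lam /\ (avg Q (fun x => llogl (`|f x| / lam)%R) <= 1)%E]].

Definition llogl_maximal m (f : 'I_m -> Rn R n -> R) (x : Rn R n) : \bar R :=
  ereal_sup [set (\prod_(i < m) llogl_norm Q (f i))%E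
    | Q in [set Q | cset Q x]].

End averages.

Section operators.
Context {R : realType} {n : nat}.
Local Notation mu := (@lebesgue R n).
Local Notation func := (Rn R n -> R).

(* T is an m-linear operator on D 0 x ... x D (m - 1), where each D i is a
   linear space of measurable functions; its values are measurable functions
   and are considered up to equality almost everywhere. Outside of this
   domain, T is arbitrary. *)
Definition multilinear_operator m (D : 'I_m -> set func)
    (T : ('I_m -> func) -> func) : Prop :=
  [/\ forall i g, D i g -> measurable_fun setT g,
      forall i (a : R) g h, D i g -> D i h -> D i (fun x => a * g x + h x),
      forall f, (forall i, D i (f i)) -> measurable_fun setT (T f)
    & forall f i (a : R) g h, (forall j, D j (f j)) -> D i g -> D i h ->
        {ae mu, forall x,
          T [eta f with i |-> fun y => a * g y + h y] x =
          a * T [eta f with i |-> g] x + T [eta f with i |-> h] x}].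

Definition commutator m (T : ('I_m -> func) -> func) (i : 'I_m) (b : func) :
    ('I_m -> func) -> func :=
  fun f x => b x * T f x - T [eta f with i |-> fun y => b y * f i y] x.

Definition iterated_commutator m l (lm : (l <= m)%N)
    (T : ('I_m -> func) -> func) (b : 'I_l -> func) :
    ('I_m -> func) -> func :=
  foldl (fun T' s => commutator T' (widen_ord lm s) (b s)) T (enum 'I_l).

(* The domain D contains every argument at which [iterated_commutator]
   evaluates T, for bounded and compactly supported f_1, ..., f_m. *)
Definition suitable_domain m l (lm : (l <= m)%N) (D : 'I_m -> set func)
    (b : 'I_l -> func) : Prop :=
  (forall i f, bounded_compact_support f -> D i f) /\
  (forall s f, bounded_compact_support f ->
     D (widen_ord lm s) (fun x => b s x * f x)).

(* [false] and [true] stand for the values 1 and 2 of gamma. *)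
Definition sparse_factor (b f : func) (Q : cube R n) (gamma : bool)
    (x : Rn R n) : \bar R :=
  if gamma then avg Q (fun y => `|(b y - mean Q b) * f y|)
  else (`|b x - mean Q b|%:E * avg Q (fun y => `|f y|)%R)%E.

Definition sparse_bound m l (lm : (l <= m)%N) (b : 'I_l -> func)
    (f : 'I_m -> func) (S : 'I_(3 ^ n) -> set (cube R n)) (x : Rn R n) :
    \bar R :=
  (\sum_(j < 3 ^ n) \sum_(gamma : {ffun 'I_l -> bool}) \esum_(Q in S j)
    ((\prod_(s < l) sparse_factor (b s) (f (widen_ord lm s)) Q (gamma s) x) *
     (\prod_(i < m | (l <= i)%N) avg Q (fun y => `|f i y|)%R) *
     (\1_(cset Q) x)%:E))%E.

Definition sparse_domination m l (lm : (l <= m)%N) (C eta : R)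
    (b : 'I_l -> func) (T : ('I_m -> func) -> func) : Prop :=
  forall f : 'I_m -> func, (forall i, bounded_compact_support (f i)) ->
  exists S : 'I_(3 ^ n) -> set (cube R n),
    (forall j, exists D, [/\ dyadic_lattice D, S j `<=` D & sparse eta (S j)])
    /\ {ae mu, forall x, (`|iterated_commutator lm T b f x|%:E
                            <= C%:E * sparse_bound lm b f S x)%E}.

End operators.

Section constants.
Context {R : realType}.

(* Below, u1 and vt are the constants [u]_{A_1} and [v^{1/m}]_{A_t}. *)
Definition p0 (n : nat) (t u1 : R) : R := 2 ^+ (n + 3) * (t - 1) * u1 + 1.

Definition K0 (n : nat) (Cn t u1 vt : R) : R :=
  let p := p0 n t u1 in
  4 * Cn * p * conj_exponent p *
    (u1 + 2 `^ (p - 1) * Cn `^ t * vt ^+ 2 * u1 `^ (p - 1)) + 1.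

End constants.

(* Main.v *)
(* The proof uses only dyadic tools: no maximal theorem and no extrapolation.
   Write W = v^(1/m), so that the measure is uW dx, and for a cube Q let
   a_Q^m be the product of the L(log L) averages of the f_i over Q.

   By the John-Nirenberg and Young inequalities, every term of the sparse
   bound is at most a constant times the product of the BMO norms times
   (a_Q osc_Q)^m on Q, where osc_Q is the maximum of 1 and of the normalized
   oscillations |b_s - <b_s>_Q| / ||b_s||. Since sums of m-th powers are at
   most m-th powers of sums, it suffices to bound the uW-measure of
   {sum_Q a_Q osc_Q 1_Q > W} by a constant times the least N such that
   {x in Q for some Q of the family, a_Q > s W(x)} has uW-measure at most N / s
   for all s > 0; this N is controlled by the maximal function.

   Split osc_Q into the layers {osc_Q ~ 2^i}, whose u-measure decays like
   exp(- c 2^i) by John-Nirenberg and a reverse Holder inequality for the A_1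
   weight u, also after multiplication by a small power of (W / <W>_Q)^(+-1),
   by the A_t condition. In each layer separate the cubes according to the
   ratio r_Q = a_Q / <W>_Q. The cubes with r_Q > 1 are handled by Chebyshev's
   inequality with an exponent 1 - e and subadditivity of x^(1-e). For the
   cubes with 2^-(k+1) < r_Q <= 2^-k, use the exponent 1 + e and the Carleson
   property of the sparse family with respect to u, then sum over k. In both
   cases the sum of <W>_Q u(Q) over {a_Q > k <W>_Q} is bounded by N / k because a
   fixed proportion of Q consists of points which lie in few cubes of the family
   and at which W is comparable to <W>_Q. *)
Require Import Defs.
From mathcomp Require Import all_boot all_order all_algebra.
From mathcomp Require Import all_classical all_reals all_analysis.
From mathcomp Require Import measurable_realfun ess_sup_inf ring lra.

Set Implicit Arguments.
Unset Strict Implicit.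
Unset Printing Implicit Defensive.
Import Order.TTheory GRing.Theory Num.Theory.
Import numFieldNormedType.Exports.

Local Open Scope classical_set_scope.
Local Open Scope ring_scope.

(** * Lebesgue measure of cubes *)

(** Exponent 1 is critical in Chebyshev's inequality here: it leads to the sum of [r_Q <W>_Q u(Q)],
    in which every dyadic range of [r_Q] may contribute as much as N, and there are infinitely many
    ranges. Moving the exponent off 1, down for large and up for small ratios, makes the ranges
    summable at the price of powers of [1/e]. The weights that remain are [u W^e] and [u W^(-e)].
    Averages of W and of [W^(-s)], with [s = 1/(t-1)], are controlled for Lebesgue measure only; the
    reverse Holder property carries small powers over to u, with an exponent [eps] of order
    [1/[u]_{A_1}]. Half of [eps] pays for W and half for the decay in the layers, whence
    [e = s eps / 2]. The constant obtained is polynomial in [[u]_{A_1}] and [t - 1], times [8^(t-1)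
    [v^(1/m)]_{A_t}^2]. The exponential [2^(p0-1)] in [K0] absorbs the polynomial, so the estimate
    for m-th roots costs one factor [K0] and the final one costs [K0^m]. The level sets in the weak
    norms are not known to be measurable: estimates are made on measurable sets and carried over by
    monotonicity of the integral. *)

Section lebesgue_cubes.
Context {R : realType}.
Let T := measurableTypeR R.

(** The outer measure of a set of rows is that of its preimage, so the Caratheodory condition at X
    is the condition for the preimages. *)
Lemma measurable_Rn n (A : set (Rn R n)) :
  measurable (@row_of_tuple R n @^-1` A : set (n.-tuple T)) -> measurable A.
Proof.
move=> mA.
have cA : caratheodory_measurable (mu_ext (borel_lebesgue n)) (@row_of_tuple R n @^-1` A).
  by apply: sub_caratheodory; exact: sub_sigma_algebra.
by move=> X; exact: (cA (@row_of_tuple R n @^-1` X)).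
Qed.

Lemma lebesgueE n (A : set (Rn R n)) :
  measurable (@row_of_tuple R n @^-1` A : set (n.-tuple T)) ->
  lebesgue A = borel_lebesgue n (@row_of_tuple R n @^-1` A).
Proof. by move=> mA; rewrite /lebesgue /lebesgue_outer measurable_mu_extE. Qed.

Definition box n (a : 'I_n -> R) (h : R) : set (n.-tuple T) :=
  [set t | forall i, a i <= tnth t i < a i + h].

Lemma measurable_box n (a : 'I_n -> R) h : measurable (box a h).
Proof.
have -> : box a h = \bigcap_(i in [set: 'I_n]) (@tnth n T ^~ i @^-1` `[a i, a i + h[%classic).
  apply/seteqP; split => t /= tb i.
    by move=> _ /=; rewrite in_itv/=; exact: tb.
  by have := tb i I; rewrite /= in_itv.
apply: fin_bigcap_measurable => // i _.
rewrite -[X in measurable X]setTI; exact: measurable_tnth.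
Qed.

Lemma borel_lebesgue_box n (a : 'I_n -> R) h : 0 <= h ->
  borel_lebesgue n (box a h) = (h ^+ n)%:E.
Proof.
move=> h0; elim: n => [|n IH] in a *.
  rewrite /= diracE expr0 mem_set//; by case.
rewrite /=/pushforward.
have -> : @cons_pair R n @^-1` box a h =
    box (fun i => a (lift ord0 i)) h `*` `[a ord0, a ord0 + h[%classic.
  apply/seteqP; split => -[t x] /=; rewrite /box/= in_itv/=.
    move=> H; split; last exact: (H ord0).
    by move=> i; have := H (lift ord0 i); rewrite tnthS.
  move=> [H1 H2] i; case: (unliftP ord0 i) => [j ->|->]; last by [].
  by rewrite tnthS.
rewrite product_measure1E//; last exact: measurable_box.
rewrite [X in (_ * X)%E](lebesgue_measure_itv `[a ord0, a ord0 + h[) IH/= lte_fin.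
case: ltP => [|ha].
  by rewrite -EFinB -EFinM addrAC subrr add0r exprSr.
have -> : h = 0 by apply/eqP; rewrite eq_le h0 andbT; lra.
by rewrite mule0 exprS mul0r.
Qed.

End lebesgue_cubes.

(** * Dyadic subcubes and dyadic lattices *)

Section dyadic_cubes.
Context {R : realType} {n : nat}.
Local Notation mu := (@lebesgue R n).
Implicit Types Q P : cube R n.

Lemma side_gt0 Q : 0 < side Q.
Proof. exact: (valP Q). Qed.

Definition vol Q : R := side Q ^+ n.

Lemma vol_gt0 Q : 0 < vol Q.
Proof. exact/exprn_gt0/side_gt0. Qed.

Lemma cset_boxE Q :
  @row_of_tuple R n @^-1` cset Q = box (corner Q 0) (side Q).
Proof.
by apply/seteqP; split => t /= H i; have := H i; rewrite mxE.
Qed.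

Lemma measurable_cset Q : measurable (cset Q).
Proof. by apply: measurable_Rn; rewrite cset_boxE; exact: measurable_box. Qed.

Lemma lebesgue_cset Q : mu (cset Q) = (vol Q)%:E.
Proof.
rewrite lebesgueE cset_boxE; last exact: measurable_box.
by rewrite borel_lebesgue_box// ltW// side_gt0.
Qed.

Lemma corner_cset Q : cset Q (corner Q).
Proof. by move=> i; rewrite lexx ltrDl side_gt0. Qed.

Lemma eq_cube Q P : corner Q = corner P -> side Q = side P -> Q = P.
Proof.
move=> c s; apply: val_inj; move: c s; rewrite /corner/side.
by case: (val Q) (val P) => [? ?] [? ?] /= -> ->.
Qed.

(** Finite functions make this a countable type, so the subcubes of a cube can be enumerated by
    [pickle]. *)
Definition dyadic_index := {k : nat & {ffun 'I_n -> 'I_(2 ^ k)}}.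

Fact subcube_subproof Q k (j : {ffun 'I_n -> 'I_(2 ^ k)}) :
  0 < (\row_i (corner Q 0 i + (j i)%:R * (side Q / 2 ^+ k)) : 'rV[R]_n,
       side Q / 2 ^+ k).2.
Proof. by rewrite divr_gt0 ?side_gt0 ?exprn_gt0. Qed.

Definition subcube Q k (j : {ffun 'I_n -> 'I_(2 ^ k)}) : cube R n :=
  exist (fun Q : 'rV[R]_n * R => is_true (0 < Q.2)) _ (subcube_subproof Q j).

Lemma side_subcube Q k (j : {ffun 'I_n -> 'I_(2 ^ k)}) :
  side (subcube Q j) = side Q / 2 ^+ k.
Proof. by []. Qed.

Lemma corner_subcube Q k (j : {ffun 'I_n -> 'I_(2 ^ k)}) i :
  corner (subcube Q j) 0 i = corner Q 0 i + (j i)%:R * (side Q / 2 ^+ k).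
Proof. by rewrite /corner /= mxE. Qed.

Lemma dyadic_descendantP Q P : dyadic_descendant Q P ->
  exists k (j : {ffun 'I_n -> 'I_(2 ^ k)}), P = subcube Q j.
Proof.
move=> [k [j [sP cP]]]; exists k, [ffun i => j i]; apply: eq_cube => //.
by apply/rowP => i; rewrite cP corner_subcube ffunE sP.
Qed.

Lemma vol_subcube Q k (j : {ffun 'I_n -> 'I_(2 ^ k)}) :
  vol (subcube Q j) = vol Q / (2 ^+ n) ^+ k.
Proof. by rewrite /vol side_subcube expr_div_n -!exprM mulnC. Qed.

Lemma mem_subcube Q k (x : Rn R n) : cset Q x ->
  exists j : {ffun 'I_n -> 'I_(2 ^ k)}, cset (subcube Q j) x.
Proof.
move=> Qx; have h0 := side_gt0 Q.
have h20 : 0 < side Q / 2 ^+ k by rewrite divr_gt0 ?exprn_gt0.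
pose y i := ((x : 'rV[R]_n) 0 i - corner Q 0 i) / (side Q / 2 ^+ k).
have y0 i : 0 <= y i.
  by rewrite divr_ge0 ?(ltW h20)// subr_ge0; case/andP: (Qx i).
have yk i : (Num.truncn (y i) < 2 ^ k)%N.
  have /andP[ty _] := truncn_itv (y0 i).
  rewrite -(@ltr_nat R); apply: (le_lt_trans ty).
  rewrite natrX ltr_pdivrMr// mulrCA mulfV ?mulr1 ?expf_neq0//.
  by case/andP: (Qx i) => _; rewrite addrC -ltrBlDr.
exists [ffun i => Ordinal (yk i)] => i.
rewrite corner_subcube side_subcube ffunE /=.
have /andP[] := truncn_itv (y0 i).
rewrite {2 4}/y ler_pdivlMr// ltr_pdivrMr// lerBrDl ltrBlDl => -> /=.
by rewrite -natr1 mulrDl mul1r addrA.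
Qed.

(** In units of the finer side [h] all endpoints are integers, up to the corner of Q. A common point
    gives strict inequalities between integers, and these improve by one unit because the intervals
    are half-open. *)
Lemma subcube_nested Q k k' (j : {ffun 'I_n -> 'I_(2 ^ k)})
    (j' : {ffun 'I_n -> 'I_(2 ^ k')}) (x : Rn R n) : (k <= k')%N ->
  cset (subcube Q j) x -> cset (subcube Q j') x ->
  cset (subcube Q j') `<=` cset (subcube Q j).
Proof.
move=> kk' xj xj' y yj' i; move: {xj xj' yj'}(xj i) (xj' i) (yj' i).
rewrite !corner_subcube !side_subcube.
set h := side Q / 2 ^+ k'.
have -> : side Q / 2 ^+ k = (2 ^ (k' - k))%:R * h.
  rewrite natrX /h; have := subnKC kk'; move: (k' - k)%N => d <-.
  by rewrite exprD; field; rewrite !expf_neq0.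
have h0 : 0 < h by rewrite divr_gt0 ?side_gt0 ?exprn_gt0.
set N := (2 ^ (k' - k))%N; set c := corner Q 0 i.
move=> /andP[a1 a2] /andP[b1 b2] /andP[c1 c2].
have l1 : (j' i < (j i).+1 * N)%N.
  rewrite -(@ltr_nat R) -(ltr_pM2r h0) natrM -natr1.
  by lra.
have l2 : (j i * N < (j' i).+1)%N.
  rewrite -(@ltr_nat R) -(ltr_pM2r h0) natrM -natr1.
  by lra.
have l1' : ((j' i)%:R + 1) * h <= ((j i)%:R + 1) * N%:R * h.
  by rewrite ler_pM2r// !natr1 -natrM ler_nat.
have l2' : (j i)%:R * N%:R * h <= (j' i)%:R * h.
  by rewrite ler_pM2r// -natrM ler_nat.
by apply/andP; split; lra.
Qed.

Lemma subcube_sub Q k (j : {ffun 'I_n -> 'I_(2 ^ k)}) :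
  cset (subcube Q j) `<=` cset Q.
Proof.
move=> x xj i; move: (xj i); rewrite corner_subcube side_subcube.
have k0 : 0 < (2 ^+ k : R) by rewrite exprn_gt0.
have l1 : (j i)%:R + 1 <= 2 ^+ k :> R.
  by rewrite -natrX natr1 ler_nat ltn_ord.
have j0 : 0 <= (j i)%:R :> R by [].
have hk : side Q / 2 ^+ k * 2 ^+ k = side Q by rewrite divfK ?gt_eqF.
have := side_gt0 Q; set h := side Q / 2 ^+ k in hk *.
have h0 : 0 < h by rewrite divr_gt0 ?side_gt0.
by rewrite -hk => _ /andP[? ?]; apply/andP; split; nra.
Qed.

Lemma subcube_parent Q k (j : {ffun 'I_n -> 'I_(2 ^ k.+1)}) :
  exists j' : {ffun 'I_n -> 'I_(2 ^ k)},
    cset (subcube Q j) `<=` cset (subcube Q j') /\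
    vol (subcube Q j') = 2 ^+ n * vol (subcube Q j).
Proof.
have Qj := corner_cset (subcube Q j).
have [j' j'P] := mem_subcube k (subcube_sub Qj).
exists j'; split; first exact: (subcube_nested (leqnSn k) j'P Qj).
rewrite !vol_subcube exprS; field.
by rewrite !expf_neq0//= expf_neq0.
Qed.

Definition bigsub Q (B : forall k, {ffun 'I_n -> 'I_(2 ^ k)} -> Prop) : set (Rn R n) :=
  [set x | exists k (j : {ffun 'I_n -> 'I_(2 ^ k)}), B k j /\ cset (subcube Q j) x].

(** Maximal cubes exist because the level k is bounded below, and they are disjoint by nestedness.
    The empty set is the value at all indices that code no maximal cube, which gives a sequence over
    [nat] fit for countable additivity. *)
Lemma maximal_subcubes Q (B : forall k, {ffun 'I_n -> 'I_(2 ^ k)} -> Prop) :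
  exists F : nat -> set (Rn R n), [/\ trivIset setT F,
    forall i, F i = set0 \/ exists k (j : {ffun 'I_n -> 'I_(2 ^ k)}),
      [/\ F i = cset (subcube Q j), B k j & forall k' (j' : {ffun 'I_n -> 'I_(2 ^ k')}),
        (k' < k)%N -> cset (subcube Q j) `<=` cset (subcube Q j') -> ~ B k' j']
    & \bigcup_i F i = bigsub Q B].
Proof.
pose sel (p : dyadic_index) := B (projT1 p) (projT2 p) /\
  forall k' (j' : {ffun 'I_n -> 'I_(2 ^ k')}), (k' < projT1 p)%N ->
    cset (subcube Q (projT2 p)) `<=` cset (subcube Q j') -> ~ B k' j'.
pose F i := if pickle_inv i is Some p then
   [set x | sel p /\ cset (subcube Q (projT2 (p : dyadic_index))) x] else set0.
exists F; split.
- have main i i' p p' x : pickle_inv i = Some p -> pickle_inv i' = Some p' ->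
     sel p -> sel p' -> cset (subcube Q (projT2 (p : dyadic_index))) x ->
     cset (subcube Q (projT2 (p' : dyadic_index))) x -> (projT1 p <= projT1 p')%N ->
     i = i'.
    move=> ip ip' [Bp sp] [Bp' sp'] px p'x; rewrite leq_eqVlt => /orP[/eqP pp'|lt].
      suff ppE : p = p'.
        by have := @pickle_invK dyadic_index i; have := @pickle_invK dyadic_index i'; rewrite ip ip' ppE /= => -> ->.
      clear -pp' px p'x; case: p p' pp' px p'x => [k j] [k' j'] /= kk; subst k'.
      move=> /= xj xj'; congr existT; apply/ffunP => s; apply/val_inj => /=.
      move: {xj xj'} (xj s) (xj' s); rewrite !corner_subcube !side_subcube.
      have h0 : 0 < side Q / 2 ^+ k by rewrite divr_gt0 ?side_gt0 ?exprn_gt0.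
      move=> /andP[a1 a2] /andP[b1 b2].
      have l1 : (j s < (j' s).+1)%N.
        by rewrite -(@ltr_nat R) -(ltr_pM2r h0) -natr1; nra.
      have l2 : (j' s < (j s).+1)%N.
        by rewrite -(@ltr_nat R) -(ltr_pM2r h0) -natr1; nra.
      by apply/eqP; rewrite eqn_leq; move: l1 l2; rewrite !ltnS => -> ->.
    exfalso; apply: (sp' _ _ lt _ Bp).
    exact: (subcube_nested (ltnW lt) px p'x).
  apply/trivIsetP => i i' _ _ /eqP ii'; apply/seteqP; split => // x [].
  rewrite /F; case pE : (pickle_inv i) => [p|//]; case pE' : (pickle_inv i') => [p'|//].
  move=> [sp xp] [sp' xp']; apply: ii'.
  have [le|/ltnW le] := leqP (projT1 p) (projT1 p').
    exact: main pE pE' sp sp' xp xp' le.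
  by apply/esym; exact: main pE' pE sp' sp xp' xp le.
- move=> i; rewrite /F; case pE : (pickle_inv i) => [[k j]|]; last by left.
  have [[/= sp sp']|nsp] := pselect (sel (existT _ k j)).
    right; exists k, j; split => //; apply/seteqP; split => x /=; first by case.
    by move=> xj; split => //; split.
  by left; apply/seteqP; split => x //= [].
- apply/seteqP; split => x.
    move=> [i _]; rewrite /F; case pE : (pickle_inv i) => [[k j]|//] [[Bkj _] xj].
    by exists k, j.
  move=> [k [j [Bkj xj]]].
  pose P k := `[< exists j : {ffun 'I_n -> 'I_(2 ^ k)}, B k j /\ cset (subcube Q j) x >].
  have exP : exists k, P k by exists k; apply/asboolP; exists j.
  case: (ex_minnP exP) => k0 /asboolP[j0 [Bj0 xj0]] min.
  exists (pickle (existT _ k0 j0 : dyadic_index)) => //; rewrite /F pickleK_inv.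
  split => //; split => //= k' j' k'k sub Bj'.
  have /min : P k' by apply/asboolP; exists j'; split => //; exact: sub.
  by rewrite leqNgt k'k.
Qed.

(** Fix one cube [Q0]. An ancestor of [Q0] is determined by the index of [Q0] in it (this is [anc]),
    and any cube of D has a common ancestor with [Q0]; so a pair of dyadic indices determines it. *)
Lemma dyadic_lattice_countable (D : set (cube R n)) : dyadic_lattice D -> countable D.
Proof.
move=> [_ common _].
have [[Q0 DQ0]|D0] := pselect (exists Q, D Q); last first.
  have -> : D = set0 by apply/seteqP; split => // Q DQ; apply: D0; exists Q.
  exact: countable0.
have anc0 (p : dyadic_index) : 0 < ((\row_i (corner Q0 0 i - (projT2 p i)%:R * side Q0) : 'rV[R]_n),
   side Q0 * 2 ^+ (projT1 p)).2.
  by rewrite /= mulr_gt0 ?side_gt0 ?exprn_gt0.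
pose anc p : cube R n := exist (fun Q : 'rV[R]_n * R => is_true (0 < Q.2)) _ (anc0 p).
pose g (p : dyadic_index * dyadic_index) : cube R n := subcube (anc p.1) (projT2 p.2).
have sub : D `<=` g @` setT.
  move=> Q DQ; have [Q' [_ Q'0 Q'Q]] := common _ _ DQ0 DQ.
  have [k [j Q0E]] := dyadic_descendantP Q'0.
  have [k' [j' QE]] := dyadic_descendantP Q'Q.
  exists (existT _ k j, existT _ k' j') => //.
  suff ancE : anc (existT _ k j) = Q' by rewrite /g /fst ancE -QE.
  have sE : side Q0 = side Q' / 2 ^+ k by rewrite Q0E side_subcube.
  apply: eq_cube; last by rewrite [LHS]/side /= sE divfK// expf_neq0.
  apply/rowP => i; transitivity (corner Q0 0 i - (j i)%:R * side Q0); first by rewrite [LHS]mxE.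
  rewrite sE Q0E corner_subcube.
  by rewrite addrK.
apply: (sub_countable (subset_card_le sub)).
apply: (@sub_countable _ _ _ [set: dyadic_index * dyadic_index]).
  exact: card_image_le.
exact: countableP.
Qed.

Lemma dyadic_lattice_nested (D : set (cube R n)) Q P (x : Rn R n) : dyadic_lattice D ->
  D Q -> D P -> side P <= side Q -> cset Q x -> cset P x -> cset P `<=` cset Q.
Proof.
move=> [_ common _] DQ DP sPQ Qx Px.
have [Q' [_ /dyadic_descendantP[k [j QE]] /dyadic_descendantP[k' [j' PE]]]] := common _ _ DQ DP.
subst Q P; apply: (subcube_nested _ Qx Px).
move: sPQ; rewrite !side_subcube ler_pM2l ?side_gt0// lef_pV2 ?posrE ?exprn_gt0//.
by rewrite ler_eXn2l// ltr1n.
Qed.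

Lemma dyadic_lattice_eq (D : set (cube R n)) Q P (x : Rn R n) : dyadic_lattice D ->
  D Q -> D P -> side P = side Q -> cset Q x -> cset P x -> P = Q.
Proof.
move=> lD DQ DP sPQ Qx Px.
have PQ : cset P `<=` cset Q by apply: (dyadic_lattice_nested lD DQ DP _ Qx Px); rewrite sPQ.
have QP : cset Q `<=` cset P by apply: (dyadic_lattice_nested lD DP DQ _ Px Qx); rewrite sPQ.
apply: eq_cube => //; apply/rowP => i; apply/eqP; rewrite eq_le.
have /(_ i)/andP[-> _] := PQ _ (corner_cset P).
by have /(_ i)/andP[-> _] := QP _ (corner_cset Q).
Qed.

End dyadic_cubes.

(** * Dyadic density and stopping cubes *)

Lemma sum_half_le1 (R : realFieldType) N : \sum_(i < N) (2 ^+ i.+1)^-1 <= 1 :> R.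
Proof.
suff -> : \sum_(i < N) (2 ^+ i.+1)^-1 = 1 - (2 ^+ N)^-1 :> R.
  by rewrite gerBl invr_ge0 exprn_ge0.
elim: N => [|N IH]; first by rewrite big_ord0 expr0 invr1 subrr.
by rewrite big_ord_recr/= IH exprS; field; rewrite expf_neq0.
Qed.

Section dyadic_density.
Context {R : realType} {n : nat}.
Local Notation mu := (@lebesgue R n).
Let T := measurableTypeR R.
Implicit Types Q P : cube R n.
Implicit Types A B U V Z : set (Rn R n).

(** The open sets of the topology on Q generated by its dyadic subcubes. Each one is a countable
    disjoint union of subcubes, which is what makes them useful as covers. *)
Definition dyadic_open Q U := forall x, U x ->
  exists k (j : {ffun 'I_n -> 'I_(2 ^ k)}),
    cset (subcube Q j) x /\ cset (subcube Q j) `<=` U.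

Lemma dyadic_open_sub Q U : dyadic_open Q U -> U `<=` cset Q.
Proof. by move=> oU x /oU[k [j [xj _]]]; exact: subcube_sub xj. Qed.

Lemma dyadic_open_disjoint Q U : dyadic_open Q U ->
  exists F : nat -> set (Rn R n), [/\ trivIset setT F,
    forall i, F i = set0 \/ exists k (j : {ffun 'I_n -> 'I_(2 ^ k)}),
      F i = cset (subcube Q j) & \bigcup_i F i = U].
Proof.
move=> oU; have [F [tF Fsub FE]] :=
  maximal_subcubes Q (fun k j => cset (subcube Q (k := k) j) `<=` U).
exists F; split => //.
  by move=> i; have [->|[k [j [-> _ _]]]] := Fsub i; [left|right; exists k, j].
rewrite FE; apply/seteqP; split => x.
  by move=> [k [j [sU xj]]]; exact: sU.
by move=> /oU[k [j [xj sU]]]; exists k, j.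
Qed.

Lemma measurable_dyadic_open Q U : dyadic_open Q U -> measurable U.
Proof.
move=> /dyadic_open_disjoint[F [_ FE <-]]; apply: bigcupT_measurable => i.
by have [->|[k [j ->]]] := FE i; [exact: measurable0|exact: measurable_cset].
Qed.

Lemma dyadic_openI Q U V : dyadic_open Q U -> dyadic_open Q V ->
  dyadic_open Q (U `&` V).
Proof.
move=> oU oV x [Ux Vx].
have [k [j [xj sU]]] := oU _ Ux; have [k' [j' [xj' sV]]] := oV _ Vx.
have [kk'|/ltnW kk'] := leqP k k'.
  exists k', j'; split => // y yj'; split; last exact: sV.
  by apply: sU; exact: (subcube_nested kk' xj xj').
exists k, j; split => // y yj; split; first exact: sU.
by apply: sV; exact: (subcube_nested kk' xj' xj).
Qed.

Lemma dyadic_open_bigcup Q (F : nat -> set (Rn R n)) :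
  (forall i, dyadic_open Q (F i)) -> dyadic_open Q (\bigcup_i F i).
Proof.
move=> oF x [i _ /(oF i)[k [j [xj sF]]]]; exists k, j; split => // y yj.
by exists i => //; exact: sF.
Qed.

Lemma dyadic_open_cset Q : dyadic_open Q (cset Q).
Proof.
move=> x Qx; have [j xj] := mem_subcube 0 Qx; exists 0%N, j; split => //.
exact: subcube_sub.
Qed.

Lemma dyadic_open_subcube Q k (j : {ffun 'I_n -> 'I_(2 ^ k)}) :
  dyadic_open Q (cset (subcube Q j)).
Proof. by move=> x xj; exists k, j; split. Qed.

Lemma dyadic_open_setD_subcube Q k (j : {ffun 'I_n -> 'I_(2 ^ k)}) :
  dyadic_open Q (cset Q `\` cset (subcube Q j)).
Proof.
move=> x [Qx xj]; have [j' xj'] := mem_subcube k Qx.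
exists k, j'; split => // y yj'; split; first exact: subcube_sub yj'.
by move=> yj; apply: xj; apply: (subcube_nested (leqnn k) yj yj').
Qed.

(** A subcube around x of side less than [c - x_i] stays in the half-space. The rays []-oo, c[]
    generate the Borel sets of the line, which is why this half-space is the one considered. *)
Lemma dyadic_open_halfspace Q i (c : R) :
  dyadic_open Q (cset Q `&` [set x : Rn R n | (x : 'rV[R]_n) 0 i < c]).
Proof.
move=> x [Qx /= xc].
pose d := side Q / (c - (x : 'rV[R]_n) 0 i).
have d0 : 0 <= d by rewrite divr_ge0 ?(ltW (side_gt0 Q))// subr_ge0 ltW.
pose k := Num.truncn d.
have [j xj] := mem_subcube k.+1 Qx.
have hk : side Q / 2 ^+ k.+1 < c - (x : 'rV[R]_n) 0 i.
  rewrite ltr_pdivrMr ?exprn_gt0// mulrC -ltr_pdivrMr ?subr_gt0//.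
  have /andP[_ dk] := truncn_itv d0; apply: (lt_le_trans dk).
  by rewrite -natrX ler_nat ltnW// ltn_expl.
exists k.+1, j; split => // y yj; split; first exact: subcube_sub yj.
move: (xj i) (yj i); rewrite /= !side_subcube => /andP[? ?] /andP[? ?].
by move: hk; lra.
Qed.

(** Regularity in a form symmetric in B and its complement: both are covered by dyadic open sets
    with a small overlap. Closure under complements is then immediate, and a sigma-algebra argument
    becomes possible. *)
Definition dyadic_regular Q B := forall e : R, 0 < e -> exists U V,
  [/\ dyadic_open Q U, dyadic_open Q V, cset Q `&` B `<=` U,
      cset Q `\` B `<=` V & (mu (U `&` V) <= e%:E)%E].

Lemma dyadic_regularC Q B : dyadic_regular Q B -> dyadic_regular Q (~` B).
Proof.
move=> rB e /rB[U [V [oU oV sU sV UV]]]; exists V, U; split => //.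
  by move=> x [Qx Bx]; apply: sU; split => //; exact: contrapT.
by rewrite setIC.
Qed.

Lemma dyadic_regular_subcube Q k (j : {ffun 'I_n -> 'I_(2 ^ k)}) :
  dyadic_regular Q (cset (subcube Q j)).
Proof.
move=> e e0; exists (cset (subcube Q j)), (cset Q `\` cset (subcube Q j)).
split => //.
- exact: dyadic_open_subcube.
- exact: dyadic_open_setD_subcube.
- by rewrite setDE setICA setICr setI0 measure0 lee_fin ltW.
Qed.

Lemma dyadic_regular0 Q : dyadic_regular Q set0.
Proof.
move=> e e0; exists set0, (cset Q); split => //.
- exact: dyadic_open_cset.
- by rewrite set0I measure0 lee_fin ltW.
Qed.

(** Half of [e] is spent on the overlaps of the pairs [U i], [V i], the other half on the part of
    the union of all [U i] missed by the first [N + 1] of them. *)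
Lemma dyadic_regular_bigcup Q (B : nat -> set (Rn R n)) :
  (forall i, dyadic_regular Q (B i)) -> dyadic_regular Q (\bigcup_i B i).
Proof.
move=> rB e e0; have e20 i : 0 < e / 2 / 2 ^+ i.+1 by rewrite !divr_gt0 ?exprn_gt0.
have /choice[UV UVP] : forall i, exists W : set (Rn R n) * set (Rn R n),
  [/\ dyadic_open Q W.1, dyadic_open Q W.2, cset Q `&` B i `<=` W.1,
      cset Q `\` B i `<=` W.2 & (mu (W.1 `&` W.2) <= (e / 2 / 2 ^+ i.+1)%:E)%E].
  by move=> i; have [U [V H]] := rB i _ (e20 i); exists (U, V).
pose U i := (UV i).1; pose V i := (UV i).2.
have oU i : dyadic_open Q (U i) by have [] := UVP i.
have oV i : dyadic_open Q (V i) by have [] := UVP i.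
have mU i : measurable (U i) := measurable_dyadic_open (oU i).
have mV i : measurable (V i) := measurable_dyadic_open (oV i).
pose UN N := \big[setU/set0]_(i < N.+1) U i.
have mUN N : measurable (UN N) by exact: bigsetU_measurable.
have UNnd : nondecreasing_seq UN.
  by move=> a b ab; apply/subsetPset; exact: subset_bigsetU.
have UNE : \bigcup_i UN i = \bigcup_i U i by exact: bigcup_bigsetU_bigcup.
have oUU : dyadic_open Q (\bigcup_i U i) by exact: dyadic_open_bigcup.
have mUU := measurable_dyadic_open oUU.
have UUfin : mu (\bigcup_i U i) \is a fin_num.
  rewrite ge0_fin_numE//; apply: (@le_lt_trans _ _ (mu (cset Q))).
    by rewrite le_measure ?inE//; [exact: measurable_cset|exact: dyadic_open_sub].
  by rewrite lebesgue_cset ltry.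
have e20' : 0 < e / 2 by rewrite divr_gt0.
have [N UNN] : exists N, (mu (\bigcup_i U i) - (e / 2)%:E < mu (UN N))%E.
  have cUN := nondecreasing_cvg_mu (mu := mu) mUN (bigcupT_measurable _ mUN) UNnd.
  have sUN := ereal_nondecreasing_cvgn (u_ := mu \o UN).
  have ndmu : nondecreasing_seq (mu \o UN).
    move=> a b ab /=; rewrite le_measure ?inE//; exact/subsetPset/UNnd.
  have supE := cvg_unique (@ereal_hausdorff R) cUN (sUN ndmu); rewrite UNE in supE.
  have := ub_ereal_sup_adherent e20' (S := range (mu \o UN)).
  rewrite -supE => /(_ UUfin) [_ [N _ <-] HN]; by exists N.
(* An infinite intersection of the [V i] need not be dyadic open, hence the truncation at N. *)
pose VN := \bigcap_(i in `I_N.+1) V i.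
have oVN : dyadic_open Q (cset Q `&` VN).
  rewrite /VN; elim: N.+1 => [|M IH].
    by rewrite II0 bigcap_set0 setIT; exact: dyadic_open_cset.
  rewrite IIS bigcap_setU bigcap_set1 setIA.
  exact: dyadic_openI.
exists (\bigcup_i U i), (cset Q `&` VN); split => //.
- move=> x [Qx [i _ Bx]]; exists i => //.
  by have [_ _ sU _ _] := UVP i; exact: sU.
- move=> x [Qx Bx]; split => // i _; have [_ _ _ sV _] := UVP i; apply: sV.
  by split => // Bix; apply: Bx; exists i.
have mW i : measurable (U i `&` V i) by exact: measurableI.
have mS : measurable (\big[setU/set0]_(i < N.+1) (U i `&` V i)).
  exact: bigsetU_measurable.
have sub : \bigcup_i U i `&` (cset Q `&` VN) `<=`
    (\bigcup_i U i `\` UN N) `|` \big[setU/set0]_(i < N.+1) (U i `&` V i).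
  move=> x [UUx [Qx VNx]]; have [UNx|UNx] := pselect (UN N x); last by left.
  right; move: UNx; rewrite /UN -bigcup_mkord => -[i iN Uix].
  by rewrite -(bigcup_mkord _ (fun i => U i `&` V i)); exists i => //; split => //; exact: VNx.
have mD : measurable (\bigcup_i U i `\` UN N) by exact: measurableD.
apply: (@le_trans _ _ (mu ((\bigcup_i U i `\` UN N) `|`
    \big[setU/set0]_(i < N.+1) (U i `&` V i)))).
  rewrite le_measure ?inE//; last exact: measurableU.
  by apply: measurableI => //; exact: measurable_dyadic_open oVN.
apply: (le_trans (measureU2 _ _ _)) => //.
rewrite (splitr e) EFinD; apply: leeD.
  rewrite measureD//; last by rewrite ltey_eq UUfin.
  rewrite (_ : _ `&` _ = UN N); last first.
    by apply/setIidr; rewrite -UNE; exact: bigcup_sup.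
  have UNfin : mu (UN N) \is a fin_num.
    rewrite ge0_fin_numE//; apply: (@le_lt_trans _ _ (mu (\bigcup_i U i))).
      by rewrite le_measure ?inE//; rewrite -UNE; exact: bigcup_sup.
    by rewrite -ge0_fin_numE.
  rewrite leeBlDr//; move: UNN; rewrite lteBlDr// addeC => /ltW.
  by rewrite addeC.
apply: (le_trans (content_subadditive mu (F := fun i => U i `&` V i) (n := N.+1)
  (fun k _ => mW k) mS (@subset_refl _ _))).
apply: (@le_trans _ _ (\sum_(i < N.+1) (e / 2 / 2 ^+ i.+1)%:E)%E).
  by apply: lee_sum => i _; have [_ _ _ _] := UVP i.
rewrite sumEFin lee_fin -mulr_sumr ger_pMr//.
exact: sum_half_le1.
Qed.

Lemma dyadic_regular_eq Q A B : cset Q `&` A = cset Q `&` B ->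
  dyadic_regular Q A -> dyadic_regular Q B.
Proof.
move=> AB rA e /rA[U [V [oU oV sU sV UV]]]; exists U, V; split => //.
  by rewrite -AB.
move=> x [Qx Bx]; apply: sV; split => // Ax; apply: Bx.
by have [] : (cset Q `&` B) x by rewrite -AB.
Qed.

Lemma dyadic_regular_open Q U : dyadic_open Q U -> dyadic_regular Q U.
Proof.
move=> /dyadic_open_disjoint[F [_ FE <-]]; apply: dyadic_regular_bigcup => i.
have [->|[k [j ->]]] := FE i; first exact: dyadic_regular0.
exact: dyadic_regular_subcube.
Qed.

Definition tuple_of_row (x : Rn R n) : n.-tuple T :=
  [tuple (x : 'rV[R]_n) 0 i | i < n].

Lemma tuple_of_rowK : cancel tuple_of_row (@row_of_tuple R n).
Proof. by move=> x; apply/rowP => i; rewrite mxE tnth_mktuple. Qed.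

Lemma row_of_tupleK : cancel (@row_of_tuple R n) tuple_of_row.
Proof. by move=> t; apply/eq_from_tnth => i; rewrite tnth_mktuple mxE. Qed.

Lemma dyadic_regular_borel Q (B : set (n.-tuple T)) : measurable B ->
  dyadic_regular Q (tuple_of_row @^-1` B).
Proof.
pose G : set (set (n.-tuple T)) := [set B | dyadic_regular Q (tuple_of_row @^-1` B)].
suff : measurable `<=` G by move=> sG mB; exact: (sG _ mB).
have sigG : sigma_algebra setT G.
  split; first by rewrite /G/= preimage_set0; exact: dyadic_regular0.
    by move=> A GA; rewrite setTD /G/= preimage_setC; exact: dyadic_regularC.
  by move=> F GF; rewrite /G/= preimage_bigcup; exact: dyadic_regular_bigcup.
apply: smallest_sub => // A; rewrite -bigcup_seq => -[i _ [D mD <-]].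
rewrite setTI.
(* A generator of the product sigma-algebra is a cylinder over a Borel set D of the line; a second
   sigma-algebra argument, now in D, reduces the claim to rays. *)
pose H : set (set R) := [set D | G ((fun t : n.-tuple T => tnth t i) @^-1` D)].
suff : measurable `<=` H by move=> sH; exact: (sH _ mD).
have sigH : sigma_algebra setT H.
  have [G0 GC GU] := sigG; split; first by rewrite /H/= preimage_set0.
    by move=> A' /= /GC; rewrite /H/= !setTD preimage_setC.
  by move=> F GF; rewrite /H/= preimage_bigcup; exact: GU.
move=> E mE; have : (@RGenInftyO.G R).-sigma.-measurable E.
  by rewrite -RGenInftyO.measurableE.
move: E {mE}; apply: smallest_sub => // _ [c ->].
rewrite /H/G/=; have := @dyadic_open_halfspace Q i c.
move=> /dyadic_regular_open; apply: dyadic_regular_eq.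
rewrite setIA setIid; apply/seteqP; split => x [Qx] /=.
  by rewrite tnth_mktuple in_itv.
by rewrite tnth_mktuple in_itv.
Qed.

(** A weak form of the Lebesgue density theorem that needs no maximal function. Cover Z by a dyadic
    open set of measure at most [mu Z + e] and add up the hypothesis over its disjoint subcubes:
    [mu Z <= th (mu Z + e)] for every e. *)
Lemma dyadic_density Q Z (th : R) : measurable Z -> Z `<=` cset Q ->
  0 <= th -> th < 1 ->
  (forall k (j : {ffun 'I_n -> 'I_(2 ^ k)}),
     mu (Z `&` cset (subcube Q j)) <= th%:E * mu (cset (subcube Q j)))%E ->
  mu Z = 0%E.
Proof.
move=> mZ ZQ th0 th1 H.
have Zfin : mu Z \is a fin_num.
  rewrite ge0_fin_numE//; apply: (@le_lt_trans _ _ (mu (cset Q))).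
    by rewrite le_measure ?inE//; exact: measurable_cset.
  by rewrite lebesgue_cset ltry.
have key e : 0 < e -> (mu Z <= th%:E * (mu Z + e%:E))%E.
  move=> e0; have e20 : 0 < e / 2 by rewrite divr_gt0.
  have [_ [C [mC ZC] <-]] := lb_ereal_inf_adherent e20 Zfin.
  rewrite -/(mu_ext _ _) -/(lebesgue_outer Z) -/(lebesgue Z) => Ce.
  pose B : set (Rn R n) := tuple_of_row @^-1` (\bigcup_i C i).
  have mBC : measurable (\bigcup_i C i) by apply: bigcupT_measurable.
  have preB : @row_of_tuple R n @^-1` B = \bigcup_i C i.
    by rewrite /B -comp_preimage (_ : _ \o _ = id)//; apply/funext => t /=; rewrite row_of_tupleK.
  have mB : measurable B by apply: measurable_Rn; rewrite preB.
  have ZB : Z `<=` B.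
    by move=> x Zx; rewrite /B/=; apply: ZC; rewrite /= tuple_of_rowK.
  have muB : (mu B <= mu Z + (e / 2)%:E)%E.
    rewrite lebesgueE preB//; apply/ltW; apply: le_lt_trans Ce.
    exact: measure_sigma_subadditive.
  have [U [V [oU oV sU sV UV]]] := dyadic_regular_borel Q mBC e20.
  have mU := measurable_dyadic_open oU; have mV := measurable_dyadic_open oV.
  (* A point of U outside B lies in V as well, so U exceeds B by the small overlap only. *)
  have muU : (mu U <= mu Z + e%:E)%E.
    apply: (@le_trans _ _ (mu (B `|` (U `&` V)))).
      rewrite le_measure ?inE//; first by apply: measurableU => //; exact: measurableI.
      move=> x Ux; have [Bx|Bx] := pselect (B x); [by left|right].
      by split => //; apply: sV; split => //; exact: dyadic_open_sub oU _ Ux.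
    apply: le_trans (measureU2 _ _ _) _ => //; first exact: measurableI.
    by rewrite (splitr e) EFinD addeA; apply: leeD.
  have [F [tF FE FU]] := dyadic_open_disjoint oU.
  have mF i : measurable (F i).
    by have [->|[k [j ->]]] := FE i; [exact: measurable0|exact: measurable_cset].
  apply: (@le_trans _ _ (th%:E * mu U)%E); last by rewrite lee_wpmul2l.
  have -> : Z = \bigcup_i (Z `&` F i).
    rewrite -setI_bigcupr FU; apply/esym/setIidl => x Zx.
    by apply: sU; split; [exact: ZQ|exact: ZB].
  rewrite -FU !measure_bigcup//; last 2 first.
    by move=> i _; exact: measurableI.
    exact: trivIset_setIl.
  rewrite -nneseriesZl//.
  apply: lee_nneseries => // i _.
  by have [->|[k [j ->]]] := FE i; [rewrite setI0 measure0 mule0|exact: H].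
have Z0 : (0 <= mu Z)%E by exact: measure_ge0.
move: Zfin key Z0; case: (mu Z) => [z| |]// _ key; rewrite lee_fin => z0.
congr EFin; apply/eqP; rewrite eq_le z0 andbT leNgt; apply/negP => zp.
(* With [e = (1 - th) z] the bound reads [z <= (1 - (1 - th)^2) z], which is absurd for [z > 0]. *)
have /key : 0 < (1 - th) * z by rewrite mulr_gt0// subr_gt0.
have : 0 < (1 - th) * ((1 - th) * z) by rewrite !mulr_gt0// subr_gt0.
rewrite -EFinD -EFinM lee_fin; nra.
Qed.

(** The stopping cubes are the maximal subcubes in which E has density above [2^-(n+1)]. The parent
    of such a cube has density at most [2^-(n+1)], and passing to a child multiplies this by at most
    [2^n], so E fills at most half of a stopping cube. What they miss of E has density at most 1/2
    in every subcube and is null. *)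
Lemma dyadic_calderon_zygmund Q E : measurable E -> E `<=` cset Q ->
  ((2 ^+ n.+1)%:E * mu E <= mu (cset Q))%E ->
  exists F : nat -> set (Rn R n), [/\ trivIset setT F,
    forall i, F i = set0 \/ exists P, [/\ F i = cset P, cset P `<=` cset Q,
       (2%:E * mu (E `&` cset P) <= mu (cset P))%E &
       (mu (cset P) <= (2 ^+ n.+1)%:E * mu (E `&` cset P))%E]
    & mu (E `\` \bigcup_i F i) = 0%E].
Proof.
move=> mE EQ EQle.
pose B k (j : {ffun 'I_n -> 'I_(2 ^ k)}) :=
  (mu (cset (subcube Q j)) < (2 ^+ n.+1)%:E * mu (E `&` cset (subcube Q j)))%E.
have mEI P : measurable (E `&` cset P) by apply: measurableI => //; exact: measurable_cset.
have [F [tF FE FU]] := maximal_subcubes Q B.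
exists F; split => //.
  move=> i; have [->|[k [j [-> Bj max]]]] := FE i; [by left|right].
  exists (subcube Q j); split => //; [exact: subcube_sub| |exact: ltW].
  (* Level 0 has no parent, but there the cube is Q itself, excluded by the density hypothesis. *)
  case: k => [|k] in j Bj max *.
    exfalso; move: Bj; rewrite /B ltNge => /negP; apply.
    rewrite lebesgue_cset vol_subcube expr0 divr1 -lebesgue_cset.
    apply: le_trans EQle; rewrite lee_wpmul2l// ?lee_fin ?exprn_ge0//.
    by rewrite le_measure ?inE//; exact: subIsetl.
  have [j' [sub volE]] := subcube_parent Q j.
  have := max _ j' (ltnSn k) sub; rewrite /B => /negP; rewrite -leNgt => H.
  have {H} : ((2 ^+ n.+1)%:E * mu (E `&` cset (subcube Q j)) <= (2 ^+ n)%:E * mu (cset (subcube Q j)))%E.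
    rewrite [in leRHS]lebesgue_cset -EFinM -volE -lebesgue_cset; apply: le_trans H.
    rewrite lee_wpmul2l// ?lee_fin ?exprn_ge0// le_measure ?inE//.
    exact: setIS.
  by rewrite exprSr EFinM -muleA lee_pmul2l// lte_fin exprn_gt0.
rewrite FU; have mBs : measurable (bigsub Q B).
  rewrite -FU; apply: bigcupT_measurable => i.
  by have [->|[k [j [-> _ _]]]] := FE i; [exact: measurable0|exact: measurable_cset].
apply: (@dyadic_density Q _ 2^-1) => //; [exact: measurableD| | |].
- by move=> x [/EQ].
- by rewrite invf_lt1// ltr1n.
move=> k j; have [Bj|Bj] := pselect (B k j).
  rewrite (_ : _ `&` _ = set0) ?measure0 ?mule_ge0//; apply/seteqP; split => // x [[_ nb] xj].
  by apply: nb; exists k, j.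
apply: (@le_trans _ _ (mu (E `&` cset (subcube Q j)))).
  rewrite le_measure ?inE//; last by apply: setSI => x [].
  by apply: measurableI; [exact: measurableD|exact: measurable_cset].
move: Bj; rewrite /B => /negP; rewrite -leNgt lebesgue_cset => H.
have : ((2 ^+ n.+1)%:E * mu (E `&` cset (subcube Q j)) <= (2 ^+ n.+1)%:E * (2^-1 * vol (subcube Q j))%:E)%E.
  apply: (le_trans H); rewrite -EFinM lee_fin exprSr mulrA mulfK//.
  by rewrite ler_peMl ?(ltW (vol_gt0 _))// exprn_ege1// ler1n.
by rewrite lee_pmul2l// ?lte_fin ?exprn_gt0.
Qed.
End dyadic_density.

(** * Weighted integrals *)

Section real_inequalities.
Context {R : realType}.
Implicit Types x a : R.

(* AM-GM, from [1 + z <= expR z] at [(1 - a) * ln x] and [- a * ln x]. *)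
Lemma powR_le_tangent x a : 0 <= x -> 0 <= a <= 1 -> x `^ a <= 1 + a * (x - 1).
Proof.
move=> x0 /andP[a0 a1]; have [->|xn0] := eqVneq x 0.
  have [->|an0] := eqVneq a 0; first by rewrite powRr0 mul0r addr0.
  by rewrite powR0//; lra.
have xp : 0 < x by rewrite lt_neqAle eq_sym xn0.
rewrite /powR (negbTE xn0); set y := ln x.
have -> : x = expR y by rewrite lnK.
have h1 := expR_ge1Dx (y - a * y); have h2 := expR_ge1Dx (- (a * y)).
have s0 := expR_gt0 (a * y).
have e1 : expR y = expR (a * y) * expR (y - a * y) by rewrite -expRD addrC subrK.
have e2 : 1 = expR (a * y) * expR (- (a * y)) by rewrite expRxMexpNx_1.
have h : 1 <= a * expR (y - a * y) + (1 - a) * expR (- (a * y)) by nra.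
have e3 : expR (a * y) * (a * expR (y - a * y) + (1 - a) * expR (- (a * y))) =
    a * (expR (a * y) * expR (y - a * y)) +
    (1 - a) * (expR (a * y) * expR (- (a * y))) by ring.
have := ler_wpM2l (ltW s0) h; rewrite mulr1 e3 -e1 -e2; lra.
Qed.

Lemma powRN_ge_tangent x a : 0 < x -> 0 <= a -> 1 - a * (x - 1) <= x `^ (- a).
Proof.
move=> x0 a0; rewrite /powR gt_eqF//.
have := expR_ge1Dx (- a * ln x); have := expR_ge1Dx (ln x).
by rewrite lnK//; nra.
Qed.

(** With halving of the measure at each level, growth by [exp(1/3)] per level still gives a ratio of
    at most 3/4 in [john_nirenberg_exp]. *)
Lemma expR_third : expR (3^-1 : R) <= 3 / 2.
Proof.
have := expR_ge1Dx (- 3^-1 : R); rewrite expRN => h.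
rewrite -[leLHS]invrK -[leRHS]invrK lef_pV2 ?posrE ?invr_gt0 ?expR_gt0//.
by apply: le_trans h; lra.
Qed.

End real_inequalities.

Section weighted_integrals.
Context {R : realType} {d : measure_display} {T : measurableType d}.
Variable mu : {measure set T -> \bar R}.
Implicit Types E F Q : set T.
Implicit Types u f g b : T -> R.

Lemma measurable_ge f (c : R) : measurable_fun setT f ->
  measurable [set x | c <= f x].
Proof.
move=> mf; rewrite -[X in measurable X]setTI.
rewrite (_ : [set x | _] = f @^-1` `[c, +oo[%classic); first exact: mf.
by apply/seteqP; split => x /=; rewrite in_itv/= andbT.
Qed.

Lemma measurable_gt f (c : R) : measurable_fun setT f ->
  measurable [set x | c < f x].
Proof.
move=> mf; rewrite -[X in measurable X]setTI.
rewrite (_ : [set x | _] = f @^-1` `]c, +oo[%classic); first exact: mf.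
by apply/seteqP; split => x /=; rewrite in_itv/= andbT.
Qed.
Lemma measurable_powRf f (p : R) : measurable_fun setT f ->
  measurable_fun setT (fun x => f x `^ p).
Proof. by move=> mf; exact: (measurableT_comp (measurable_powR p) mf). Qed.

Definition wint u E : \bar R := (\int[mu]_(x in E) (u x)%:E)%E.

Lemma wint_ge0 u E : (forall x, 0 <= u x) -> (0 <= wint u E)%E.
Proof. by move=> u0; apply: integral_ge0 => x _; rewrite lee_fin. Qed.

Lemma wint_sub u E F : measurable_fun setT u -> (forall x, 0 <= u x) ->
  measurable E -> measurable F -> E `<=` F -> (wint u E <= wint u F)%E.
Proof.
move=> mf u0 mE mF EF; apply: ge0_subset_integral => //.
  by apply/measurable_EFinP; exact: measurable_funTS.
by move=> x _; rewrite lee_fin.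
Qed.

Lemma wint_le u f E : measurable_fun setT u -> measurable_fun setT f ->
  (forall x, 0 <= u x) -> measurable E ->
  (forall x, E x -> u x <= f x) -> (wint u E <= wint f E)%E.
Proof.
move=> mu' mf u0 mE uf; apply: ge0_le_integral => //.
- by move=> x _; rewrite lee_fin.
- by apply/measurable_EFinP; exact: measurable_funTS.
- by apply/measurable_EFinP; exact: measurable_funTS.
Qed.

Lemma wintZ (c : R) u E : measurable_fun setT u -> (forall x, 0 <= u x) ->
  measurable E -> 0 <= c -> wint (fun x => c * u x) E = (c%:E * wint u E)%E.
Proof.
move=> mf u0 mE c0; rewrite /wint.
under eq_integral do rewrite EFinM.
rewrite ge0_integralZl_EFin//; first by move=> x _; rewrite lee_fin.
by apply/measurable_EFinP; exact: measurable_funTS.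
Qed.

Lemma wintD u f E : measurable_fun setT u -> measurable_fun setT f ->
  (forall x, 0 <= u x) -> (forall x, 0 <= f x) -> measurable E ->
  wint (fun x => u x + f x) E = (wint u E + wint f E)%E.
Proof.
move=> mf mg u0 f0 mE; rewrite /wint.
under eq_integral do rewrite EFinD.
by rewrite ge0_integralD// => *; rewrite ?lee_fin//;
  apply/measurable_EFinP; exact: measurable_funTS.
Qed.

Lemma wint_sum (I : Type) (r : seq I) (f : I -> T -> R) E :
  (forall i, measurable_fun setT (f i)) -> (forall i x, 0 <= f i x) ->
  measurable E ->
  wint (fun x => \sum_(i <- r) f i x) E = (\sum_(i <- r) wint (f i) E)%E.
Proof.
move=> mf f0 mE; rewrite /wint.
under eq_integral do rewrite -sumEFin.
rewrite ge0_integral_sum//; last by move=> i x _; rewrite lee_fin.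
by move=> i; apply/measurable_EFinP; exact: measurable_funTS.
Qed.

Lemma wint_cst1 E : measurable E -> wint (fun=> 1) E = mu E.
Proof. by move=> mE; rewrite /wint integral_cst// mul1e. Qed.

Lemma wint_indic u E F : measurable_fun setT u ->
  measurable E -> measurable F ->
  wint (fun x => u x * \1_F x) E = wint u (E `&` F).
Proof.
move=> mf mE mF; rewrite /wint [RHS]integral_mkcondr.
apply: eq_integral => x _; rewrite patchE indicE.
by case: ifP; rewrite ?mulr1 ?mulr0.
Qed.

Lemma wint_setU u E F : measurable_fun setT u -> (forall x, 0 <= u x) ->
  measurable E -> measurable F -> [disjoint E & F] ->
  wint u (E `|` F) = (wint u E + wint u F)%E.
Proof.
move=> mf u0 mE mF EF; apply: ge0_integral_setU => //.
  by apply/measurable_EFinP; exact: measurable_funTS.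
by move=> x _; rewrite lee_fin.
Qed.

Lemma wint_setUle u E F : measurable_fun setT u -> (forall x, 0 <= u x) ->
  measurable E -> measurable F -> (wint u (E `|` F) <= wint u E + wint u F)%E.
Proof.
move=> mf u0 mE mF; have -> : E `|` F = E `|` (F `\` E).
  apply/seteqP; split => x [Ex|]; [by left| |by left|by case=> Fx _; right].
  by move=> Fx; have [Ex|Ex] := pselect (E x); [left|right].
rewrite wint_setU//; last 2 first.
- exact: measurableD.
- by apply/disj_setPS => x [? []].
by apply: leeD => //; apply: wint_sub => //; exact: measurableD.
Qed.

Lemma wint_null u E : mu E = 0%E -> measurable E -> measurable_fun setT u ->
  (forall x, 0 <= u x) -> wint u E = 0%E.
Proof.
move=> E0 mE mf u0; apply: null_set_integral => //.
  by apply/measurable_EFinP; exact: measurable_funTS.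
Qed.

Lemma wint_bigcup u (F : nat -> set (T)) : measurable_fun setT u ->
  (forall x, 0 <= u x) -> (forall i, measurable (F i)) -> trivIset setT F ->
  wint u (\bigcup_i F i) = (\sum_(i <oo) wint u (F i))%E.
Proof.
move=> mf u0 mF tF; apply: ge0_integral_bigcup => //.
  by apply/measurable_EFinP; exact: measurable_funTS.
by move=> x _; rewrite lee_fin.
Qed.

Lemma wint_markov u f E Q (c : R) : measurable_fun setT u ->
  (forall x, 0 <= u x) -> measurable_fun setT f -> (forall x, 0 <= f x) ->
  0 <= c -> measurable E -> measurable Q -> E `<=` Q ->
  (forall x, E x -> c <= f x) ->
  (c%:E * wint u E <= wint (fun x => (u x * f x)%R) Q)%E.
Proof.
move=> mf u0 mg f0 c0 mE mQ EQ Ef.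
apply: (@le_trans _ _ (wint (fun x => u x * f x) E)).
  rewrite -wintZ//; apply: wint_le => //.
  - exact: measurable_funM.
  - exact: measurable_funM.
  - by move=> x; rewrite mulr_ge0.
  - by move=> x Ex; rewrite mulrC ler_wpM2l// Ef.
apply: wint_sub => //; first exact: measurable_funM.
by move=> x; rewrite mulr_ge0.
Qed.

Lemma measure_markov f E Q (c : R) :
  measurable_fun setT f -> (forall x, 0 <= f x) ->
  0 <= c -> measurable E -> measurable Q -> E `<=` Q ->
  (forall x, E x -> c <= f x) -> (c%:E * mu E <= wint f Q)%E.
Proof.
move=> mf f0 c0 mE mQ EQ Ef; rewrite -wint_cst1//.
apply: (le_trans (wint_markov (u := fun=> 1) _ _ mf f0 c0 mE mQ EQ Ef)) => //.
by rewrite /wint; under eq_integral do rewrite mul1r.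
Qed.

(** A layer-cake estimate at geometric scales: f is at most the sum of [D^(k+1)] over the layers
    that contain the point, and the integrals are dominated by [D (D th)^k]. The layers may
    overlap. *)
Lemma wint_layers u f Q (L : nat -> set (T)) (D th : R) :
  measurable Q -> measurable_fun setT u -> (forall x, 0 <= u x) ->
  measurable_fun setT f -> (forall x, 0 <= f x) ->
  (forall k, measurable (L k)) -> 0 <= D -> 0 <= th -> D * th < 1 ->
  (forall x, Q x -> exists k, L k x /\ f x <= D ^+ k.+1) ->
  (forall k, wint u (Q `&` L k) <= (th ^+ k)%:E * wint u Q)%E ->
  (wint (fun x => (u x * f x)%R) Q <= (D / (1 - D * th))%:E * wint u Q)%E.
Proof.
move=> mQ mf u0 mg f0 mL D0 th0 Dth Lf Lu.
have mLi k : measurable_fun setT (fun x : T => D ^+ k.+1 * (u x * \1_(L k) x)).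
  by apply: measurable_funM => //; apply: measurable_funM => //; exact: measurable_indic.
pose G k x := (D ^+ k.+1 * (u x * \1_(L k) x))%:E.
have G0 k x : (0 <= G k x)%E by rewrite lee_fin !mulr_ge0// exprn_ge0.
have mG k : measurable_fun Q (G k).
  by apply/measurable_EFinP; exact: measurable_funTS.
apply: (@le_trans _ _ (\int[mu]_(x in Q) (\sum_(k <oo) G k x))%E).
  apply: ge0_le_integral => //.
  - by move=> x _; rewrite lee_fin mulr_ge0.
  - by apply/measurable_EFinP; apply: measurable_funTS; exact: measurable_funM.
  - by apply: ge0_emeasurable_sum => // k x _ _.
  - move=> x Qx; have [k [Lk fk]] := Lf _ Qx.
    apply: (@le_trans _ _ (G k x)).
      by rewrite lee_fin indicE mem_set// mulr1 mulrC ler_wpM2r.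
    apply: le_trans (nneseries_lim_ge k.+1 _) => //.
    by rewrite big_nat_recr//= leeDr// sume_ge0.
rewrite integral_nneseries//.
apply: lime_le; first by apply: is_cvg_nneseries => k _ _; exact: integral_ge0.
apply: nearW => N.
have GE k : (\int[mu]_(x in Q) G k x <= (D * (D * th) ^+ k)%:E * wint u Q)%E.
  rewrite -/(wint _ _) wintZ//; last by rewrite exprn_ge0.
  - rewrite wint_indic// exprMn mulrA -exprS EFinM -muleA lee_wpmul2l//.
    by rewrite lee_fin exprn_ge0.
  - by apply: measurable_funM => //; exact: measurable_indic.
  - by move=> x; rewrite mulr_ge0.
apply: (@le_trans _ _ (\sum_(0 <= k < N) (D * (D * th) ^+ k)%:E * wint u Q)%E).
  by apply: lee_sum => k _; exact: GE.
rewrite -ge0_sume_distrl; last by move=> k _; rewrite lee_fin mulr_ge0// exprn_ge0// mulr_ge0.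
apply: lee_wpmul2r; first exact: wint_ge0.
rewrite sumEFin lee_fin -mulr_sumr ler_wpM2l//.
have q0 : 0 <= D * th by rewrite mulr_ge0.
set q := D * th in q0 Dth *.
rewrite -[leRHS]mul1r ler_pdivlMr ?subr_gt0//.
have -> : (\sum_(0 <= i < N) q ^+ i) * (1 - q) = 1 - q ^+ N.
  rewrite big_mkord -[1 in RHS](expr1n _ N) subrXX mulrC; congr (_ * _).
  by apply: eq_bigr => i _; rewrite expr1n mul1r.
by rewrite gerBl exprn_ge0.
Qed.

End weighted_integrals.

(** * A_1 weights and the John-Nirenberg inequality *)

Section cz_system.
Context {R : realType} {d : measure_display} {T : measurableType d}.
Variable mu : {measure set T -> \bar R}.

(* The properties of the cubes of [R^n] used by the John-Nirenberg and
   [A_oo] arguments; N = 2 ^ (n + 1) there. *)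
Record cz_system (cube : Type) (cs : cube -> set T) (vol : cube -> R) (N : R) : Prop :=
  CZSystem {
    cz_measurable : forall Q, measurable (cs Q);
    cz_vol : forall Q, mu (cs Q) = (vol Q)%:E;
    cz_vol_gt0 : forall Q, 0 < vol Q;
    cz_ge1 : 1 <= N;
    cz_stopping : forall Q E, measurable E -> E `<=` cs Q ->
      (N%:E * mu E <= mu (cs Q))%E ->
      exists F : nat -> set T, [/\ trivIset setT F,
        forall i, F i = set0 \/ exists P, [/\ F i = cs P, cs P `<=` cs Q,
          (2%:E * mu (E `&` cs P) <= mu (cs P))%E &
          (mu (cs P) <= N%:E * mu (E `&` cs P))%E]
        & mu (E `\` \bigcup_i F i) = 0%E] }.

Lemma fin_num_real (x : \bar R) : (0 <= x)%E -> (x < +oo)%E ->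
  exists2 a : R, 0 <= a & x = a%:E.
Proof. by case: x => [a| |]//; rewrite lee_fin => a0 _; exists a. Qed.

Variables (cube : Type) (cs : cube -> set T) (vol : cube -> R) (N : R).
Hypothesis cz : cz_system cs vol N.
Implicit Types (Q P : cube) (E G : set T) (u g b : T -> R).

Let mcs Q : measurable (cs Q). Proof. exact: (cz_measurable cz). Qed.
Let mu_cs Q : mu (cs Q) = (vol Q)%:E. Proof. exact: (cz_vol cz). Qed.
Let vol0 Q : 0 < vol Q. Proof. exact: (cz_vol_gt0 cz). Qed.
Let N1 : 1 <= N. Proof. exact: (cz_ge1 cz). Qed.
Let N0 : 0 <= N. Proof. exact: le_trans N1. Qed.

(** The stopping cubes enter later proofs only through their union [Om] and a transfer principle: a
    proportion that holds in each stopping cube holds in [Om]. The weight u is quantified inside,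
    since the principle serves both an A_1 weight and Lebesgue measure. *)
Lemma cz_stopping_cover Q E : measurable E -> E `<=` cs Q ->
  (N%:E * mu E <= mu (cs Q))%E ->
  exists Om, [/\ measurable Om, Om `<=` cs Q, (mu Om <= N%:E * mu E)%E &
    forall u G (c : R), measurable_fun setT u -> (forall x, 0 <= u x) ->
      measurable G -> G `<=` E -> 0 <= c ->
      (forall P, cs P `<=` cs Q -> (2%:E * mu (E `&` cs P) <= mu (cs P))%E ->
         (wint mu u (G `&` cs P) <= c%:E * wint mu u (cs P))%E) ->
      (wint mu u G <= c%:E * wint mu u Om)%E].
Proof.
move=> mE EQ NE; have [F [tF FE F0]] := cz_stopping cz mE EQ NE.
have mF i : measurable (F i).
  by have [->|[P [-> _ _ _]]] := FE i; [exact: measurable0|exact: mcs].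
have mU : measurable (\bigcup_i F i) by exact: bigcupT_measurable.
exists (\bigcup_i F i); split => //.
- move=> x [i _ Fx]; have [F0'|[P [FP PQ _ _]]] := FE i; first by rewrite F0' in Fx.
  by apply: PQ; rewrite -FP.
- apply: (@le_trans _ _ (N%:E * mu (E `&` \bigcup_i F i))%E); last first.
    by rewrite lee_wpmul2l// le_measure ?inE//; exact: measurableI.
  rewrite setI_bigcupr !measure_bigcup//; last 2 first.
    by move=> i _; exact: measurableI.
    exact: trivIset_setIl.
  rewrite -nneseriesZl//; apply: lee_nneseries => // i _.
  have [->|[P [-> _ _ ?]]] := FE i; last by [].
  by rewrite setI0 measure0 mule0.
move=> u G c mfu u0 mG GE c0 H.
have GU : G `<=` (\bigcup_i (G `&` F i)) `|` (E `\` \bigcup_i F i).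
  move=> x Gx; have [Ux|Ux] := pselect ((\bigcup_i F i) x); last by right; split => //; exact: GE.
  by left; rewrite -setI_bigcupr.
have mGU : measurable (\bigcup_i (G `&` F i)).
  by apply: bigcupT_measurable => i; exact: measurableI.
have mEU : measurable (E `\` \bigcup_i F i) by exact: measurableD.
apply: (@le_trans _ _ (wint mu u ((\bigcup_i (G `&` F i)) `|` (E `\` \bigcup_i F i)))).
  by apply: wint_sub => //; exact: measurableU.
apply: (le_trans (wint_setUle _ _ _ _ _)) => //.
rewrite (wint_null F0)// adde0 !wint_bigcup//; last 2 first.
  by move=> i; exact: measurableI.
  exact: trivIset_setIl.
rewrite -nneseriesZl//; last by move=> i _; exact: wint_ge0.
apply: lee_nneseries => [i _ _|i _]; first exact: wint_ge0.
have [->|[P [-> PQ ? _]]] := FE i; last exact: H.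
by rewrite setI0 /wint !integral_set0 mule0.
Qed.

(* [wint mu u] stands for the measure [u dx]; for a weight [u] in A_1,
   [A1_bound u U] holds for every [U] above the A_1 constant. *)
Record A1_bound u (U : R) : Prop := A1Bound {
  A1_measurable : measurable_fun setT u;
  A1_ge0 : forall x, 0 <= u x;
  A1_fin : forall Q, (wint mu u (cs Q) < +oo)%E;
  A1_ge1 : 1 <= U;
  A1_lower : forall Q E, measurable E -> E `<=` cs Q ->
    (mu E * wint mu u (cs Q) <= (U * vol Q)%:E * wint mu u E)%E }.

(** The A_1 condition bounds the mass of a set from below only, so it is applied to the complement
    of E, which has at least half of the volume. *)
Lemma A1_half u U Q E : A1_bound u U -> measurable E -> E `<=` cs Q ->
  (2%:E * mu E <= mu (cs Q))%E ->
  (wint mu u E <= (1 - (2 * U)^-1)%:E * wint mu u (cs Q))%E.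
Proof.
move=> [mfu u0 ufin U1 uA] mE EQ EQ2; have U0 : 0 < U by exact: lt_le_trans U1.
have mD : measurable (cs Q `\` E) by exact: measurableD.
have Qfin := ufin Q.
have ED : wint mu u (cs Q) = (wint mu u E + wint mu u (cs Q `\` E))%E.
  rewrite -wint_setU//; last by apply/disj_setPS => x [? []].
  by congr wint; rewrite setDUK.
have : (mu (cs Q) <= mu E + mu (cs Q `\` E))%E.
  by rewrite -{1}(setDUK EQ); exact: measureU2.
have Efin : (mu E < +oo)%E.
  apply: (@le_lt_trans _ _ (mu (cs Q))); last by rewrite mu_cs ltry.
  by rewrite le_measure ?inE.
have Dfin : (mu (cs Q `\` E) < +oo)%E.
  apply: (@le_lt_trans _ _ (mu (cs Q))); last by rewrite mu_cs ltry.
  by rewrite le_measure ?inE.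
have uE : (wint mu u E < +oo)%E by apply: le_lt_trans Qfin; exact: wint_sub.
have uD : (wint mu u (cs Q `\` E) < +oo)%E by apply: le_lt_trans Qfin; exact: wint_sub.
have := uA Q _ mD (@subDsetl _ _ _).
rewrite ED; move: EQ2; rewrite mu_cs.
have [a a0 ->] := fin_num_real (measure_ge0 mu E) Efin.
have [b b0 ->] := fin_num_real (measure_ge0 mu _) Dfin.
have [s s0 ->] := fin_num_real (wint_ge0 mu E u0) uE.
have [t t0 ->] := fin_num_real (wint_ge0 mu _ u0) uD.
rewrite -!EFinD -!EFinM !lee_fin => aQ h vQ.
have Qp := vol0 Q.
have h1 : vol Q * (s + t) <= vol Q * (2 * U * t) by nra.
rewrite ler_pM2l// in h1.
have -> : (1 - (2 * U)^-1) * (s + t) = (s + t) - (s + t) / (2 * U).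
  by rewrite mulrBl mul1r mulrC.
have : (s + t) / (2 * U) <= t by rewrite ler_pdivrMr ?mulr_gt0// mulrC.
by lra.
Qed.

(** In each stopping cube [A1_half] gains the factor [1 - 1/(2U)]. The union of the stopping cubes
    is at most N times larger than E, so the induction continues with this union and one factor N
    less. *)
Lemma A1_decay u U k Q E : A1_bound u U -> measurable E -> E `<=` cs Q ->
  ((N ^+ k)%:E * mu E <= mu (cs Q))%E ->
  (wint mu u E <= ((1 - (2 * U)^-1) ^+ k)%:E * wint mu u (cs Q))%E.
Proof.
move=> uU; have [mfu u0 ufin U1 uA] := uU.
have th0 : 0 <= 1 - (2 * U)^-1.
  rewrite subr_ge0 invf_le1 ?mulr_gt0//; last exact: lt_le_trans U1.
  by rewrite -[leLHS]mulr1 ler_pM// ler1n.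
elim: k E => [|k IH] E mE EQ; first by rewrite !expr0 !mul1e => _; exact: wint_sub.
move=> NkE; have NE : (N%:E * mu E <= mu (cs Q))%E.
  apply: le_trans NkE; rewrite lee_wpmul2r// lee_fin exprS ler_peMr//.
  exact: exprn_ege1.
have [Om [mOm OmQ NOm H]] := cz_stopping_cover mE EQ NE.
apply: (@le_trans _ _ ((1 - (2 * U)^-1)%:E * wint mu u Om)%E).
  apply: (H u E) => // P PQ EP; apply: (A1_half uU) => //.
    exact: measurableI.
rewrite exprS EFinM -muleA lee_wpmul2l//; apply: IH => //.
apply: le_trans NkE; rewrite exprSr EFinM -muleA lee_wpmul2l//.
by rewrite lee_fin exprn_ge0.
Qed.

(* Dual form of the reverse Holder inequality of an A_1 weight. *)
Lemma A1_reverse_holder u U Q g (L : R) : A1_bound u U ->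
  measurable_fun setT g -> (forall x, 0 <= g x) ->
  (wint mu g (cs Q) <= (vol Q)%:E)%E -> 1 <= L -> N = 2 `^ L ->
  (wint mu (fun x => (u x * g x `^ (4 * U * L)^-1)%R) (cs Q) <=
   (8 * U)%:E * wint mu u (cs Q))%E.
Proof.
move=> uU mg g0 + L1 NL; have [mfu u0 ufin U1 uA] := uU.
have U0 : 0 < U by exact: lt_le_trans U1.
have L0 : 0 < L by exact: lt_le_trans L1.
set e := (4 * U * L)^-1; have e0 : 0 < e by rewrite invr_gt0 !mulr_gt0.
(* The exponent [e] is chosen so that [D = 2^(1/(4U)) <= 1 + 1/(4U)]; since [th = 1 - 2/(4U)], the
   ratio [D th] is at most [1 - 1/(4U)]. *)
pose D := N `^ e; pose th := 1 - (2 * U)^-1.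
have DE : D = 2 `^ (4 * U)^-1.
  by rewrite /D NL -powRrM; congr (_ `^ _); rewrite /e; field; lra.
have D1 : D <= 1 + (4 * U)^-1.
  rewrite DE; apply: (le_trans (powR_le_tangent _ _)) => //.
    rewrite invr_ge0 mulr_ge0 ?(ltW U0)//= invf_le1 ?mulr_gt0//.
    by rewrite -[leLHS]mulr1 ler_pM// ler1n.
  lra.
have D0 : 0 <= D by exact: powR_ge0.
have iU : 0 < (4 * U)^-1 by rewrite invr_gt0 mulr_gt0.
have iUE : (2 * U)^-1 = 2 * (4 * U)^-1 by field; lra.
have iU4 : (4 * U)^-1 <= 4^-1.
  by rewrite lef_pV2 ?posrE ?mulr_gt0// -[leLHS]mulr1 ler_pM2l.
have th0 : 0 <= th by rewrite /th iUE; lra.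
have Dth : D * th <= 1 - (4 * U)^-1.
  apply: (@le_trans _ _ ((1 + (4 * U)^-1) * th)); first by rewrite ler_wpM2r.
  by rewrite /th iUE; nra.
have Dth1 : D * th < 1 by lra.
have DU : D / (1 - D * th) <= 8 * U.
  rewrite ler_pdivrMr; last by lra.
  have : 1 <= 8 * U * (4 * U)^-1 / 2.
    by rewrite (_ : _ / 2 = 1)//; field; lra.
  have : 0 < 8 * U by rewrite mulr_gt0.
  move: Dth D1 iU4; nra.
move=> gQ.
(* By Markov's inequality [{g >= N^k}] has volume at most [N^-k] of Q, as [A1_decay] demands. Level
   0 is everything, so that points with [g < 1] are covered too. *)
pose Lk k := if k is 0%N then [set: T] else [set x | N ^+ k <= g x].
have Np : 0 < N by exact: lt_le_trans N1.
have mLk k : measurable (Lk k).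
  by case: k => [|k]; [exact: measurableT|exact: measurable_ge].
apply: le_trans (wint_layers (L := Lk) (D := D) (th := th) _ _ _ _ _ _ _ _ _ _ _) _ => //.
- exact: measurable_powRf.
- by move=> x; exact: powR_ge0.
- move=> x Qx; have exk : exists k, g x < N ^+ k.+1.
    have N2 : 2 <= N.
      rewrite NL -[leLHS]powRr1//; apply: ler_powR => //; by rewrite ler1n.
    exists (Num.truncn (g x)); have /andP[_ h] := truncn_itv (g0 x).
    apply: (lt_le_trans h); apply: (@le_trans _ _ (2 ^+ (Num.truncn (g x)).+1)).
      by rewrite -natrX ler_nat ltnW// ltn_expl.
    by rewrite lerXn2r ?nnegrE.
  case: (ex_minnP exk) => k gk min; exists k; split.
    case: k gk min => [//|k] gk min /=; rewrite leNgt; apply/negP => /min.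
    by rewrite ltnn.
  apply: (@le_trans _ _ ((N ^+ k.+1) `^ e)).
    by apply: ge0_ler_powR; rewrite ?nnegrE ?exprn_ge0 ?(ltW e0) ?(ltW gk).
  by rewrite -powR_mulrn// powRAC powR_mulrn.
- move=> k; apply: A1_decay => //; first exact: measurableI.
  case: k => [|k] /=; first by rewrite setIT expr0 mul1e.
  rewrite mu_cs; apply: le_trans gQ.
  apply: measure_markov => //.
  - exact: exprn_ge0.
  - by apply: measurableI => //; exact: measurable_ge.
  - by move=> x [].
by rewrite lee_wpmul2r// ?lee_fin//; exact: wint_ge0.
Qed.

Section john_nirenberg.
Variables (b : T -> R) (c : cube -> R) (B : R).
Hypothesis mb : measurable_fun setT b.
Hypothesis B0 : 0 < B.
Hypothesis bB : forall Q, (wint mu (fun x => `|b x - c Q|%R) (cs Q) <= (B * vol Q)%:E)%E.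

(** [2 N B] is the stopping threshold, at which the exceptional set has density at most [1/(2N)].
    Together with [4 B] it bounds [|c P - c Q|] for a stopping cube P of Q. *)
Let l0 : R := (2 * N + 4) * B.

Let mosc Q : measurable_fun setT (fun x => `|b x - c Q|).
Proof. by apply: measurableT_comp => //; exact: measurable_funB. Qed.

Let markov Q (l : R) : 0 < l ->
  (l%:E * mu (cs Q `&` [set x | (l <= `|b x - c Q|)%R]) <= (B * vol Q)%:E)%E.
Proof.
move=> l0'; apply: le_trans (bB Q).
have mE : measurable (cs Q `&` [set x | l <= `|b x - c Q|]).
  by apply: measurableI => //; exact: measurable_ge.
by apply: measure_markov => //; [exact: ltW|move=> x []].
Qed.

(** Induction on k for all cubes at once. Replacing Q by a stopping cube P changes the constant by
    at most one step [l0], so level [k + 1] for Q is contained in level k for P, while the stopping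
    cubes fill at most half of Q. *)
Lemma john_nirenberg_distribution k Q :
  (mu (cs Q `&` [set x | (k%:R * l0 <= `|b x - c Q|)%R]) <=
   ((1 / 2) ^+ k)%:E * mu (cs Q))%E.
Proof.
have mE k' l' P : measurable (cs P `&` [set x | k' * l' <= `|b x - c P|]).
  by apply: measurableI => //; exact: measurable_ge.
elim: k Q => [|k IH] Q.
  by rewrite expr0 mul1e le_measure ?inE//; exact: mcs.
have Np : 0 < N by exact: lt_le_trans N1.
pose E := cs Q `&` [set x | 2 * N * B <= `|b x - c Q|].
have mEE : measurable E by apply: measurableI => //; exact: measurable_ge.
have EQ : E `<=` cs Q by move=> x [].
have NE2 : (N%:E * mu E <= (1 / 2)%:E * mu (cs Q))%E.
  have := markov Q (l := 2 * N * B); rewrite -/E mu_cs => /(_ _).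
  rewrite !mulr_gt0// => /(_ isT).
  have Efin : (mu E < +oo)%E.
    apply: (@le_lt_trans _ _ (mu (cs Q))); last by rewrite mu_cs ltry.
    by rewrite le_measure ?inE.
  have [a a0 ->] := fin_num_real (measure_ge0 mu E) Efin.
  rewrite -!EFinM !lee_fin => h.
  by rewrite -(ler_pM2l B0); move: h; nra.
have NE : (N%:E * mu E <= mu (cs Q))%E.
  apply: (le_trans NE2); rewrite mu_cs -EFinM lee_fin.
  by have := vol0 Q; lra.
have [Om [mOm OmQ NOm H]] := cz_stopping_cover mEE EQ NE.
pose G := cs Q `&` [set x | k.+1%:R * l0 <= `|b x - c Q|].
have mG : measurable G by apply: measurableI => //; exact: measurable_ge.
have l00 : 0 < l0 by rewrite /l0 mulr_gt0// addr_gt0// mulr_gt0.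
have kE : k.+1%:R * l0 = k%:R * l0 + l0 by rewrite -natr1 mulrDl mul1r.
have GE : G `<=` E.
  move=> x [Qx /= h]; split => //=; apply: le_trans h.
  have kl0 : 0 <= k%:R * l0 by rewrite mulr_ge0// ltW.
  rewrite kE; apply: (@le_trans _ _ l0).
    by rewrite /l0 ler_pM2r// lerDl.
  by rewrite lerDr.
have : (wint mu (fun=> 1%R) G <= ((1 / 2) ^+ k)%:E * wint mu (fun=> 1%R) Om)%E.
  apply: H => //.
  move=> P PQ EP; rewrite !wint_cst1//; last exact: measurableI.
  apply: le_trans (IH P); rewrite le_measure ?inE//; first exact: measurableI.
  pose E4 := cs P `&` [set x | 4 * B <= `|b x - c P|].
  have mE4 : measurable E4 by apply: measurableI => //; exact: measurable_ge.
  (* E fills at most half of P and E4 at most a quarter, so some point avoids both; it compares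
     [c P] with [c Q]. *)
  have [y [Py yE yE4]] : exists y, [/\ cs P y, ~ E y & ~ E4 y].
    apply: contrapT => ny.
    have sub : cs P `<=` (E `&` cs P) `|` E4.
      move=> y Py; apply: contrapT => nEy; apply: ny; exists y; split => //.
        by move=> Ey; apply: nEy; left.
      by move=> E4y; apply: nEy; right.
    have mEP : measurable (E `&` cs P) by exact: measurableI.
    have : (mu (cs P) <= mu (E `&` cs P) + mu E4)%E.
      apply: le_trans (measureU2 _ mEP mE4).
      by rewrite le_measure ?inE//; exact: measurableU.
    have := markov P (l := 4 * B); rewrite -/E4 mulr_gt0// => /(_ isT).
    move: EP; rewrite mu_cs.
    have fin1 : (mu (E `&` cs P) < +oo)%E.
      apply: (@le_lt_trans _ _ (mu (cs P))); last by rewrite mu_cs ltry.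
      by rewrite le_measure ?inE.
    have fin2 : (mu E4 < +oo)%E.
      apply: (@le_lt_trans _ _ (mu (cs P))); last by rewrite mu_cs ltry.
      by rewrite le_measure ?inE//; move=> x [].
    have [s s0 ->] := fin_num_real (measure_ge0 mu _) fin1.
    have [t t0 ->] := fin_num_real (measure_ge0 mu _) fin2.
    rewrite -!EFinM -EFinD !lee_fin => h1 h2 h3.
    have h2' : 4 * t <= vol P by rewrite -(ler_pM2l B0); move: h2; nra.
    by have := vol0 P; lra.
  have y1 : `|b y - c Q| < 2 * N * B.
    rewrite ltNge; apply/negP => h; apply: yE; split => //; exact: PQ.
  have y2 : `|b y - c P| < 4 * B.
    by rewrite ltNge; apply/negP => h; apply: yE4; split.
  move=> x [[Qx /= h] Px]; split => //=.
  have := ler_normB (b x - c P) (- (c P - c Q)); rewrite opprK normrN.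
  rewrite (_ : b x - c P + (c P - c Q) = b x - c Q); last by ring.
  have := ler_normB (b y - c Q) (b y - c P).
  rewrite (_ : b y - c Q - (b y - c P) = c P - c Q); last by ring.
  move: h y1 y2; rewrite kE {2}/l0; lra.
rewrite !wint_cst1// -/G => /le_trans; apply.
rewrite exprSr EFinM -muleA lee_wpmul2l//.
exact: le_trans NE2.
Qed.

(** The constant 6 is [D / (1 - D th)] for [D = 3/2] and [th = 1/2]. *)
Lemma john_nirenberg_exp Q :
  (wint mu (fun x => expR (`|b x - c Q| / (3 * l0)))%R (cs Q) <= (6 * vol Q)%:E)%E.
Proof.
have l00 : 0 < l0 by rewrite /l0 mulr_gt0// addr_gt0// mulr_gt0// (lt_le_trans _ N1).
pose L k := [set x | k%:R * l0 <= `|b x - c Q|].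
have mL k : measurable (L k) by exact: measurable_ge.
pose f x := expR (`|b x - c Q| / (3 * l0)).
have mf : measurable_fun setT f.
  apply: measurableT_comp => //; apply: measurable_funM => //; exact: mosc.
apply: le_trans (_ : (wint mu (fun x => 1 * f x)%R (cs Q) <= _)%E).
  by rewrite /wint; under [leRHS]eq_integral do rewrite mul1r.
apply: le_trans (wint_layers (L := L) (D := 3 / 2) (th := 1 / 2) _ _ _ _ _ _ _ _ _ _ _) _ => //.
- by move=> x; exact: expR_ge0.
- lra.
- move=> x Qx; exists (Num.truncn (`|b x - c Q| / l0)).
  have y0 : 0 <= `|b x - c Q| / l0 by rewrite divr_ge0// ltW.
  have /andP[h1 h2] := truncn_itv y0; split.
    by rewrite /L/= -ler_pdivlMr.
  rewrite /f (_ : `|b x - c Q| / (3 * l0) = `|b x - c Q| / l0 * 3^-1); last by field; lra.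
  apply: (@le_trans _ _ (expR ((Num.truncn (`|b x - c Q| / l0)).+1%:R * 3^-1))).
    by rewrite ler_expR ler_pM2r ?invr_gt0// ltW.
  rewrite expRM_natl.
  rewrite lerXn2r ?nnegrE ?expR_ge0//; exact: expR_third.
- move=> k; rewrite !wint_cst1//; first exact: john_nirenberg_distribution.
  exact: measurableI.
rewrite wint_cst1// mu_cs -EFinM lee_fin ler_wpM2r//; first exact/ltW/vol0.
by rewrite ler_pdivrMr; lra.
Qed.

End john_nirenberg.

End cz_system.

(** * Sparse families *)

Section power_sums.
Context {R : realType}.
Implicit Types (x y p e : R).

Lemma powRD_le x y p : 0 <= x -> 0 <= y -> 0 <= p <= 1 ->
  (x + y) `^ p <= x `^ p + y `^ p.
Proof.
move=> x0 y0 /andP[p0 p1]; have [xy0|xyn0] := eqVneq (x + y) 0.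
  have -> : x = 0 by move: x0 y0 xy0; lra.
  rewrite add0r lerDr; exact: powR_ge0.
have xyp : 0 < x + y by rewrite lt_neqAle eq_sym xyn0 addr_ge0.
have key z : 0 <= z -> z <= x + y -> (x + y) `^ p * (z / (x + y)) <= z `^ p.
  move=> z0 zxy; have [->|zn0] := eqVneq z 0; first by rewrite mul0r mulr0 powR_ge0.
  have zp : 0 < z by rewrite lt_neqAle eq_sym zn0.
  rewrite -[X in _ <= X `^ p](divfK xyn0) powRM ?divr_ge0 ?(ltW xyp)//.
  rewrite mulrC ler_wpM2r ?powR_ge0//.
  by apply: ger1_powR => //; rewrite divr_gt0// ler_pdivrMr// mul1r.
have := lerD (key x x0 _) (key y y0 _); rewrite lerDl y0 lerDr x0 => /(_ isT isT).
by rewrite -mulrDr -mulrDl mulfV// mulr1.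
Qed.

Lemma powR_sum_le (I : Type) (s : seq I) (f : I -> R) p : (forall i, 0 <= f i) ->
  0 < p <= 1 -> (\sum_(i <- s) f i) `^ p <= \sum_(i <- s) f i `^ p.
Proof.
move=> f0 /andP[p0 p1]; elim: s => [|i s IH].
  by rewrite !big_nil powR0// gt_eqF.
rewrite !big_cons; apply: le_trans (powRD_le _ _ _) _ => //.
- exact: sumr_ge0.
- by rewrite ltW.
- by rewrite lerD2l.
Qed.

Lemma powR1D_le x y e : 0 <= x -> 0 <= y -> 0 < e <= 1 ->
  (x + y) `^ (1 + e) <= x `^ (1 + e) + 2 * (y * (x + y) `^ e).
Proof.
move=> x0 y0 /andP[e0 e1].
have powS z : 0 <= z -> z `^ (1 + e) = z * z `^ e.
  by move=> z0; rewrite powRD ?powRr1// gt_eqF// addr_gt0.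
rewrite !powS ?addr_ge0//.
have [x00|xn0] := eqVneq x 0.
  rewrite x00 !add0r mul0r add0r; have := powR_ge0 y e; nra.
have xp : 0 < x by rewrite lt_neqAle eq_sym xn0.
have h : (x + y) `^ e <= x `^ e * (1 + e * (y / x)).
  have -> : x + y = x * (1 + y / x) by field.
  have yx : 0 <= y / x by rewrite divr_ge0.
  rewrite powRM// ?addr_ge0// ler_wpM2l ?powR_ge0//.
  apply: le_trans (powR_le_tangent _ _) _; rewrite ?addr_ge0//.
  - by rewrite (ltW e0).
  - by rewrite addrAC subrr add0r.
have hx : x `^ e <= (x + y) `^ e.
  by apply: ge0_ler_powR; rewrite ?nnegrE ?addr_ge0 ?(ltW e0)// lerDl.
have h2 : x * (x + y) `^ e <= x * x `^ e + y * (x + y) `^ e.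
  apply: (@le_trans _ _ (x * (x `^ e * (1 + e * (y / x))))).
    by rewrite ler_wpM2l.
  have -> : x * (x `^ e * (1 + e * (y / x))) = x * x `^ e + e * (y * x `^ e) by field.
  rewrite lerD2l; apply: (@le_trans _ _ (y * x `^ e)).
    by rewrite ler_piMl// mulr_ge0// powR_ge0.
  by rewrite ler_wpM2l.
rewrite mulrDl; lra.
Qed.

(** Add the terms in increasing order of [sd] and apply [powR1D_le] at each step: the new term is
    then paired only with terms of smaller or equal [sd]. With [sd] the side length, the inner sum
    runs over subcubes, which is the form needed for the Carleson property. *)
Lemma powR_sum_sorted (I : eqType) (s : seq I) (f sd : I -> R) e :
  (forall i, 0 <= f i) -> 0 < e <= 1 ->
  (\sum_(i <- s) f i) `^ (1 + e) <=
  2 * \sum_(i <- s) \sum_(j <- s | sd j <= sd i) f i * f j `^ e.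
Proof.
move=> f0 e01; have [e0 e1] := andP e01.
pose r := fun i j => sd j <= sd i.
have rtot : total r by move=> i j; exact: le_total.
have rtr : transitive r by move=> j i k; rewrite /r => h1 h2; exact: le_trans h2 h1.
have := sort_sorted rtot s; have /permPl := perm_sort r s.
move: (sort r s) => s' ss' so.
have -> : \sum_(i <- s) f i = \sum_(i <- s') f i by apply/esym/perm_big.
have -> : \sum_(i <- s) \sum_(j <- s | sd j <= sd i) f i * f j `^ e =
    \sum_(i <- s') \sum_(j <- s' | sd j <= sd i) f i * f j `^ e.
  rewrite -[LHS](perm_big _ ss')/=; apply: eq_bigr => i _.
  exact/esym/perm_big.
elim: s' so {ss'} => [|i s' IH] so.
  by rewrite !big_nil powR0 ?mulr0// gt_eqF// addr_gt0.
have all_i : all (r i) s' by exact: order_path_min so.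
have {}so := path_sorted so.
rewrite !big_cons; have S0 : 0 <= \sum_(j <- s') f j by exact: sumr_ge0.
rewrite addrC; apply: (le_trans (powR1D_le S0 (f0 i) e01)).
rewrite addrC mulrDr; apply: lerD.
  rewrite ler_wpM2l//= lexx -mulr_sumr -mulrDr ler_wpM2l//.
  rewrite (_ : \sum_(j <- s' | sd j <= sd i) f j `^ e = \sum_(j <- s') f j `^ e).
    rewrite addrC; apply: (le_trans (powRD_le _ _ _)) => //; first by rewrite (ltW e0).
    by rewrite lerD2l; exact: powR_sum_le.
  rewrite big_seq_cond [RHS]big_seq; apply: eq_bigl => j.
  by case js : (j \in s') => //=; exact: (allP all_i).
apply: (le_trans (IH so)); rewrite ler_wpM2l//.
apply: ler_sum => j _; rewrite big_cons; case: ifP => // _.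
by rewrite lerDr mulr_ge0// powR_ge0.
Qed.

Lemma geometric_partial_sum_le (q : R) M : 0 <= q < 1 ->
  \sum_(i <- iota 0 M) q ^+ i <= (1 - q)^-1.
Proof.
move=> /andP[q0 q1]; rewrite -{1}(subn0 M) -/(index_iota 0 M) big_mkord. rewrite -[leRHS]mul1r ler_pdivlMr ?subr_gt0//.
have -> : (\sum_(i < M) q ^+ i) * (1 - q) = 1 - q ^+ M.
  rewrite -[1 in RHS](expr1n _ M) subrXX mulrC; congr (_ * _).
  by apply: eq_bigr => i _; rewrite expr1n mul1r.
by rewrite gerBl exprn_ge0.
Qed.

Lemma half_powR e : (1 / 2) `^ e = (2 `^ e)^-1 :> R.
Proof. by rewrite div1r -powR_inv1// -powRrM mulN1r powRN. Qed.

Lemma half_powR_le e : 0 <= e <= 1 -> (1 / 2) `^ e <= 1 - e / 2.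
Proof. by move=> e01; apply: (le_trans (powR_le_tangent _ e01)); lra. Qed.

Lemma seq_max (I : eqType) (s : seq I) (f : I -> R) (p : pred I) : has p s ->
  exists i, [/\ i \in s, p i & forall j, j \in s -> p j -> f j <= f i].
Proof.
elim: s => [//|i s IH] /=; have [ps _|nps] := boolP (has p s).
  have [j [js pj jmax]] := IH ps; have [pi|npi] := boolP (p i); last first.
    exists j; split; rewrite ?inE ?js ?orbT// => k; rewrite inE => /orP[/eqP -> |/jmax//].
    by rewrite (negbTE npi).
  have [ij|ji] := leP (f i) (f j).
    exists j; split; rewrite ?inE ?js ?orbT// => k; rewrite inE => /orP[/eqP -> //|/jmax//].
  exists i; split; rewrite ?inE ?eqxx// => k; rewrite inE => /orP[/eqP -> //|ks pk].
  by apply: le_trans (ltW ji); exact: jmax.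
rewrite orbF => pi; exists i; split; rewrite ?inE ?eqxx// => j.
rewrite inE => /orP[/eqP -> //|js pj]; move/hasPn : nps => /(_ _ js).
by rewrite pj.
Qed.

End power_sums.

Section overlap.
Context {R : realType} {d : measure_display} {T : measurableType d}.
Variable mu : {measure set T -> \bar R}.

Lemma wint_overlap (I : Type) (s : seq I) (u : T -> R) (G : I -> set T)
    (X : set T) (K : R) :
  measurable_fun setT u -> (forall x, 0 <= u x) -> measurable X ->
  (forall i, measurable (G i)) -> 0 <= K ->
  (forall x, X x -> \sum_(i <- s) \1_(G i) x <= K) ->
  (\sum_(i <- s) wint mu u (X `&` G i) <= K%:E * wint mu u X)%E.
Proof.
move=> mu' u0 mX mG K0 GK.
have m1 i : measurable_fun setT (fun x : T => u x * \1_(G i) x).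
  by apply: measurable_funM => //; exact: measurable_indic.
under eq_bigr do rewrite -wint_indic//.
rewrite -wint_sum//; last by move=> i x; rewrite mulr_ge0.
rewrite -wintZ//; apply: wint_le => //.
- exact: measurable_sum.
- exact: measurable_funM.
- by move=> x; apply: sumr_ge0 => i _; rewrite mulr_ge0.
- by move=> x Xx; rewrite -mulr_sumr mulrC ler_wpM2r// GK.
Qed.

Lemma wint_union_bound (I : eqType) (s : seq I) (u : T -> R) (G : I -> set T)
    (X : set T) :
  measurable_fun setT u -> (forall x, 0 <= u x) -> measurable X ->
  (forall i, measurable (G i)) ->
  (forall x, X x -> exists2 i, i \in s & G i x) ->
  (wint mu u X <= \sum_(i <- s) wint mu u (G i))%E.
Proof.
move=> mu' u0 mX mG XG.
have m1 i : measurable_fun setT (fun x : T => u x * \1_(G i) x).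
  by apply: measurable_funM => //; exact: measurable_indic.
apply: (@le_trans _ _ (\sum_(i <- s) wint mu u (X `&` G i))%E); last first.
  by apply: lee_sum => i _; apply: wint_sub => //; exact: measurableI.
under eq_bigr do rewrite -wint_indic//.
rewrite -wint_sum//; last by move=> i x; rewrite mulr_ge0.
apply: wint_le => //; first exact: measurable_sum.
move=> x /XG[i si Gi]; rewrite (big_rem i)//= indicE mem_set// mulr1 lerDl.
by apply: sumr_ge0 => j _; rewrite mulr_ge0.
Qed.

(** On X, [W = W^p W^(1-p)] with [W^p <= c^-p f^p]. For [p = 1 - e] and [p = 1 + e] the factor left
    beside u is [W^e] or [W^(-e)]. *)
Lemma chebyshev_powR (u W f : T -> R) (X : set T) (p c : R) :
  measurable_fun setT u -> (forall x, 0 <= u x) ->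
  measurable_fun setT W -> (forall x, 0 < W x) ->
  measurable_fun setT f -> (forall x, 0 <= f x) -> measurable X ->
  0 < c -> 0 <= p -> (forall x, X x -> c * W x < f x) ->
  (wint mu (fun x => (u x * W x)%R) X <=
   (c `^ (- p))%:E * wint mu (fun x => (f x `^ p * (u x * W x `^ (1 - p)))%R) X)%E.
Proof.
move=> mfu u0 mW W0 mf f0 mX c0 p0 cWf.
have m1 : measurable_fun setT (fun x => f x `^ p * (u x * W x `^ (1 - p))).
  apply: measurable_funM; first exact: measurable_powRf.
  by apply: measurable_funM => //; exact: measurable_powRf.
have pos x : 0 <= f x `^ p * (u x * W x `^ (1 - p)).
  by rewrite !mulr_ge0// powR_ge0.
rewrite -wintZ// ?powR_ge0//; apply: wint_le => //.
- exact: measurable_funM.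
- exact: measurable_funM.
- by move=> x; rewrite mulr_ge0// ltW.
move=> x /cWf h.
have WE : W x = W x `^ p * W x `^ (1 - p).
  by rewrite -powRD ?subrKC ?powRr1// ?(ltW (W0 x))// oner_eq0.
rewrite [X in u x * X <= _]WE mulrCA [leRHS]mulrA; apply: ler_wpM2r.
  by rewrite mulr_ge0// powR_ge0.
rewrite -[leLHS]mul1r.
have c1 : 1 = c `^ (- p) * c `^ p by rewrite powRN mulVf// gt_eqF// powR_gt0.
rewrite {1}c1 -mulrA ler_wpM2l ?powR_ge0// -powRM ?(ltW c0) ?(ltW (W0 x))//.
by apply: ge0_ler_powR; rewrite ?nnegrE ?mulr_ge0 ?(ltW c0) ?(ltW (W0 x))// ltW.
Qed.

End overlap.

Section sparse_families.
Context {R : realType} {d : measure_display} {T : measurableType d}.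
Variable mu : {measure set T -> \bar R}.
Variables (cube : choiceType) (cs : cube -> set T) (vol : cube -> R) (N : R).
Hypothesis cz : cz_system mu cs vol N.
Implicit Types (P Q : cube) (S : seq cube).

Let mcs Q : measurable (cs Q). Proof. exact: (cz_measurable cz). Qed.
Let mu_cs Q : mu (cs Q) = (vol Q)%:E. Proof. exact: (cz_vol cz). Qed.
Let vol0 Q : 0 < vol Q. Proof. exact: (cz_vol_gt0 cz). Qed.

(** Sparseness in the form of pairwise disjoint major subsets, for finite lists of cubes; [sd]
    stands for the side length and [sparse_nested] records that the cubes come from one dyadic
    lattice. *)
Record sparse_seq (sd : cube -> R) (eta : R) S : Prop := SparseSeq {
  sparse_uniq : uniq S;
  sparse_eta : 0 < eta <= 1;
  sparse_nested : forall P Q x, P \in S -> Q \in S -> cs P x -> cs Q x ->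
    sd P <= sd Q -> cs P `<=` cs Q;
  sparse_sets : exists E : cube -> set T,
    [/\ forall Q, measurable (E Q), forall Q, E Q `<=` cs Q,
        forall Q, Q \in S -> ((eta * vol Q)%:E <= mu (E Q))%E &
        forall P Q x, P \in S -> Q \in S -> E P x -> E Q x -> P = Q] }.

Lemma sum_indic_disjoint (I : eqType) (s : seq I) (G : I -> set T) x :
  uniq s -> (forall i j, i \in s -> j \in s -> G i x -> G j x -> i = j) ->
  \sum_(i <- s) \1_(G i) x <= 1 :> R.
Proof.
elim: s => [|i s IH] /=; first by rewrite big_nil.
move=> /andP[nis us] H; rewrite big_cons; have [Gi|Gi] := pselect (G i x).
  rewrite indicE mem_set//= big_seq big1 ?addr0// => j js.
  rewrite indicE memNset// => Gj; move/negP : nis; apply.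
  by rewrite (H i j)// ?inE ?eqxx ?js ?orbT.
rewrite indicE memNset// add0r; apply: IH => // j k js ks.
by apply: H; rewrite inE ?js ?ks orbT.
Qed.

Lemma A1_bound_cst1 : A1_bound mu cs vol (fun=> 1) 1.
Proof.
split => //; first by move=> Q; rewrite wint_cst1// mu_cs ltry.
by move=> Q E mE EQ; rewrite !wint_cst1// mu_cs mul1r muleC.
Qed.

(** By the A_1 condition a major subset carries at least the fraction [eta / U] of the u-mass of its
    cube, and the major subsets are disjoint. *)
Lemma sparse_carleson sd eta S u U Q : sparse_seq sd eta S ->
  A1_bound mu cs vol u U ->
  (\sum_(P <- S | `[< cs P `<=` cs Q >]) wint mu u (cs P) <=
   (U / eta)%:E * wint mu u (cs Q))%E.
Proof.
move=> [uS /andP[eta0 _] _ [E [mE EQ Eeta Edis]]] [mfu u0 ufin U1 uA].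
have U0 : 0 < U by exact: lt_le_trans U1.
have step P : P \in S -> (wint mu u (cs P) <= (U / eta)%:E * wint mu u (E P))%E.
  move=> PS; have := Eeta _ PS; have := uA P _ (mE P) (EQ P).
  have fin1 : (mu (E P) < +oo)%E.
    apply: (@le_lt_trans _ _ (mu (cs P))); last by rewrite mu_cs ltry.
    by rewrite le_measure ?inE.
  have fin2 : (wint mu u (E P) < +oo)%E.
    by apply: le_lt_trans (ufin P); exact: wint_sub.
  have [a a0 ->] := fin_num_real (measure_ge0 mu _) fin1.
  have [b b0 ->] := fin_num_real (wint_ge0 mu _ u0) fin2.
  have [c c0 ->] := fin_num_real (wint_ge0 mu _ u0) (ufin P).
  rewrite -!EFinM !lee_fin => h1 h2; have vP := vol0 P.
  rewrite mulrAC ler_pdivlMr// mulrC -(ler_pM2l vP).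
  by apply: le_trans (_ : a * c <= _); nra.
apply: (@le_trans _ _ (\sum_(P <- S | `[< cs P `<=` cs Q >])
    (U / eta)%:E * wint mu u (cs Q `&` E P))%E).
  rewrite big_seq_cond [leRHS]big_seq_cond; apply: lee_sum => P /andP[PS /asboolP PQ].
  rewrite (_ : cs Q `&` E P = E P); first exact: step.
  by apply/setIidr; exact: subset_trans (EQ P) PQ.
rewrite -ge0_sume_distrr; last by move=> P _; exact: wint_ge0.
rewrite lee_wpmul2l ?lee_fin ?divr_ge0 ?(ltW U0) ?(ltW eta0)//.
rewrite -big_filter -[leRHS]mul1e; apply: wint_overlap => // x _.
apply: sum_indic_disjoint; first exact: filter_uniq.
by move=> i j; rewrite !mem_filter => /andP[_ iS] /andP[_ jS]; exact: Edis.
Qed.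

Section weighted.
Variables (u : T -> R) (U : R).
Hypothesis uU : A1_bound mu cs vol u U.
Variables (W : T -> R) (Wb : cube -> R) (A s : R).
Hypotheses (mW : measurable_fun setT W) (W0 : forall x, 0 < W x).
Hypotheses (Wb0 : forall Q, 0 < Wb Q) (A1 : 1 <= A) (s0 : 0 < s).
Hypothesis WbE : forall Q, wint mu W (cs Q) = (Wb Q * vol Q)%:E.
Hypothesis WbN : forall Q,
  (wint mu (fun x => W x `^ (- s))%R (cs Q) <= (vol Q * (A / Wb Q) `^ s)%:E)%E.
Variables (sd : cube -> R) (eta : R) (S : seq cube).
Hypothesis spS : sparse_seq sd eta S.

Let mfu : measurable_fun setT u. Proof. exact: A1_measurable uU. Qed.
Let u0 : forall x, 0 <= u x. Proof. exact: A1_ge0 uU. Qed.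
Let U1 : 1 <= U. Proof. exact: A1_ge1 uU. Qed.
Let U0 : 0 < U. Proof. exact: lt_le_trans U1. Qed.
Let eta0 : 0 < eta. Proof. by case: spS => _ /andP[]. Qed.
Let A0 : 0 < A. Proof. exact: lt_le_trans A1. Qed.

Definition uavg Q : R := fine (wint mu u (cs Q)).

Lemma uavgE Q : wint mu u (cs Q) = (uavg Q)%:E.
Proof. by rewrite fineK// ge0_fin_numE ?wint_ge0// (A1_fin uU). Qed.

Lemma uavg_ge0 Q : 0 <= uavg Q.
Proof. by apply: fine_ge0; exact: wint_ge0. Qed.

(** The thresholds of [core]: by Markov's inequality K excludes a quarter of each cube, while [8 Wb]
    and [h Wb] exclude an eighth each. For [s = 1/(t-1)], [1/h] is [8^(t-1) A], the source of the
    exponential in t in the final constant. *)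
Let K : R := 4 / eta.
Let h : R := 8^-1 `^ s^-1 / A.

Let K0' : 0 < K. Proof. by rewrite divr_gt0. Qed.
Let h0 : 0 < h. Proof. by rewrite divr_gt0// powR_gt0. Qed.

Definition stack Q (x : T) : R := \sum_(P <- S | `[< cs P `<=` cs Q >]) \1_(cs P) x.

Lemma measurable_stack Q : measurable_fun setT (stack Q).
Proof.
rewrite /stack; under eq_fun do rewrite -big_filter.
by apply: measurable_sum => P; exact: measurable_indic.
Qed.

Let stack_ge0 Q x : 0 <= stack Q x.
Proof. by apply: sumr_ge0. Qed.

Definition core Q : set T := cs Q `&` (~` [set x | K < stack Q x] `&`
  (~` [set x | 8 * Wb Q < W x] `&` [set x | h * Wb Q <= W x])).

Lemma measurable_core Q : measurable (core Q).
Proof.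
apply: measurableI => //; apply: measurableI.
  by apply: measurableC; apply: measurable_gt; exact: measurable_stack.
apply: measurableI; last exact: measurable_ge.
by apply: measurableC; exact: measurable_gt.
Qed.

Lemma core_sub Q : core Q `<=` cs Q.
Proof. by move=> x []. Qed.

Let fin_sub Q E : measurable E -> E `<=` cs Q -> (mu E < +oo)%E.
Proof.
move=> mE EQ; apply: (@le_lt_trans _ _ (mu (cs Q))); last by rewrite mu_cs ltry.
by rewrite le_measure ?inE.
Qed.

Lemma core_large Q : ((vol Q / 2)%:E <= mu (core Q))%E.
Proof.
have mS := measurable_stack.
pose X1 := cs Q `&` [set x | K < stack Q x].
pose X2 := cs Q `&` [set x | 8 * Wb Q < W x].
pose X3 := cs Q `&` ~` [set x | h * Wb Q <= W x].
have mX1 : measurable X1 by apply: measurableI => //; exact: measurable_gt.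
have mX2 : measurable X2 by apply: measurableI => //; exact: measurable_gt.
have mX3 : measurable X3.
  by apply: measurableI => //; apply: measurableC; exact: measurable_ge.
have mC := measurable_core Q.
have i1 : (K%:E * mu X1 <= (vol Q / eta)%:E)%E.
  apply: (@le_trans _ _ (wint mu (stack Q) (cs Q))).
    apply: measure_markov => //; [exact: ltW|by move=> x []|].
    by move=> x [_ /ltW].
  have := sparse_carleson Q spS A1_bound_cst1.
  rewrite wint_cst1// mu_cs -EFinM mul1r mulrC; apply: le_trans.
  rewrite /stack; under [wint _ _ _]eq_integral do rewrite -big_filter.
  rewrite -/(wint _ _ _) wint_sum//; last by move=> P; exact: measurable_indic.
  rewrite -[leRHS]big_filter; apply: lee_sum => P _.
  rewrite wint_cst1// /wint integral_indic//; exact: measureIl.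
have i2 : ((8 * Wb Q)%:E * mu X2 <= (Wb Q * vol Q)%:E)%E.
  rewrite -WbE; apply: measure_markov => //.
  - by move=> x; exact: ltW.
  - by rewrite mulr_ge0// ltW.
  - by move=> x [].
  - by move=> x [_ /ltW].
have hWb : 0 < h * Wb Q by rewrite mulr_gt0.
have i3 : (((h * Wb Q) `^ (- s))%:E * mu X3 <= (vol Q * (A / Wb Q) `^ s)%:E)%E.
  apply: le_trans (WbN Q); apply: measure_markov => //.
  - exact: measurable_powRf.
  - by move=> x; exact: powR_ge0.
  - exact: powR_ge0.
  - by move=> x [].
  - move=> x [_ /= /negP]; rewrite -ltNge => /ltW Wh.
    rewrite !powRN lef_pV2 ?posrE ?powR_gt0//.
    by apply: ge0_ler_powR; rewrite ?nnegrE ?(ltW s0) ?(ltW hWb) ?(ltW (W0 x)).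
have cover : (mu (cs Q) <= mu (core Q) + mu X1 + mu X2 + mu X3)%E.
  apply: (@le_trans _ _ (mu (core Q `|` X1 `|` X2 `|` X3))).
    rewrite le_measure ?inE//; first by do 3!apply: measurableU => //.
    move=> x Qx; have [x3|x3] := pselect (h * Wb Q <= W x); last by right; split.
    left; have [x2|x2] := pselect (8 * Wb Q < W x); first by right; split.
    left; have [x1|x1] := pselect (K < stack Q x); first by right; split.
    by left; split.
  apply: le_trans (measureU2 _ _ _) _ => //; first by do 2!apply: measurableU => //.
  apply: leeD => //; apply: le_trans (measureU2 _ _ _) _ => //.
    exact: measurableU.
  by apply: leeD => //; exact: measureU2.
move: i1 i2 i3 cover; rewrite mu_cs.
have [c c0 ->] := fin_num_real (measure_ge0 mu _) (fin_sub mC (@core_sub Q)).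
have [x1 x10 ->] := fin_num_real (measure_ge0 mu _) (fin_sub mX1 (@subIsetl _ _ _)).
have [x2 x20 ->] := fin_num_real (measure_ge0 mu _) (fin_sub mX2 (@subIsetl _ _ _)).
have [x3 x30 ->] := fin_num_real (measure_ge0 mu _) (fin_sub mX3 (@subIsetl _ _ _)).
rewrite -!EFinM -!EFinD !lee_fin => i1 i2 i3 cover.
have vQ := vol0 Q; have wQ := Wb0 Q.
have j1 : x1 <= vol Q / 4.
  have : 4 / eta * x1 <= vol Q / eta by [].
  by rewrite mulrAC ler_pM2r ?invr_gt0//; lra.
have j2 : x2 <= vol Q / 8.
  by rewrite -(ler_pM2l wQ); move: i2; lra.
have j3 : x3 <= vol Q / 8.
  move: i3; rewrite powRN -ler_pdivlMl ?invr_gt0 ?powR_gt0// invrK.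
  rewrite mulrCA -powRM ?divr_ge0 ?(ltW hWb) ?(ltW A0) ?(ltW wQ)//.
  have -> : h * Wb Q * (A / Wb Q) = 8^-1 `^ s^-1.
    by rewrite /h; field; rewrite !gt_eqF.
  by rewrite -powRrM mulVf ?gt_eqF// powRr1.
lra.
Qed.

(** The core has half of the volume, hence at least [1/(2U)] of the u-mass, and W is at least [h Wb]
    on it. *)
Lemma core_mass Q :
  ((h * Wb Q * uavg Q / (2 * U))%:E <= wint mu (fun x => (u x * W x)%R) (core Q))%E.
Proof.
have mC := measurable_core Q.
have lowW : ((h * Wb Q)%:E * wint mu u (core Q) <= wint mu (fun x => (u x * W x)%R) (core Q))%E.
  rewrite -wintZ//; last by rewrite mulr_ge0 ?ltW.
  apply: wint_le => //.
  - exact: measurable_funM.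
  - exact: measurable_funM.
  - by move=> x; rewrite mulr_ge0// mulr_ge0 ?ltW.
  - by move=> x [_ [_ [_ /= ?]]]; rewrite mulrC ler_wpM2l.
apply: le_trans lowW.
have := core_large Q; have := A1_lower uU mC (@core_sub Q); rewrite uavgE.
have finu : (wint mu u (core Q) < +oo)%E.
  apply: le_lt_trans (A1_fin uU Q); apply: wint_sub => //; exact: core_sub.
have [c c0 ->] := fin_num_real (measure_ge0 mu _) (fin_sub mC (@core_sub Q)).
have [b b0 ->] := fin_num_real (wint_ge0 mu _ u0) finu.
rewrite -!EFinM !lee_fin => i1 i2.
have vQ := vol0 Q; have q0 := uavg_ge0 Q.
have key : uavg Q <= b * (2 * U).
  rewrite -(ler_pM2l vQ); apply: (@le_trans _ _ (2 * (c * uavg Q))).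
    by rewrite mulrA; apply: ler_wpM2r => //; lra.
  by move: i1; lra.
rewrite ler_pdivrMr ?mulr_gt0// -[leRHS]mulrA ler_wpM2l// ltW// mulr_gt0//.
Qed.

(** Take the largest cube whose core contains x. All other cubes with x in their core lie inside it,
    so they are counted by its [stack], which is at most K at points of its core. *)
Lemma core_overlap (p : pred cube) x : \sum_(Q <- S | p Q) \1_(core Q) x <= K.
Proof.
have [Sx|Sx] := boolP (has (fun Q => x \in core Q) S); last first.
  rewrite big_seq_cond big1 ?(ltW K0')// => Q /andP[QS _].
  by move/hasPn : Sx => /(_ _ QS) /negbTE; rewrite indicE => ->.
have [Q [QS /set_mem xQ Qmax]] := seq_max sd Sx.
have [Qx [/= nK _]] := xQ; move/negP : nK; rewrite -leNgt; apply: le_trans.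
rewrite /stack big_mkcond [leRHS]big_mkcond big_seq [leRHS]big_seq.
apply: ler_sum => P PS; case: ifP => pP; last by case: ifP.
have [xP|xP] := boolP (x \in core P); last by rewrite indicE (negbTE xP); case: ifP.
have Px := core_sub (set_mem xP).
rewrite asboolT; first by rewrite !indicE xP mem_set.
apply: (sparse_nested spS PS QS Px Qx); exact: Qmax.
Qed.

Variables (a : cube -> R) (Nn : R).
Hypotheses (a0 : forall Q, 0 <= a Q) (Nn0 : 0 <= Nn).
Hypothesis weakN : forall sg : R, 0 < sg ->
  (wint mu (fun x => (u x * W x)%R)
     [set x | exists2 Q, Q \in S & cs Q x /\ (sg * W x < a Q)%R] <= (Nn / sg)%:E)%E.

(** [2 U / h] comes from [core_mass], K from [core_overlap], and 8 from the ceiling of W on a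
    core. *)
Let C1 : R := 2 * U / h * K * 8.

Let C10 : 0 < C1. Proof. by rewrite !mulr_gt0// invr_gt0. Qed.

Let C1nn : 0 <= C1. Proof. exact: ltW. Qed.

(** The core of a cube with [k Wb < a] lies in the level set for [k / 8], because [W <= 8 Wb] there.
    The mass of the cores in this level set is at most K times that of the set. *)
Lemma level_sum (k : R) : 0 < k ->
  \sum_(Q <- S | k * Wb Q < a Q) Wb Q * uavg Q <= C1 * Nn / k.
Proof.
move=> k0; pose X := [set x | exists2 Q, Q \in S & cs Q x /\ k / 8 * W x < a Q].
have mX : measurable X.
  have -> : X = \bigcup_(Q in [set` S]) (cs Q `&` ~` [set x | a Q <= k / 8 * W x]).
    apply/seteqP; split => x; first by move=> [Q QS [Qx /= h']]; exists Q => //; split => //=; apply/negP; rewrite -ltNge.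
    by move=> [Q QS [Qx /= /negP]]; rewrite -ltNge => ?; exists Q.
  apply: fin_bigcup_measurable; first exact: finite_seq.
  move=> Q _; apply: measurableI => //; apply: measurableC; apply: measurable_ge.
  exact: measurable_funM.
have mUW : measurable_fun setT (fun x => u x * W x) by exact: measurable_funM.
have uW0 x : 0 <= u x * W x by rewrite mulr_ge0// ltW.
have ovK x : X x -> \sum_(Q <- [seq Q <- S | k * Wb Q < a Q]) \1_(core Q) x <= K.
  by move=> _; rewrite big_filter; exact: core_overlap.
have ov := wint_overlap mu mUW uW0 mX measurable_core (ltW K0') ovK.
have k80 : 0 < k / 8 by rewrite divr_gt0.
have K0E : (0 <= K%:E)%E by rewrite lee_fin ltW.
have {}ov := le_trans ov (lee_wpmul2l K0E (weakN k80)).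
have : ((\sum_(Q <- S | k * Wb Q < a Q) h * Wb Q * uavg Q / (2 * U))%:E <=
    K%:E * (Nn / (k / 8))%:E)%E.
  apply: le_trans ov; rewrite big_filter -sumEFin big_seq_cond [leRHS]big_seq_cond.
  apply: lee_sum => Q /andP[QS ka]; rewrite (_ : X `&` core Q = core Q); first exact: core_mass.
  apply/setIidr => x xQ; exists Q => //; split; first exact: core_sub xQ.
  have [_ [_ [/negP /=]]] := xQ; rewrite -leNgt => W8 _; apply: le_lt_trans ka.
  by rewrite mulrAC ler_pdivrMr// mulrAC -mulrA ler_wpM2l// ltW.
rewrite -EFinM lee_fin => H.
have -> : \sum_(Q <- S | k * Wb Q < a Q) Wb Q * uavg Q =
   2 * U / h * \sum_(Q <- S | k * Wb Q < a Q) h * Wb Q * uavg Q / (2 * U).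
  rewrite mulr_sumr; apply: eq_bigr => Q _; field.
  by rewrite !gt_eqF.
have c0 : 0 <= 2 * U / h by apply: ltW; apply: divr_gt0 => //; exact: mulr_gt0.
apply: le_trans (ler_wpM2l c0 H) _.
by rewrite le_eqVlt; apply/orP; left; apply/eqP; rewrite /C1; field; rewrite !gt_eqF.
Qed.

Variables (F : cube -> set T) (e rho : R).
Hypotheses (mF : forall Q, measurable (F Q)) (FQ : forall Q, F Q `<=` cs Q).
Hypotheses (e0 : 0 < e) (e1 : e < 1) (rho0 : 0 <= rho).
Hypothesis Fp : forall Q, (wint mu (fun x => u x * W x `^ e)%R (F Q) <=
  (rho * Wb Q `^ e * uavg Q)%:E)%E.
Hypothesis Fm : forall Q, (wint mu (fun x => u x * W x `^ (- e))%R (F Q) <=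
  (rho * Wb Q `^ (- e) * uavg Q)%:E)%E.

Let mUW : measurable_fun setT (fun x => u x * W x).
Proof. exact: measurable_funM. Qed.

Let uW0 x : 0 <= u x * W x.
Proof. by rewrite mulr_ge0// ltW. Qed.

Let mUWp p : measurable_fun setT (fun x => u x * W x `^ p).
Proof. by apply: measurable_funM => //; exact: measurable_powRf. Qed.

Let uWp0 p x : 0 <= u x * W x `^ p.
Proof. by rewrite mulr_ge0// powR_ge0. Qed.

Definition sparse_sum (p : pred cube) (x : T) : R :=
  \sum_(Q <- S | p Q) a Q * \1_(F Q) x.

Lemma measurable_sparse_sum p : measurable_fun setT (sparse_sum p).
Proof.
rewrite /sparse_sum; under eq_fun do rewrite -big_filter.
apply: measurable_sum => Q; apply: measurable_funM => //; exact: measurable_indic.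
Qed.

Lemma sparse_sum_ge0 p x : 0 <= sparse_sum p x.
Proof. by apply: sumr_ge0 => Q _; rewrite mulr_ge0. Qed.

Let r Q := a Q / Wb Q.

Let r0 Q : 0 <= r Q. Proof. by rewrite divr_ge0// ltW. Qed.

Let aE Q : a Q = r Q * Wb Q. Proof. by rewrite divfK// gt_eqF. Qed.

Let rgt k Q : (k * Wb Q < a Q) = (k < r Q).
Proof. by rewrite /r ltr_pdivlMr. Qed.

(** Dominate [r^(1-e)] by the sum of [2 * 2^(k(1-e))] over the k with [2^k < r] and apply
    [level_sum] at each [2^k]. A geometric series of ratio [2^-e] remains, with sum at most
    [2/e]. *)
Lemma level_sum_ge1 : \sum_(Q <- S | Wb Q < a Q) r Q `^ (1 - e) * (Wb Q * uavg Q) <=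
  4 * C1 * Nn / e.
Proof.
have wu0 Q : 0 <= Wb Q * uavg Q by rewrite mulr_ge0 ?uavg_ge0// ltW.
have e1' : 0 <= 1 - e by rewrite subr_ge0 ltW.
have [M rM] : exists M, forall Q, Q \in S -> r Q <= 2 ^+ M.
  exists (\sum_(Q <- S) (Num.truncn (r Q)).+1)%N => Q QS.
  have /andP[_ /ltW h1] := truncn_itv (r0 Q); apply: (le_trans h1).
  apply: (@le_trans _ _ (2 ^+ (Num.truncn (r Q)).+1)).
    by rewrite -natrX ler_nat ltnW// ltn_expl.
  by rewrite ler_eXn2l ?ltr1n// (big_rem Q)//= leq_addr.
pose q := 2 `^ (1 - e).
have q0 : 0 <= q by exact: powR_ge0.
have split_r Q : Q \in S -> Wb Q < a Q ->
    r Q `^ (1 - e) <= \sum_(k <- iota 0 M | 2 ^+ k * Wb Q < a Q) 2 * q ^+ k.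
  move=> QS; rewrite -[X in X < _]mul1r rgt => r1.
  have exk : exists k, r Q <= 2 ^+ k by exists M; exact: rM.
  case: (ex_minnP exk) => -[|k] rk kmin.
    by move: r1; rewrite ltNge; move: rk; rewrite expr0 => ->.
  have kr : 2 ^+ k < r Q.
    by rewrite ltNge; apply/negP => /kmin; rewrite ltnn.
  have kM : (k < M)%N by rewrite (leq_trans _ (kmin M (rM _ QS))).
  have kin : k \in iota 0 M by rewrite mem_iota.
  rewrite (big_rem k)//= rgt kr; apply: ler_wpDr.
    by apply: sumr_ge0 => i _; rewrite mulr_ge0// exprn_ge0.
  apply: (@le_trans _ _ ((2 ^+ k.+1) `^ (1 - e))).
    by apply: ge0_ler_powR; rewrite ?nnegrE ?exprn_ge0.
  rewrite -powR_mulrn// powRAC powR_mulrn// -/q exprS ler_wpM2r ?exprn_ge0//.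
  by rewrite /q -[leRHS]powRr1//; apply: ler_powR; rewrite ?ler1n// gerBl ltW.
apply: (@le_trans _ _ (\sum_(k <- iota 0 M) (2 * q ^+ k) *
    \sum_(Q <- S | 2 ^+ k * Wb Q < a Q) Wb Q * uavg Q)).
  under [leRHS]eq_bigr do rewrite mulr_sumr big_mkcond.
  rewrite exchange_big/= big_mkcond big_seq [leRHS]big_seq.
  apply: ler_sum => Q QS; case: ifP => [wa|_]; last first.
    by apply: sumr_ge0 => k _; case: ifP => // _; rewrite !mulr_ge0// ?exprn_ge0 ?uavg_ge0// ltW.
  rewrite -big_mkcond/= -mulr_suml ler_wpM2r//; exact: split_r.
apply: (@le_trans _ _ (\sum_(k <- iota 0 M) (2 * C1 * Nn) * ((1 / 2) `^ e) ^+ k)).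
  apply: ler_sum => k _.
  have k0 : 0 < 2 ^+ k :> R by rewrite exprn_gt0.
  have := level_sum k0 => H.
  have q20 : 0 <= 2 * q ^+ k by rewrite mulr_ge0// exprn_ge0.
  apply: (le_trans (ler_wpM2l q20 H)).
  have -> : (1 / 2) `^ e = q / 2.
    rewrite half_powR /q powRB ?powRr1//; last by rewrite pnatr_eq0 implybT.
    by rewrite mulrAC mulfV ?mul1r ?pnatr_eq0.
  rewrite le_eqVlt expr_div_n; apply/orP; left; apply/eqP; field.
  by rewrite expf_neq0.
rewrite -mulr_sumr; have e01 : 0 <= e <= 1 by rewrite !ltW.
have half := half_powR_le e01.
have h1 : (1 / 2) `^ e < 1 by apply: (le_lt_trans half); rewrite gtrBl divr_gt0.
have CN : 0 <= 2 * C1 * Nn by rewrite mulr_ge0// mulr_ge0.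
apply: le_trans (ler_wpM2l CN (geometric_partial_sum_le _ _)) _.
  by rewrite powR_ge0.
have -> : 4 * C1 * Nn / e = 2 * C1 * Nn * (e / 2)^-1 by field; rewrite gt_eqF.
rewrite ler_wpM2l// lef_pV2 ?posrE ?subr_gt0 ?divr_gt0//; lra.
Qed.

Lemma weak_bound_up :
  (wint mu (fun x => u x * W x)%R
     [set x | 1 / 2 * W x < sparse_sum (fun Q => Wb Q < a Q) x]%R <=
   (8 * rho * C1 * Nn / e)%:E)%E.
Proof.
set f := sparse_sum _; set X := [set x | _].
have mf : measurable_fun setT f by exact: measurable_sparse_sum.
have mX : measurable X.
  have -> : X = ~` [set x | f x <= 1 / 2 * W x].
    by apply/seteqP; split => x /=; [move=> h' /=; apply/negP; rewrite -ltNge|move/negP; rewrite -ltNge].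
  apply: measurableC; have -> : [set x | f x <= 1 / 2 * W x] = [set x | 0 <= 1 / 2 * W x - f x].
    by apply/seteqP; split => x /=; rewrite subr_ge0.
  by apply: measurable_ge; apply: measurable_funB => //; exact: measurable_funM.
have f0 x : 0 <= f x by exact: sparse_sum_ge0.
have e1' : 0 <= 1 - e by rewrite subr_ge0 ltW.
have h2 : 0 < 1 / 2 :> R by rewrite divr_gt0.
have := @chebyshev_powR _ _ _ mu u W f X (1 - e) (1 / 2) mfu u0 mW W0 mf f0 mX h2 e1' (fun x Xx => Xx).
move=> /le_trans; apply; rewrite subKr.
have c2 : (1 / 2) `^ (- (1 - e)) <= 2 :> R.
  rewrite half_powR powRN invrK.
  by rewrite -[leRHS]powRr1//; apply: ler_powR; rewrite ?ler1n// gerBl ltW.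
have e1s : 0 < 1 - e <= 1 by rewrite subr_gt0 e1 gerBl ltW.
pose g x := \sum_(Q <- S | Wb Q < a Q) (a Q `^ (1 - e)) * (u x * W x `^ e * \1_(F Q) x).
apply: (@le_trans _ _ (2%:E * wint mu g setT)%E).
  apply: lee_pmul => //.
    by apply: wint_ge0 => x; rewrite mulr_ge0// powR_ge0.
  have mg : measurable_fun setT g.
    rewrite /g; under eq_fun do rewrite -big_filter.
    apply: measurable_sum => Q; apply: measurable_funM => //.
    by apply: measurable_funM => //; exact: measurable_indic.
  have mfg : measurable_fun setT (fun x => f x `^ (1 - e) * (u x * W x `^ e)).
    by apply: measurable_funM => //; exact: measurable_powRf.
  apply: (@le_trans _ _ (wint mu (fun x => f x `^ (1 - e) * (u x * W x `^ e)) setT)).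
    by apply: wint_sub => // x; rewrite mulr_ge0// powR_ge0.
  apply: wint_le => // x; first by rewrite mulr_ge0// powR_ge0.
  move=> _; rewrite /g /f /sparse_sum.
  rewrite -big_filter; apply: le_trans (ler_wpM2r (uWp0 e x) (powR_sum_le _ _ e1s)) _.
    by move=> Q; rewrite mulr_ge0.
  rewrite big_filter mulr_suml; apply: ler_sum => Q _.
  rewrite powRM// [(\1_(F Q) x) `^ _](_ : _ = \1_(F Q) x); last first.
    rewrite indicE; case: (_ \in _); rewrite ?powR1// powR0// gt_eqF//.
    by case/andP : e1s.
  by rewrite le_eqVlt; apply/orP; left; apply/eqP; ring.
have gE : (wint mu g setT <= (\sum_(Q <- S | Wb Q < a Q) rho * (r Q `^ (1 - e) * (Wb Q * uavg Q)))%:E)%E.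
  rewrite /g /wint; under eq_integral do rewrite -big_filter.
  rewrite -/(wint _ _ _) wint_sum//; last 2 first.
  - move=> Q; apply: measurable_funM => //.
    by apply: measurable_funM => //; exact: measurable_indic.
  - by move=> Q x; rewrite mulr_ge0 ?powR_ge0// mulr_ge0.
  rewrite -[X in (_ <= X%:E)%E]big_filter -sumEFin; apply: lee_sum => Q _.
  rewrite wintZ ?powR_ge0//; last 2 first.
  - by apply: measurable_funM => //; exact: measurable_indic.
  - by move=> x; rewrite mulr_ge0.
  rewrite wint_indic// setTI.
  have ap0 : (0 <= (a Q `^ (1 - e))%:E)%E by rewrite lee_fin powR_ge0.
  apply: (le_trans (lee_wpmul2l ap0 (Fp Q))).
  rewrite -EFinM lee_fin le_eqVlt; apply/orP; left; apply/eqP.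
  have wE : Wb Q = Wb Q `^ (1 - e) * Wb Q `^ e.
    by rewrite -powRD ?subrK ?powRr1// ?(ltW (Wb0 Q))// oner_eq0.
  rewrite [in LHS]aE powRM//; last exact: ltW.
  by rewrite [in RHS]wE; ring.
have t0 : (0 <= 2%:E :> \bar R)%E by [].
apply: (le_trans (lee_wpmul2l t0 gE)).
rewrite -mulr_sumr -EFinM lee_fin.
have := level_sum_ge1; set LL := \sum_(Q <- S | _) _ => LL4.
have : rho * LL <= rho * (4 * C1 * Nn / e) by rewrite ler_wpM2l.
move=> H; have -> : 8 * rho * C1 * Nn / e = 2 * (rho * (4 * C1 * Nn / e)) by ring.
by rewrite ler_wpM2l.
Qed.

Lemma uavg_carleson Q :
  \sum_(P <- S | `[< cs P `<=` cs Q >]) uavg P <= U / eta * uavg Q.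
Proof.
have := sparse_carleson Q spS uU; rewrite uavgE.
by under eq_bigr do rewrite uavgE; rewrite sumEFin lee_fin.
Qed.

Let level k Q := ((1 / 2) ^+ k.+1 * Wb Q < a Q) && (a Q <= (1 / 2) ^+ k * Wb Q).

Let B := rho * (U / eta) * C1 * Nn.

Let B0 : 0 <= B.
Proof. by rewrite mulr_ge0// mulr_ge0// mulr_ge0// divr_ge0// ltW. Qed.

(** After the expansion into pairs with P not larger than Q, a pair counts only if F P meets F Q,
    and then P lies in Q. The inner integral is controlled by [Fm], with [r_P^e <= 2^-(ke)]; the sum
    over P is a Carleson sum, and the sum over Q is [level_sum] at [2^-(k+1)]. *)
Lemma level_energy k :
  (wint mu (fun x => sparse_sum (level k) x `^ (1 + e) * (u x * W x `^ (- e)))%R setT <=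
   (4 * B * ((1 / 2) `^ e) ^+ k)%:E)%E.
Proof.
pose Sk := [seq Q <- S | level k Q].
pose g Q P x := a Q * a P `^ e * (u x * W x `^ (- e) * \1_(F Q `&` F P) x).
have mg Q P : measurable_fun setT (g Q P).
  apply: measurable_funM => //; apply: measurable_funM => //.
  by apply: measurable_indic; exact: measurableI.
have g0 Q P x : 0 <= g Q P x by rewrite !mulr_ge0// powR_ge0.
have e01 : 0 < e <= 1 by rewrite e0 ltW.
apply: (@le_trans _ _ (wint mu (fun x => 2 * \sum_(Q <- Sk) \sum_(P <- Sk | sd P <= sd Q) g Q P x) setT)).
  apply: wint_le => //.
  - by apply: measurable_funM => //; apply: measurable_powRf; exact: measurable_sparse_sum.
  - apply: measurable_funM => //; apply: measurable_sum => Q.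
    under eq_fun do rewrite -big_filter.
    exact: measurable_sum.
  - by move=> x; rewrite mulr_ge0// powR_ge0.
  move=> x _; rewrite {1}/sparse_sum -big_filter -/Sk.
  have aF0 Q : 0 <= a Q * \1_(F Q) x by rewrite mulr_ge0.
  apply: le_trans (ler_wpM2r (uWp0 (- e) x) (powR_sum_sorted Sk sd aF0 e01)) _.
  rewrite -mulrA ler_wpM2l// mulr_suml; apply: ler_sum => Q _.
  rewrite mulr_suml; apply: ler_sum => P _; rewrite /g indicI powRM//.
  rewrite [(\1_(F P) x) `^ e](_ : _ = \1_(F P) x); last first.
    by rewrite indicE; case: (_ \in _); rewrite ?powR1// powR0// gt_eqF.
  by rewrite le_eqVlt; apply/orP; left; apply/eqP; rewrite /=; ring.
rewrite wintZ//; last 2 first.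
- apply: measurable_sum => Q; under eq_fun do rewrite -big_filter.
  exact: measurable_sum.
- by move=> x; apply: sumr_ge0 => Q _; apply: sumr_ge0.
rewrite wint_sum//; last 2 first.
- by move=> Q; under eq_fun do rewrite -big_filter; exact: measurable_sum.
- by move=> Q x; apply: sumr_ge0.
have th0 : 0 <= ((1 / 2) `^ e) ^+ k :> R by rewrite exprn_ge0// powR_ge0.
set th := ((1 / 2) `^ e) ^+ k in th0 *.
have inner Q : Q \in Sk -> (wint mu (fun x => \sum_(P <- Sk | (sd P <= sd Q)%R) g Q P x)%R setT <=
    (rho * th * (1 / 2) ^+ k * (U / eta) * (Wb Q * uavg Q))%:E)%E.
  rewrite mem_filter => /andP[/andP[_ aQ] QS].
  rewrite /wint; under eq_integral do rewrite -big_filter.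
  rewrite -/(wint _ _ _) wint_sum// big_filter.
  apply: (@le_trans _ _ (\sum_(P <- Sk | `[< cs P `<=` cs Q >]) (a Q * (rho * th * uavg P))%:E)%E).
    rewrite big_mkcond [leRHS]big_mkcond big_seq [leRHS]big_seq.
    apply: lee_sum => P; rewrite mem_filter => /andP[/andP[_ aP] PS].
    have rhs0 : (0 <= (a Q * (rho * th * uavg P))%:E)%E.
      by rewrite lee_fin mulr_ge0// mulr_ge0 ?uavg_ge0// mulr_ge0.
    case: ifP => [sPQ|_]; last by case: ifP.
    rewrite /g wintZ//; last 3 first.
    - by apply: measurable_funM => //; apply: measurable_indic; exact: measurableI.
    - by move=> x; rewrite mulr_ge0.
    - by rewrite mulr_ge0// powR_ge0.
    rewrite wint_indic//; last exact: measurableI.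
    rewrite setTI; have [FQP|FQP] := pselect (F Q `&` F P = set0).
      by rewrite FQP /wint integral_set0 mule0; case: ifP.
    have /set0P[x [xQ xP]] : F Q `&` F P != set0 by exact/eqP.
    have PQ : cs P `<=` cs Q := sparse_nested spS PS QS (FQ xP) (FQ xQ) sPQ.
    rewrite asboolT//.
    apply: (@le_trans _ _ ((a Q * a P `^ e)%:E * (rho * Wb P `^ (- e) * uavg P)%:E)%E).
      apply: lee_wpmul2l; first by rewrite lee_fin mulr_ge0// powR_ge0.
      apply: le_trans (Fm P); apply: wint_sub => //; exact: measurableI.
    rewrite -EFinM lee_fin -!mulrA ler_wpM2l// !mulrA.
    rewrite [a P `^ e * rho]mulrC -mulrA -mulrA -mulrA ler_wpM2l// mulrA.
    rewrite ler_wpM2r ?uavg_ge0// powRN -powR_inv1 ?powR_ge0// powRAC powR_inv1 ?(ltW (Wb0 P))//.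
    rewrite -powRM ?invr_ge0 ?(ltW (Wb0 P))// -/(r P) /th.
    rewrite -powR_mulrn ?powR_ge0// powRAC powR_mulrn//.
    by apply: ge0_ler_powR; rewrite ?nnegrE ?(ltW e0) ?exprn_ge0// /r ler_pdivrMr.
  rewrite sumEFin lee_fin -mulr_sumr -mulr_sumr.
  have sub : \sum_(P <- Sk | `[< cs P `<=` cs Q >]) uavg P <= U / eta * uavg Q.
    apply: le_trans (uavg_carleson Q); rewrite big_filter_cond.
    rewrite big_mkcond [leRHS]big_mkcond; apply: ler_sum => P _.
    by case: ifP => [/andP[_ ->]//|_]; case: ifP => // _; exact: uavg_ge0.
  have rt0 : 0 <= rho * th by rewrite mulr_ge0.
  apply: (@le_trans _ _ (((1 / 2) ^+ k * Wb Q) * (rho * th * (U / eta * uavg Q)))).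
    apply: ler_pM => //; last by rewrite ler_wpM2l.
    by rewrite mulr_ge0// sumr_ge0// => P _; exact: uavg_ge0.
  by rewrite le_eqVlt; apply/orP; left; apply/eqP; ring.
have t0 : (0 <= 2%:E :> \bar R)%E by [].
apply: (@le_trans _ _ (2%:E * (\sum_(Q <- Sk) (rho * th * (1 / 2) ^+ k * (U / eta) * (Wb Q * uavg Q))%:E))%E).
  by apply: lee_wpmul2l => //; rewrite big_seq [leRHS]big_seq; apply: lee_sum.
rewrite sumEFin -EFinM lee_fin -mulr_sumr.
have half0 : 0 < (1 / 2) ^+ k.+1 :> R by rewrite exprn_gt0.
have LS : \sum_(Q <- Sk) Wb Q * uavg Q <= C1 * Nn / (1 / 2) ^+ k.+1.
  apply: le_trans (level_sum half0); rewrite big_filter big_mkcond [leRHS]big_mkcond.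
  apply: ler_sum => Q _; rewrite /level; case: ifP => [/andP[->]//|_].
  by case: ifP => // _; rewrite mulr_ge0 ?uavg_ge0// ltW.
have c0 : 0 <= rho * th * (1 / 2) ^+ k * (U / eta).
  by rewrite mulr_ge0 ?divr_ge0 ?(ltW U0) ?(ltW eta0)// mulr_ge0 ?exprn_ge0// mulr_ge0.
apply: (le_trans (ler_wpM2l t0 (ler_wpM2l c0 LS))).
rewrite le_eqVlt; apply/orP; left; apply/eqP; rewrite /B exprS.
have : (1 / 2) ^+ k != 0 :> R by rewrite expf_neq0.
move: ((1 / 2) ^+ k) => z z0; field.
by rewrite z0 (gt_eqF eta0).
Qed.

Lemma measurable_weak_set p c : measurable [set x | c * W x < sparse_sum p x].
Proof.
have -> : [set x | c * W x < sparse_sum p x] = [set x | 0 < sparse_sum p x - c * W x].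
  by apply/seteqP; split => x /=; rewrite subr_gt0.
apply: measurable_gt; apply: measurable_funB; first exact: measurable_sparse_sum.
exact: measurable_funM.
Qed.

Lemma weak_bound_down :
  (wint mu (fun x => u x * W x)%R
     [set x | 1 / 2 * W x < sparse_sum (fun Q => a Q <= Wb Q) x]%R <=
   (4096 * B / e ^+ 3)%:E)%E.
Proof.
set f := sparse_sum _; set X := [set x | _].
have [M rM] : exists M, forall Q, Q \in S -> 0 < a Q -> (1 / 2) ^+ M * Wb Q < a Q.
  exists (\sum_(Q <- S) (Num.truncn (r Q)^-1).+1)%N => Q QS aQ.
  have rp : 0 < r Q by rewrite divr_gt0.
  have ri0 : 0 <= (r Q)^-1 by rewrite invr_ge0.
  have /andP[_ h1] := truncn_itv ri0; set k := Num.truncn _ in h1.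
  rewrite rgt; apply: (@le_lt_trans _ _ ((1 / 2) ^+ k.+1)).
    by rewrite ler_wiXn2l ?divr_ge0 ?ler_pdivrMr ?mul1r ?ler1n// (big_rem Q)//= leq_addr.
  rewrite div1r exprVn -[ltRHS]invrK ltf_pV2 ?posrE ?exprn_gt0 ?invr_gt0//.
  by apply: (lt_le_trans h1); rewrite -natrX ler_nat ltnW// ltn_expl.
(* The thresholds [c k] add up to at most 1/2, so some level must exceed its own. They decay like
   [q^k], slowly enough: the energy is of order [q^(4k)], Chebyshev loses at most [q^(-2k)], and
   [q^(2k)] is left to sum. *)
pose q := (1 / 2) `^ (e / 4) : R.
have q0 : 0 < q by rewrite powR_gt0// divr_gt0.
have e4 : 0 <= e / 4 <= 1 by move: e0 e1; lra.
have q1 : q <= 1 - e / 8.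
  by apply: (le_trans (half_powR_le e4)); lra.
have q1' : q < 1 by move: q1 e0; lra.
pose c k := (1 - q) * q ^+ k / 2.
have c0 k : 0 < c k by rewrite divr_gt0// mulr_gt0 ?exprn_gt0// subr_gt0.
pose Xk k := [set x | c k * W x < sparse_sum (level k) x].
have mXk k : measurable (Xk k) by exact: measurable_weak_set.
have mX : measurable X by exact: measurable_weak_set.
have cover x : X x -> exists2 k, k \in iota 0 M & Xk k x.
  move=> Xx; apply: contrapT => nk; move: Xx; rewrite /X /=; apply/negP; rewrite -leNgt.
  have small k : k \in iota 0 M -> sparse_sum (level k) x <= c k * W x.
    by move=> kM; rewrite leNgt; apply/negP => ck; apply: nk; exists k.
  apply: (@le_trans _ _ (\sum_(k <- iota 0 M) sparse_sum (level k) x)).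
    rewrite /f /sparse_sum; under [leRHS]eq_bigr do rewrite big_mkcond.
    rewrite exchange_big/= big_mkcond big_seq [leRHS]big_seq; apply: ler_sum => Q QS.
    have pos k : 0 <= (if level k Q then a Q * \1_(F Q) x else 0).
      by case: ifP => // _; rewrite mulr_ge0.
    case: ifP => [aw|_]; last exact: sumr_ge0.
    have [aQ0|aQ0] := leP (a Q) 0.
      have -> : a Q = 0 by apply/eqP; rewrite eq_le aQ0 a0.
      by rewrite mul0r sumr_ge0// => k _; case: ifP.
    have exk : exists k, (1 / 2) ^+ k * Wb Q < a Q by exists M; exact: rM.
    case: (ex_minnP exk) => -[|k] wk kmin.
      by move: wk; rewrite expr0 mul1r ltNge aw.
    have kM : (k < M)%N by rewrite (leq_trans _ (kmin M (rM _ QS aQ0))).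
    have kin : k \in iota 0 M by rewrite mem_iota.
    rewrite (big_rem k)//= /level wk /=.
    have -> : a Q <= (1 / 2) ^+ k * Wb Q.
      by rewrite leNgt; apply/negP => /kmin; rewrite ltnn.
    by rewrite lerDl; apply: sumr_ge0 => i _; exact: pos.
  apply: (@le_trans _ _ (\sum_(k <- iota 0 M) c k * W x)).
    by rewrite big_seq [leRHS]big_seq; apply: ler_sum.
  rewrite -mulr_suml ler_wpM2r ?(ltW (W0 x))// /c -mulr_suml ler_pM2r ?invr_gt0//.
  rewrite -mulr_sumr -ler_pdivlMl ?subr_gt0// mulr1.
  by apply: geometric_partial_sum_le; rewrite ltW.
apply: (le_trans (wint_union_bound mu mUW uW0 mX mXk cover)).
have half0 : 0 <= (1 / 2) `^ e :> R by exact: powR_ge0.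
have e10 : 0 <= 1 + e by rewrite addr_ge0// ltW.
have each k : (wint mu (fun x => u x * W x)%R (Xk k) <=
    (4 * B * (256 / e ^+ 2) * (q ^+ 2) ^+ k)%:E)%E.
  have mf := measurable_sparse_sum (level k).
  have pos x : 0 <= sparse_sum (level k) x by exact: sparse_sum_ge0.
  have := @chebyshev_powR _ _ _ mu u W _ (Xk k) (1 + e) (c k) mfu u0 mW W0 mf pos (mXk k) (c0 k) e10
    (fun x Xx => Xx).
  rewrite opprD addrA subrr add0r -opprD => /le_trans; apply.
  have mfe : measurable_fun setT (fun x => sparse_sum (level k) x `^ (1 + e) * (u x * W x `^ (- e))).
    by apply: measurable_funM => //; exact: measurable_powRf.
  apply: (@le_trans _ _ ((c k `^ (- (1 + e)))%:E * (4 * B * ((1 / 2) `^ e) ^+ k)%:E)%E).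
    apply: lee_wpmul2l; first by rewrite lee_fin powR_ge0.
    apply: le_trans (level_energy k); apply: wint_sub => // x.
    by rewrite mulr_ge0// powR_ge0.
  rewrite -EFinM lee_fin.
  (* As [c k <= 1] and [e < 1], the exponent may be replaced by -2; then [1 - q >= e/8] gives
     [c k >= (e/16) q^k]. *)
  have ck : c k `^ (- (1 + e)) <= 256 / e ^+ 2 * (q ^- 2) ^+ k.
    have c1 : c k <= 1.
      rewrite /c ler_pdivrMr// mul1r; apply: (@le_trans _ _ 1); last by rewrite ler1n.
      by rewrite mulr_ile1 ?subr_ge0 ?exprn_ge0 ?(ltW q0) ?(ltW q1') ?gerBl ?exprn_ile1 ?(ltW q0) ?(ltW q1').
    apply: (@le_trans _ _ (c k `^ (- 2))).
      by apply: ger_powR; rewrite ?c0 ?c1// lerN2; move: e1; lra.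
    rewrite powR_invn ?(ltW (c0 k))// /c.
    have qk : 0 < q ^+ k by rewrite exprn_gt0.
    have -> : 256 / e ^+ 2 * (q ^- 2) ^+ k = ((e / 16) * q ^+ k) ^- 2.
      rewrite exprVn -!exprM mulnC exprM; field.
      by rewrite (gt_eqF e0) (gt_eqF qk).
    rewrite lef_pV2 ?posrE ?exprn_gt0 ?mulr_gt0 ?divr_gt0 ?subr_gt0//.
    rewrite lerXn2r ?nnegrE ?mulr_ge0 ?divr_ge0 ?(ltW e0) ?(ltW qk) ?subr_ge0 ?(ltW q1')//.
    by rewrite [leRHS]mulrAC ler_pM2r//; move: q1; lra.
  have -> : (1 / 2) `^ e = q ^+ 4.
    by rewrite -powR_mulrn ?(ltW q0)// /q -powRrM; congr (_ `^ _); field.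
  have q4k : 0 <= (q ^+ 4) ^+ k by do 2!apply: exprn_ge0; exact: ltW.
  have BB : 0 <= 4 * B * (q ^+ 4) ^+ k by rewrite mulr_ge0// mulr_ge0.
  apply: (le_trans (ler_wpM2r BB ck)).
  rewrite le_eqVlt; apply/orP; left; apply/eqP.
  have qk : q ^+ k != 0 by rewrite expf_neq0// gt_eqF.
  rewrite exprVn -!exprM ![(_ * k)%N]mulnC !exprM; field.
  by rewrite qk gt_eqF.
apply: (@le_trans _ _ (\sum_(k <- iota 0 M) (4 * B * (256 / e ^+ 2) * (q ^+ 2) ^+ k)%:E)%E).
  by apply: lee_sum => k _; exact: each.
rewrite sumEFin lee_fin -mulr_sumr.
have q2 : q ^+ 2 <= 1 - e / 4.
  have -> : q ^+ 2 = (1 / 2) `^ (e / 2).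
    by rewrite -powR_mulrn ?(ltW q0)// /q -powRrM; congr (_ `^ _); field.
  have e2 : 0 <= e / 2 <= 1 by move: e0 e1; lra.
  by apply: (le_trans (half_powR_le e2)); lra.
have BB : 0 <= 4 * B * (256 / e ^+ 2).
  by rewrite mulr_ge0 ?divr_ge0 ?exprn_ge0 ?(ltW e0)// mulr_ge0.
have q21 : 0 <= q ^+ 2 < 1.
  by rewrite exprn_ge0 ?(ltW q0)//=; move: q2 e0; lra.
apply: (le_trans (ler_wpM2l BB (geometric_partial_sum_le M q21))).
have -> : 4096 * B / e ^+ 3 = 4 * B * (256 / e ^+ 2) * (e / 4)^-1.
  by field; rewrite gt_eqF.
rewrite ler_wpM2l// lef_pV2 ?posrE ?subr_gt0 ?divr_gt0//; last by case/andP: q21.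
by move: q2; lra.
Qed.

Lemma sparse_weak_bound :
  (wint mu (fun x => u x * W x)%R
     [set x | W x < \sum_(Q <- S) a Q * \1_(F Q) x]%R <=
   (5000 * rho * (U / eta) * (2 * U / (8^-1 `^ s^-1 / A) * (4 / eta) * 8) * Nn / e ^+ 3)%:E)%E.
Proof.
pose X1 := [set x | 1 / 2 * W x < sparse_sum (fun Q => Wb Q < a Q) x].
pose X2 := [set x | 1 / 2 * W x < sparse_sum (fun Q => a Q <= Wb Q) x].
have mX1 : measurable X1 by exact: measurable_weak_set.
have mX2 : measurable X2 by exact: measurable_weak_set.
have mX : measurable [set x | W x < \sum_(Q <- S) a Q * \1_(F Q) x].
  have := measurable_weak_set xpredT 1; rewrite /sparse_sum.
  by under [X in measurable [set x | X x]]eq_fun do rewrite mul1r.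
have sub : [set x | W x < \sum_(Q <- S) a Q * \1_(F Q) x] `<=` X1 `|` X2.
  move=> x /=; rewrite (bigID (fun Q => Wb Q < a Q))/= => Wx.
  have [x1|x1] := ltP (1 / 2 * W x) (sparse_sum (fun Q => Wb Q < a Q) x); first by left.
  right; rewrite /X2/= /sparse_sum; under eq_bigl do rewrite leNgt.
  by move: x1 Wx; rewrite /sparse_sum; lra.
apply: (@le_trans _ _ (wint mu (fun x => u x * W x)%R (X1 `|` X2))).
  by apply: wint_sub => //; exact: measurableU.
apply: (le_trans (wint_setUle mu mUW uW0 mX1 mX2)).
apply: (le_trans (leeD weak_bound_up weak_bound_down)).
rewrite -EFinD lee_fin -/h -/K -/C1.
have eta1 : eta <= 1 by case: spS => _ /andP[].
have Ue : 1 <= U / eta by rewrite ler_pdivlMr// mul1r (le_trans eta1).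
have CN : 0 <= rho * C1 * Nn by rewrite mulr_ge0// mulr_ge0.
have BE : B = U / eta * (rho * C1 * Nn) by rewrite /B; ring.
have CB : rho * C1 * Nn <= B by rewrite BE ler_peMl.
have e3 : 0 < e ^+ 3 by rewrite exprn_gt0.
have -> : 5000 * rho * (U / eta) * C1 * Nn / e ^+ 3 = 5000 * B / e ^+ 3.
  by rewrite /B; field; rewrite !gt_eqF.
have -> : 8 * rho * C1 * Nn / e = 8 * (rho * C1 * Nn) * e ^+ 2 / e ^+ 3.
  by field; rewrite gt_eqF.
rewrite -mulrDl ler_pM2r ?invr_gt0//.
have e2 : e ^+ 2 <= 1 by rewrite exprn_ile1// ltW.
have : rho * C1 * Nn * e ^+ 2 <= B.
  by apply: le_trans CB; rewrite ler_piMr.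
by move: B0; lra.
Qed.

End weighted.
End sparse_families.

(** * Oscillation layers *)

Lemma powR_homo (R : realType) (p x y : R) : 0 <= p -> 0 <= x -> x <= y ->
  x `^ p <= y `^ p.
Proof.
by move=> p0 x0 xy; apply: ge0_ler_powR => //; rewrite nnegrE//; exact: le_trans xy.
Qed.

Section layers.
Context {R : realType} {d : measure_display} {T : measurableType d}.
Variable mu : {measure set T -> \bar R}.

Lemma wint_sigma_subadditive (u : T -> R) (X : nat -> set T) (Y : set T) :
  measurable_fun setT u -> (forall x, 0 <= u x) -> (forall i, measurable (X i)) ->
  measurable Y -> Y `<=` \bigcup_i X i ->
  (wint mu u Y <= \sum_(i <oo) wint mu u (X i))%E.
Proof.
move=> mfu u0 mX mY YX.
have mS i : measurable (seqDU X i).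
  by apply: measurableD => //; exact: bigsetU_measurable.
apply: (@le_trans _ _ (wint mu u (\bigcup_i X i))).
  by apply: wint_sub => //; exact: bigcupT_measurable.
rewrite seqDU_bigcup_eq wint_bigcup//.
apply: lee_nneseries => [i _ _|i _]; first exact: wint_ge0.
by apply: wint_sub => //; exact: subset_seqDU.
Qed.

(** At [y] proportional to [2^i] this is a decay [16^-i], enough against the growth [8^i] of the
    thresholds in [oscillation_weak_bound]. *)
Lemma expRN_le (y : R) : 0 < y -> expR (- y) <= 256 / y ^+ 4.
Proof.
move=> y0; have y4 : 0 < (y / 4) ^+ 4 by rewrite exprn_gt0// divr_gt0.
have -> : 256 / y ^+ 4 = ((y / 4) ^+ 4)^-1 by field; rewrite gt_eqF.
rewrite expRN lef_pV2 ?posrE ?expR_gt0//.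
have -> : expR y = expR (y / 4) ^+ 4.
  by rewrite -expRM_natl; congr expR; field.
rewrite lerXn2r ?nnegrE ?expR_ge0 ?divr_ge0 ?(ltW y0)//.
by have := expR_ge1Dx (y / 4); lra.
Qed.

Variables (cube : choiceType) (cs : cube -> set T) (vol : cube -> R) (N L : R).
Hypothesis cz : cz_system mu cs vol N.
Hypotheses (L1 : 1 <= L) (NL : N = 2 `^ L).
Implicit Types (P Q : cube).
Variables (u : T -> R) (U : R).
Hypothesis uU : A1_bound mu cs vol u U.
Variables (W : T -> R) (Wb : cube -> R) (A s : R).
Hypotheses (mW : measurable_fun setT W) (W0 : forall x, 0 < W x).
Hypotheses (Wb0 : forall Q, 0 < Wb Q) (A1 : 1 <= A) (s0 : 0 < s) (s1 : s <= 1).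
Hypothesis WbE : forall Q, wint mu W (cs Q) = (Wb Q * vol Q)%:E.
Hypothesis WbN : forall Q,
  (wint mu (fun x => W x `^ (- s))%R (cs Q) <= (vol Q * (A / Wb Q) `^ s)%:E)%E.
Variables (sd : cube -> R) (eta : R) (S : seq cube).
Hypothesis spS : sparse_seq mu cs vol sd eta S.
Variables (a : cube -> R) (Nn : R).
Hypotheses (a0 : forall Q, 0 <= a Q) (Nn0 : 0 <= Nn).
Hypothesis weakN : forall sg : R, 0 < sg ->
  (wint mu (fun x => (u x * W x)%R)
     [set x | exists2 Q, Q \in S & cs Q x /\ (sg * W x < a Q)%R] <= (Nn / sg)%:E)%E.
Variables (l : nat) (y : 'I_l -> cube -> T -> R) (kap : R).
Hypotheses (l0 : (0 < l)%N) (kap0 : 0 < kap) (kap1 : kap <= 1).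
Hypothesis my : forall i Q, measurable_fun setT (y i Q).
Hypothesis yexp : forall i Q,
  (wint mu (fun x => expR (kap * y i Q x))%R (cs Q) <= (6 * vol Q)%:E)%E.

Let mcs Q : measurable (cs Q). Proof. exact: (cz_measurable cz). Qed.
Let mu_cs Q : mu (cs Q) = (vol Q)%:E. Proof. exact: (cz_vol cz). Qed.
Let vol0 Q : 0 < vol Q. Proof. exact: (cz_vol_gt0 cz). Qed.
Let mfu : measurable_fun setT u. Proof. exact: A1_measurable uU. Qed.
Let u0 : forall x, 0 <= u x. Proof. exact: A1_ge0 uU. Qed.
Let U1 : 1 <= U. Proof. exact: A1_ge1 uU. Qed.
Let U0 : 0 < U. Proof. exact: lt_le_trans U1. Qed.
Let lR : 0 < l%:R :> R. Proof. by rewrite ltr0n. Qed.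
Let l1 : 1 <= l%:R :> R. Proof. by rewrite ler1n. Qed.

Let eps : R := (4 * U * L)^-1.
Let L0 : 0 < L. Proof. exact: lt_le_trans L1. Qed.
Let eps0 : 0 < eps. Proof. by rewrite invr_gt0 !mulr_gt0. Qed.
Let eps1 : eps <= 4^-1.
Proof.
rewrite lef_pV2 ?posrE ?mulr_gt0// -mulrA ler_peMr//.
by rewrite -[leLHS]mulr1 ler_pM.
Qed.

(** The factor s is there because, besides W itself, only [W^(-s)] has a controlled average; then
    [W^(-e) = (W^(-s))^(eps/2)]. *)
Let e : R := s * eps / 2.
Let e0 : 0 < e. Proof. by rewrite divr_gt0// mulr_gt0. Qed.
Let e_eps : e <= eps / 2.
Proof. by rewrite ler_pM2r ?invr_gt0// ler_piMl// ltW. Qed.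
Let e1 : e < 1. Proof. by move: eps1 e_eps eps0; lra. Qed.

(** These are superlevel sets rather than annuli; layer 0 is the whole cube, since the oscillation
    is at least 1 everywhere. *)
Definition layer (i : nat) Q : set T := cs Q `&`
  if i is 0%N then setT else \bigcup_(j in [set: 'I_l]) [set x | 2 ^+ i <= y j Q x].

Lemma measurable_layer i Q : measurable (layer i Q).
Proof.
apply: measurableI => //; case: i => [|i]; first exact: measurableT.
by apply: fin_bigcup_measurable => // j _; exact: measurable_ge.
Qed.

Lemma layer_sub i Q : layer i Q `<=` cs Q.
Proof. by move=> x []. Qed.

Let gy Q x := \sum_(j < l) expR (kap * y j Q x) / (6 * l%:R).

Let mexp j Q : measurable_fun setT (fun x => expR (kap * y j Q x)).
Proof. by apply: measurableT_comp => //; exact: measurable_funM. Qed.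

Let mgy Q : measurable_fun setT (gy Q).
Proof. by apply: measurable_sum => j; exact: measurable_funM. Qed.

Let gy0 Q x : 0 <= gy Q x.
Proof. by apply: sumr_ge0 => j _; rewrite divr_ge0 ?expR_ge0// mulr_ge0// ltW. Qed.

Let gy_avg Q : (wint mu (gy Q) (cs Q) <= (vol Q)%:E)%E.
Proof.
rewrite /gy wint_sum//; last by move=> j; exact: measurable_funM.
have c0 : 0 <= (6 * l%:R)^-1 :> R by rewrite invr_ge0 mulr_ge0// ltW.
apply: (@le_trans _ _ (\sum_(j < l) (vol Q / l%:R)%:E)%E).
  apply: lee_sum => j _; rewrite /wint.
  under eq_integral do rewrite mulrC.
  rewrite -/(wint _ _ _) wintZ//.
  have c0' : (0 <= ((6 * l%:R)^-1 : R)%R%:E)%E by rewrite lee_fin.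
  apply: (le_trans (lee_wpmul2l c0' (yexp j Q))).
  rewrite -EFinM lee_fin le_eqVlt; apply/orP; left; apply/eqP; field.
  by rewrite gt_eqF.
by rewrite sumEFin lee_fin sumr_const card_ord -[leLHS]mulr_natr divfK// gt_eqF.
Qed.

Let decay i := expR (1 - kap * eps / 2 * 2 ^+ i).

(** The reverse Holder inequality is applied to the average g of 1 + h + [gy] with weight 1/3. One
    half power of [3 g] dominates [(1 + h)^(eps/2)]; the other one dominates, on the layer, an
    exponential of [2^i] up to the factor [6 l]. Taking h to be a normalized power of W then gives
    both weighted bounds below. *)
Lemma layer_weight i Q (h : T -> R) : measurable_fun setT h -> (forall x, 0 <= h x) ->
  (wint mu h (cs Q) <= (vol Q)%:E)%E ->
  (wint mu (fun x => u x * (1 + h x) `^ (eps / 2))%R (layer i Q) <=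
   (8 * U * (18 * l%:R * decay i) * uavg mu cs u Q)%:E)%E.
Proof.
move=> mh h0 hQ.
pose g x := 3^-1 * (1 + h x + gy Q x).
have mg : measurable_fun setT g.
  by apply: measurable_funM => //; apply: measurable_funD => //; exact: measurable_funD.
have g0 x : 0 <= g x by rewrite mulr_ge0// !addr_ge0.
have m1h : measurable_fun setT (fun x => 1 + h x) by exact: measurable_funD.
have gQ : (wint mu g (cs Q) <= (vol Q)%:E)%E.
  rewrite /g wintZ//; last 2 first.
  - by apply: measurable_funD.
  - by move=> x; rewrite !addr_ge0.
  rewrite wintD//; last by move=> x; rewrite addr_ge0.
  rewrite wintD// wint_cst1// mu_cs.
  have t0 : (0 <= (3^-1 : R)%R%:E)%E by rewrite lee_fin.
  apply: (le_trans (lee_wpmul2l t0 (leeD (leeD (lexx _) hQ) (gy_avg Q)))).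
  by rewrite -!EFinD -EFinM lee_fin; lra.
have := A1_reverse_holder cz uU mg g0 gQ L1 NL; rewrite -/eps (uavgE uU) => RH.
have mge : measurable_fun setT (fun x => u x * g x `^ eps).
  by apply: measurable_funM => //; exact: measurable_powRf.
have c0 : 0 <= 18 * l%:R * decay i :> R by rewrite !mulr_ge0 ?expR_ge0.
apply: (@le_trans _ _ ((18 * l%:R * decay i)%:E * wint mu (fun x => u x * g x `^ eps)%R (cs Q))%E); last first.
  have c0' : (0 <= (18 * l%:R * decay i : R)%:E)%E by rewrite lee_fin.
  apply: (le_trans (lee_wpmul2l c0' RH)); rewrite -!EFinM lee_fin.
  by rewrite le_eqVlt; apply/orP; left; apply/eqP; ring.
have mL := measurable_layer i Q.
have uge0 x : 0 <= u x * g x `^ eps by rewrite mulr_ge0// powR_ge0.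
apply: (@le_trans _ _ ((18 * l%:R * decay i)%:E * wint mu (fun x => u x * g x `^ eps)%R (layer i Q))%E); last first.
  apply: lee_wpmul2l; first by rewrite lee_fin.
  apply: wint_sub => //; exact: layer_sub.
rewrite -wintZ//; apply: wint_le => //.
- by apply: measurable_funM => //; exact: measurable_powRf.
- exact: measurable_funM.
- by move=> x; rewrite mulr_ge0// powR_ge0.
move=> x [_ Lx]; rewrite mulrCA ler_wpM2l//.
have h1 : 1 <= 1 + h x by rewrite lerDl.
have h3g : 1 + h x <= 3 * g x by rewrite /g mulVKf// lerDl.
have g3 : 1 <= 3 * g x by exact: le_trans h3g.
have e20 : 0 <= eps / 2 by rewrite divr_ge0// ltW.
have b1 : (1 + h x) `^ (eps / 2) <= (3 * g x) `^ (eps / 2).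
  by apply: powR_homo => //; exact: le_trans h1.
have b2 : (3 * g x) `^ eps <= 3 * g x `^ eps.
  rewrite powRM// ler_wpM2r ?powR_ge0//.
  rewrite -[leRHS]powRr1//; apply: ler_powR; rewrite ?ler1n//.
  by move: eps1; lra.
have ke : kap * eps / 2 <= 1.
  have : kap * eps <= 1 * 4^-1 by rewrite ler_pM// ltW.
  by lra.
(* Layer 0 gives no exponential gain; the factor [expR 1] in [decay] makes the bound hold there,
   since [kap eps / 2 <= 1]. *)
have [i0|ipos] := posnP i.
  apply: (le_trans b1); apply: (@le_trans _ _ ((3 * g x) `^ eps)).
    by apply: ler_powR => //; move: eps0; lra.
  apply: (le_trans b2); rewrite ler_wpM2r ?powR_ge0// i0 /decay expr0 mulr1.
  have : 1 <= expR (1 - kap * eps / 2).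
    by apply: le_trans (expR_ge1Dx _); rewrite lerDl subr_ge0.
  by move: l1; nra.
have big : expR (kap * 2 ^+ i) <= 6 * l%:R * (3 * g x).
  have [j _ /= yj] : (\bigcup_(j in [set: 'I_l]) [set x | 2 ^+ i <= y j Q x]) x.
    by move: Lx ipos; case: (i).
  apply: (@le_trans _ _ (6 * l%:R * gy Q x)).
    have -> : 6 * l%:R * gy Q x = \sum_(j < l) expR (kap * y j Q x).
      by rewrite /gy -mulr_suml mulrC divfK// gt_eqF// mulr_gt0.
    rewrite (bigD1 j)//=.
    apply: ler_wpDr; first by apply: sumr_ge0 => k _; exact: expR_ge0.
    by rewrite ler_expR ler_pM2l.
  rewrite ler_wpM2l ?mulr_ge0// ?(ltW lR)// /g mulVKf// lerDr.
  by rewrite (le_trans _ h1).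
have b3 : expR (kap * eps / 2 * 2 ^+ i) <= 6 * l%:R * (3 * g x) `^ (eps / 2).
  have -> : expR (kap * eps / 2 * 2 ^+ i) = expR (kap * 2 ^+ i) `^ (eps / 2).
    by rewrite /powR gt_eqF ?expR_gt0// expRK; congr (expR _); ring.
  apply: (@le_trans _ _ ((6 * l%:R * (3 * g x)) `^ (eps / 2))).
    by apply: powR_homo => //; exact: expR_ge0.
  have l6 : 1 <= 6 * l%:R :> R by move: l1; lra.
  have g30 : 0 <= 3 * g x by exact: le_trans g3.
  rewrite (powRM _ (le_trans ler01 l6) g30); apply: ler_wpM2r; first exact: powR_ge0.
  rewrite -[leRHS]powRr1 ?(le_trans ler01 l6)//; apply: ler_powR => //.
  by move: eps1; lra.
have E0 := expR_gt0 (kap * eps / 2 * 2 ^+ i).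
have dE : decay i = expR 1 / expR (kap * eps / 2 * 2 ^+ i) by rewrite /decay expRD expRN.
have ee1 : 1 <= expR 1 :> R by apply: le_trans (expR_ge1Dx _); lra.
have gg : (3 * g x) `^ (eps / 2) * (3 * g x) `^ (eps / 2) = (3 * g x) `^ eps.
  by rewrite -powRD -?splitr// gt_eqF// implybT.
have p0 := powR_ge0 (3 * g x) (eps / 2).
rewrite dE.
have -> : 18 * l%:R * (expR 1 / expR (kap * eps / 2 * 2 ^+ i)) * g x `^ eps =
  expR 1 * (6 * l%:R * (3 * g x `^ eps)) / expR (kap * eps / 2 * 2 ^+ i) by ring.
rewrite ler_pdivlMr//; apply: (le_trans (ler_pM (powR_ge0 _ _) (ltW E0) b1 b3)).
rewrite mulrCA gg; apply: (@le_trans _ _ (6 * l%:R * (3 * g x `^ eps))).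
  by rewrite ler_wpM2l// mulr_ge0// ltW.
by rewrite ler_peMl// !mulr_ge0 ?powR_ge0// ltW.
Qed.

Let rho i := 8 * U * (18 * l%:R * decay i) * A.

Let decay0 i : 0 < decay i. Proof. exact: expR_gt0. Qed.

Let rho0 i : 0 <= rho i.
Proof. by rewrite mulr_ge0 ?(le_trans ler01 A1)// mulr_ge0 ?mulr_ge0 ?(ltW U0) ?(ltW (decay0 i)) ?(ltW lR). Qed.

Let layer_pos i Q : (wint mu (fun x => u x * W x `^ e)%R (layer i Q) <=
  (rho i * Wb Q `^ e * uavg mu cs u Q)%:E)%E.
Proof.
pose h x := (Wb Q)^-1 * W x.
have mh : measurable_fun setT h by exact: measurable_funM.
have Wi0 : 0 < (Wb Q)^-1 by rewrite invr_gt0.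
have h0 x : 0 <= h x by rewrite mulr_ge0// ltW.
have hQ : (wint mu h (cs Q) <= (vol Q)%:E)%E.
  rewrite wintZ//; [|by move=> x; exact: ltW|exact: ltW].
  by rewrite WbE -EFinM mulKf ?gt_eqF.
have H := layer_weight i mh h0 hQ.
have mL := measurable_layer i Q.
have m1h : measurable_fun setT (fun x => u x * (1 + h x) `^ (eps / 2)).
  by apply: measurable_funM => //; apply: measurable_powRf; exact: measurable_funD.
have pos1 x : 0 <= u x * (1 + h x) `^ (eps / 2) by rewrite mulr_ge0// powR_ge0.
apply: (@le_trans _ _ ((Wb Q `^ e)%:E * wint mu (fun x => u x * (1 + h x) `^ (eps / 2))%R (layer i Q))%E).
  rewrite -wintZ ?powR_ge0//; apply: wint_le => //.
  - by apply: measurable_funM => //; exact: measurable_powRf.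
  - exact: measurable_funM.
  - by move=> x; rewrite mulr_ge0// powR_ge0.
  move=> x _; rewrite mulrCA ler_wpM2l//.
  have -> : W x = Wb Q * h x by rewrite /h mulVKf// gt_eqF.
  rewrite powRM ?(ltW (Wb0 Q))// ler_wpM2l ?powR_ge0//.
  apply: (@le_trans _ _ ((1 + h x) `^ e)).
    by apply: powR_homo; rewrite ?(ltW e0)// lerDr.
  by apply: ler_powR => //; rewrite lerDl.
have w0 : (0 <= (Wb Q `^ e)%:E)%E by rewrite lee_fin powR_ge0.
apply: (le_trans (lee_wpmul2l w0 H)); rewrite -EFinM lee_fin /rho.
set z := 8 * U * _; have z0 : 0 <= z.
  by rewrite mulr_ge0 ?mulr_ge0 ?(ltW U0) ?(ltW (decay0 i)) ?(ltW lR).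
have q0 : 0 <= uavg mu cs u Q by exact: uavg_ge0 uU _.
have w0' := powR_ge0 (Wb Q) e.
have : 0 <= z * (Wb Q `^ e * uavg mu cs u Q) by rewrite mulr_ge0// mulr_ge0.
have -> : Wb Q `^ e * (z * uavg mu cs u Q) = 1 * (z * (Wb Q `^ e * uavg mu cs u Q)) by ring.
have -> : z * A * Wb Q `^ e * uavg mu cs u Q = A * (z * (Wb Q `^ e * uavg mu cs u Q)) by ring.
by move=> ?; rewrite ler_wpM2r.
Qed.

Let layer_neg i Q : (wint mu (fun x => u x * W x `^ (- e))%R (layer i Q) <=
  (rho i * Wb Q `^ (- e) * uavg mu cs u Q)%:E)%E.
Proof.
have A0 : 0 < A by exact: lt_le_trans A1.
have WA0 : 0 < Wb Q / A by rewrite divr_gt0.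
pose h x := (Wb Q / A) `^ s * W x `^ (- s).
have mh : measurable_fun setT h.
  by apply: measurable_funM => //; exact: measurable_powRf.
have h0 x : 0 <= h x by rewrite mulr_ge0// powR_ge0.
have hQ : (wint mu h (cs Q) <= (vol Q)%:E)%E.
  rewrite wintZ ?powR_ge0//; last 2 first.
  - exact: measurable_powRf.
  - by move=> x; exact: powR_ge0.
  have w0 : (0 <= ((Wb Q / A) `^ s)%:E)%E by rewrite lee_fin powR_ge0.
  apply: (le_trans (lee_wpmul2l w0 (WbN Q))); rewrite -EFinM lee_fin.
  rewrite mulrCA -powRM ?divr_ge0 ?(ltW (Wb0 Q)) ?(ltW A0)//.
  have -> : Wb Q / A * (A / Wb Q) = 1 by field; rewrite !gt_eqF.
  by rewrite powR1 mulr1.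
have H := layer_weight i mh h0 hQ.
have mL := measurable_layer i Q.
have m1h : measurable_fun setT (fun x => u x * (1 + h x) `^ (eps / 2)).
  by apply: measurable_funM => //; apply: measurable_powRf; exact: measurable_funD.
have pos1 x : 0 <= u x * (1 + h x) `^ (eps / 2) by rewrite mulr_ge0// powR_ge0.
have c0 : 0 <= A * Wb Q `^ (- e) by rewrite mulr_ge0 ?powR_ge0// ltW.
apply: (@le_trans _ _ ((A * Wb Q `^ (- e))%:E * wint mu (fun x => u x * (1 + h x) `^ (eps / 2))%R (layer i Q))%E).
  rewrite -wintZ//; apply: wint_le => //.
  - by apply: measurable_funM => //; exact: measurable_powRf.
  - exact: measurable_funM.
  - by move=> x; rewrite mulr_ge0// powR_ge0.
  move=> x _; rewrite mulrCA ler_wpM2l//.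
  have hE : h x `^ (eps / 2) = (Wb Q / A) `^ e * W x `^ (- e).
    rewrite /h powRM ?powR_ge0// -!powRrM.
    by congr (_ `^ _ * _ `^ _); rewrite /e; ring.
  have WE : (Wb Q / A) `^ e = Wb Q `^ e * A `^ (- e).
    by rewrite powRM ?invr_ge0 ?(ltW (Wb0 Q)) ?(ltW A0)// -powR_inv1 ?(ltW A0)// -powRrM mulN1r.
  have -> : W x `^ (- e) = A `^ e * Wb Q `^ (- e) * h x `^ (eps / 2).
    rewrite hE WE !powRN.
    have := powR_gt0 e A0; have := powR_gt0 e (Wb0 Q); have := powR_gt0 e (W0 x).
    by move=> *; field; rewrite !gt_eqF.
  apply: ler_pM; rewrite ?powR_ge0 ?mulr_ge0 ?powR_ge0//.
    rewrite ler_wpM2r ?powR_ge0//; apply: le_trans (ler1_powR A1 _) _ => //.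
    exact: ltW.
  by apply: powR_homo; rewrite ?divr_ge0 ?(ltW eps0)// lerDr.
have w0 : (0 <= (A * Wb Q `^ (- e))%:E)%E by rewrite lee_fin.
apply: (le_trans (lee_wpmul2l w0 H)); rewrite -EFinM lee_fin /rho.
by rewrite le_eqVlt; apply/orP; left; apply/eqP; ring.
Qed.

Definition oscillation Q x : R := \big[Order.max/1]_(i < l) y i Q x.

Lemma le_oscillation i Q x : y i Q x <= oscillation Q x.
Proof. by rewrite /oscillation; exact: le_bigmax. Qed.

Lemma oscillation_ge1 Q x : 1 <= oscillation Q x.
Proof. by rewrite /oscillation; exact: bigmax_ge_id. Qed.

Lemma measurable_oscillation Q : measurable_fun setT (oscillation Q).
Proof.
rewrite /oscillation; elim: (index_enum _) => [|i r IH].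
  by rewrite (_ : (fun x => _) = cst 1)//; apply/funext => x; rewrite big_nil.
rewrite (_ : (fun x => _) = y i Q \max (fun x => \big[Order.max/1]_(j <- r) y j Q x)).
  exact: measurable_maxr.
by apply/funext => x; rewrite big_cons.
Qed.

Lemma oscillation_layer Q x : cs Q x -> exists2 i, layer i Q x & oscillation Q x <= 2 ^+ i.+1.
Proof.
move=> Qx; have o1 := oscillation_ge1 Q x.
have exi : exists i, oscillation Q x <= 2 ^+ i.+1.
  exists (Num.truncn (oscillation Q x)).
  have /andP[_ /ltW h] := truncn_itv (le_trans ler01 o1); apply: (le_trans h).
  by rewrite -natrX ler_nat ltnW// ltn_expl.
case: (ex_minnP exi) => -[|i] oi imin; first by exists 0%N => //; split.
exists i.+1 => //; split => //=.
have io : 2 ^+ i.+1 < oscillation Q x.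
  by rewrite ltNge; apply/negP => /imin; rewrite ltnn.
apply: contrapT => nj; move: io; apply/negP; rewrite -leNgt.
apply: bigmax_le; first by rewrite exprn_ege1// ler1n.
move=> j _; rewrite leNgt; apply/negP => /ltW yj; apply: nj.
by exists j.
Qed.

Lemma oscillation_weak_bound :
  (wint mu (fun x => u x * W x)%R
     [set x | W x < \sum_(Q <- S) a Q * (oscillation Q x * \1_(cs Q) x)]%R <=
   (5000 * (8 * U * (18 * l%:R * expR 1) * A) * (U / eta) *
     (2 * U / (8^-1 `^ s^-1 / A) * (4 / eta) * 8) / e ^+ 3 *
     (2 ^+ 20 / (kap * eps) ^+ 4) * Nn)%:E)%E.
Proof.
set X := [set x | _].
have A0 : 0 < A by exact: lt_le_trans A1.
have eta0 : 0 < eta by case: spS => _ /andP[].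
have mUW : measurable_fun setT (fun x => u x * W x) by exact: measurable_funM.
have uW0 x : 0 <= u x * W x by rewrite mulr_ge0// ltW.
(* If x were in no [Xi i], each layer sum would be at most [W / 8^(i+1)]. The oscillation is at most
   [2^(i+1)] for a suitable layer of each cube, so the total would be at most the sum of
   [W / 4^(i+1)], which is below W. *)
pose ai i Q := 8 ^+ i.+1 * a Q.
pose Xi i := [set x | W x < \sum_(Q <- S) ai i Q * \1_(layer i Q) x].
have mXi i : measurable (Xi i).
  pose f x := \sum_(Q <- S) ai i Q * \1_(layer i Q) x.
  have mf : measurable_fun setT f.
    apply: measurable_sum => Q; apply: measurable_funM => //.
    exact/measurable_indic/measurable_layer.
  have -> : Xi i = [set x | 0 < f x - W x].
    by apply/seteqP; split => x; rewrite /Xi/= subr_gt0.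
  by apply: measurable_gt; exact: measurable_funB.
have mX : measurable X.
  pose f x := \sum_(Q <- S) a Q * (oscillation Q x * \1_(cs Q) x).
  have mf : measurable_fun setT f.
    apply: measurable_sum => Q; apply: measurable_funM => //.
    by apply: measurable_funM; [exact: measurable_oscillation|exact: measurable_indic].
  have -> : X = [set x | 0 < f x - W x].
    by apply/seteqP; split => x; rewrite /X/= subr_gt0.
  by apply: measurable_gt; exact: measurable_funB.
have XX : X `<=` \bigcup_i Xi i.
  move=> x Xx; apply: contrapT => nX; move: Xx; rewrite /X/=; apply/negP; rewrite -leNgt.
  have small i : \sum_(Q <- S) a Q * \1_(layer i Q) x <= W x / 8 ^+ i.+1.
    have : ~ Xi i x by move=> Xix; apply: nX; exists i.
    rewrite /Xi /ai/= => /negP; rewrite -leNgt.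
    under eq_bigr do rewrite -mulrA.
    by rewrite -mulr_sumr mulrC -ler_pdivlMr// exprn_gt0.
  have [I0 HI] : exists I0, forall Q, Q \in S -> oscillation Q x <= 2 ^+ I0.
    exists (\sum_(Q <- S) (Num.truncn (oscillation Q x)).+1)%N => Q QS.
    have /andP[_ /ltW h] := truncn_itv (le_trans ler01 (oscillation_ge1 Q x)).
    apply: (le_trans h); apply: (@le_trans _ _ (2 ^+ (Num.truncn (oscillation Q x)).+1)).
      by rewrite -natrX ler_nat ltnW// ltn_expl.
    by rewrite ler_eXn2l ?ltr1n// (big_rem Q)//= leq_addr.
  apply: (@le_trans _ _ (\sum_(i < I0.+1) \sum_(Q <- S) 2 ^+ i.+1 * (a Q * \1_(layer i Q) x))).
    rewrite exchange_big/= big_seq [leRHS]big_seq; apply: ler_sum => Q QS.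
    have pos i : 0 <= 2 ^+ i.+1 * (a Q * \1_(layer i Q) x).
      by rewrite mulr_ge0 ?exprn_ge0// mulr_ge0.
    have [Qx|Qx] := pselect (cs Q x); last first.
      by rewrite indicE memNset// mulr0 mulr0 sumr_ge0.
    rewrite indicE mem_set// mulr1.
    have [i iQ oi] : exists2 i : nat, layer i Q x /\ (i < I0.+1)%N & oscillation Q x <= 2 ^+ i.+1.
      have [i iQ oi] := oscillation_layer Qx; have [iI|Ii] := ltnP i I0.+1.
        by exists i.
      (* A layer of index above [I0] is impossible: it would force an oscillation larger than the
         bound [2^I0] valid for the finite list. *)
      case: i iQ oi Ii => [//|i] iQ oi Ii.
      have [_ [j _ /= yj]] := iQ.
      have ji : 2 ^+ i.+1 <= 2 ^+ I0 :> R.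
        by apply: le_trans yj (le_trans (le_oscillation j Q x) (HI _ QS)).
      by move: ji; rewrite ler_eXn2l ?ltr1n// leqNgt Ii.
    have [iQ' iI] := iQ.
    rewrite (bigD1 (Ordinal iI))//=; apply: ler_wpDr; first exact: sumr_ge0.
    by rewrite indicE mem_set// mulr1 mulrC ler_wpM2r.
  apply: (@le_trans _ _ (\sum_(i < I0.+1) W x * (2 ^+ i.+1)^-1)).
    apply: ler_sum => i _; rewrite -mulr_sumr.
    have p2 : 0 <= 2 ^+ i.+1 :> R by rewrite exprn_ge0.
    apply: (le_trans (ler_wpM2l p2 (small i))).
    have -> : 2 ^+ i.+1 * (W x / 8 ^+ i.+1) = W x * (4 ^+ i.+1)^-1.
      have -> : (8 : R) = 2 * 4 by ring.
      by rewrite exprMn; field; rewrite !expf_neq0.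
    rewrite ler_wpM2l ?(ltW (W0 x))// lef_pV2 ?posrE ?exprn_gt0//.
    by rewrite lerXn2r ?nnegrE// ler_nat.
  rewrite -mulr_sumr -[leRHS]mulr1 ler_wpM2l ?(ltW (W0 x))//.
  exact: sum_half_le1.
apply: (le_trans (wint_sigma_subadditive mUW uW0 mXi mX XX)).
pose G := 5000 * (8 * U * (18 * l%:R * expR 1) * A) * (U / eta) *
     (2 * U / (8^-1 `^ s^-1 / A) * (4 / eta) * 8) / e ^+ 3 * Nn.
have G0 : 0 <= G.
  have pe : 0 < expR 1 :> R := expR_gt0 1.
  have p8 : 0 < 8^-1 `^ s^-1 :> R by rewrite powR_gt0.
  have r0 : 0 <= 8 * U * (18 * l%:R * expR 1) * A.
    apply: mulr_ge0; last exact: ltW.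
    apply: mulr_ge0; first by apply: mulr_ge0 => //; exact: ltW.
    by apply: mulr_ge0; [apply: mulr_ge0 => //; exact: ltW|exact: ltW].
  have q0 : 0 <= 2 * U / (8^-1 `^ s^-1 / A) * (4 / eta) * 8.
    apply: mulr_ge0 => //; apply: mulr_ge0; last by apply: divr_ge0 => //; exact: ltW.
    apply: divr_ge0; first by apply: mulr_ge0 => //; exact: ltW.
    by apply: divr_ge0; exact: ltW.
  have u0' : 0 <= U / eta by apply: divr_ge0; exact: ltW.
  apply: (mulr_ge0 _ Nn0); apply: divr_ge0; last by apply: exprn_ge0; exact: ltW.
  apply: (mulr_ge0 _ q0); apply: (mulr_ge0 _ u0'); apply: (mulr_ge0 _ r0).
  exact: ler0n.
have each i : (wint mu (fun x => u x * W x)%R (Xi i) <=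
    (G * (2 ^+ 16 / (kap * eps) ^+ 4) * (2 ^+ i.+1)^-1)%:E)%E.
  have ai0 Q : 0 <= ai i Q by rewrite mulr_ge0 ?exprn_ge0.
  have p8 : 0 < 8 ^+ i.+1 :> R by rewrite exprn_gt0.
  have Nni0 : 0 <= 8 ^+ i.+1 * Nn by rewrite mulr_ge0 ?exprn_ge0.
  have wN sg : 0 < sg -> (wint mu (fun x => u x * W x)%R
     [set x | exists2 Q, Q \in S & cs Q x /\ (sg * W x < ai i Q)%R] <= (8 ^+ i.+1 * Nn / sg)%:E)%E.
    move=> sg0; have sg8 : 0 < sg / 8 ^+ i.+1 by rewrite divr_gt0.
    have := weakN sg8; congr (wint _ _ _ <= _)%E.
      apply/seteqP; split => x [Q QS [Qx h]]; exists Q => //; split => //.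
        by move: h; rewrite mulrAC (ltr_pdivrMr _ _ p8) (mulrC (a Q)).
      by rewrite mulrAC (ltr_pdivrMr _ _ p8) (mulrC (a Q)).
    by congr EFin; field; rewrite !gt_eqF.
  have := sparse_weak_bound cz uU mW W0 Wb0 A1 s0 WbE WbN spS ai0 Nni0 wN
    (measurable_layer i) (@layer_sub i) e0 e1 (rho0 i) (layer_pos i) (layer_neg i).
  move=> /le_trans; apply; rewrite lee_fin /rho /decay expRD.
  have y2 : 0 < kap * eps / 2 * 2 ^+ i by rewrite mulr_gt0 ?exprn_gt0// divr_gt0// mulr_gt0.
  have := expRN_le y2; set E := expR _ => HE.
  apply: (@le_trans _ _ (G * (8 ^+ i.+1 * E))).
    rewrite le_eqVlt; apply/orP; left; apply/eqP; rewrite /G; field.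
    have p8' : 0 < 8^-1 `^ s^-1 :> R by rewrite powR_gt0.
    by rewrite !gt_eqF// ?addr_gt0.
  rewrite -mulrA ler_wpM2l//.
  have p8' : 0 <= 8 ^+ i.+1 :> R by exact: ltW.
  apply: (le_trans (ler_wpM2l p8' HE)).
  rewrite le_eqVlt; apply/orP; left; apply/eqP.
  have ke0 : kap * eps != 0 by rewrite gt_eqF// mulr_gt0.
  rewrite !exprS; have -> : (8 : R) ^+ i = (2 ^+ i) ^+ 3.
    by rewrite -exprM mulnC exprM; congr (_ ^+ _); ring.
  have i2 : 2 ^+ i != 0 :> R by rewrite expf_neq0.
  move: (2 ^+ i) i2 (kap * eps) ke0 => z z0 ke ke0; field.
  by rewrite ke0 z0.
have c0 : 0 <= G * (2 ^+ 16 / (kap * eps) ^+ 4).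
  by rewrite mulr_ge0// divr_ge0 ?exprn_ge0// mulr_ge0// ltW.
apply: lime_le; first by apply: is_cvg_nneseries => k _ _; exact: wint_ge0.
apply: nearW => M.
apply: (@le_trans _ _ (\sum_(0 <= i < M) (G * (2 ^+ 16 / (kap * eps) ^+ 4) * (2 ^+ i.+1)^-1)%:E)%E).
  by apply: lee_sum => i _; exact: each.
rewrite sumEFin lee_fin -mulr_sumr big_mkord.
apply: (@le_trans _ _ (G * (2 ^+ 16 / (kap * eps) ^+ 4))).
  by rewrite ler_piMr// sum_half_le1.
rewrite [leRHS](_ : _ = G * (2 ^+ 20 / (kap * eps) ^+ 4)); last by rewrite /G; ring.
rewrite ler_wpM2l// ler_wpM2r ?invr_ge0 ?exprn_ge0// ?mulr_ge0 ?(ltW kap0) ?(ltW eps0)//.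
by rewrite ler_eXn2l ?ltr1n.
Qed.

End layers.

(** * From finite lists to countable families *)

Lemma countable_exhaustion (I : choiceType) (D : set I) : countable D -> exists s : nat -> seq I,
  [/\ forall k, uniq (s k), forall k, {in s k, forall i, D i},
      forall k k', (k <= k')%N -> {subset s k <= s k'} &
      forall i, D i -> exists k, i \in s k].
Proof.
move=> /countable_injP[f finj]; pose F k := [set i | D i /\ (f i < k)%N].
have Ffin k : finite_set (F k).
  apply/finite_set_leP; exists k.
  have fi : {in F k &, injective f}.
    by move=> i j; rewrite !inE => -[Di _] [Dj _]; apply: finj; rewrite inE.
  rewrite -(card_le_eql (inj_card_eq fi)).
  by apply: subset_card_le => _ [i [_ ik] <-].
have mem k i : (i \in finmap.enum_fset (fset_set (F k))) = (i \in F k).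
  exact: in_fset_set.
exists (fun k => finmap.enum_fset (fset_set (F k))); split.
- by move=> k; exact: finmap.fset_uniq.
- by move=> k i; rewrite mem inE => -[].
- move=> k k' kk' i; rewrite !mem !inE => -[Di fi]; split => //.
  exact: leq_trans kk'.
- by move=> i Di; exists (f i).+1; rewrite mem inE; split.
Qed.

Lemma esum_exhaustion (R : realType) (I : choiceType) (D : set I) (s : nat -> seq I) (a : I -> R) (c : R) :
  (forall i, 0 <= a i) ->
  (forall k, uniq (s k)) ->
  (forall k k', (k <= k')%N -> {subset s k <= s k'}) ->
  (forall i, D i -> exists k, i \in s k) ->
  (c%:E < \esum_(i in D) (a i)%:E)%E -> exists k, c < \sum_(i <- s k) a i.
Proof.
move=> a0 us mono cover /ereal_sup_gt[_ [A [finA AD] <-]].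
rewrite fsbig_finite//= sumEFin lte_fin; set r := finmap.enum_fset _ => cA.
have ur : uniq r by exact: finmap.fset_uniq.
have rD : forall i, i \in r -> D i.
  by move=> i; rewrite [_ \in _](in_fset_set finA) inE; exact: AD.
have [k Ak] : exists k, {subset r <= s k}.
  elim: r rD {cA ur} => [|i r IH] rD; first by exists 0%N.
  have [k rk] : exists k, {subset r <= s k}.
    by apply: IH => j jr; apply: rD; rewrite inE jr orbT.
  have [k' ik'] := cover _ (rD i (mem_head _ _)).
  exists (maxn k k') => j; rewrite inE => /orP[/eqP->|/rk jk].
    by apply: mono ik'; rewrite leq_maxr.
  by apply: mono jk; rewrite leq_maxl.
exists k; apply: (lt_le_trans cA); rewrite [leRHS](bigID (mem r))/=.
apply: ler_wpDr; first exact: sumr_ge0.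
rewrite -[leRHS]big_filter le_eqVlt; apply/orP; left; apply/eqP/perm_big.
apply: uniq_perm; rewrite ?filter_uniq// => i.
by rewrite mem_filter; case: (boolP (i \in _)) => //= iA; rewrite Ak.
Qed.

Lemma sum_expr_le (R : realDomainType) (I : Type) (s : seq I) (z : I -> R) m : (0 < m)%N ->
  (forall i, 0 <= z i) -> \sum_(i <- s) z i ^+ m <= (\sum_(i <- s) z i) ^+ m.
Proof.
move=> m0 z0; elim: s => [|i s IH]; first by rewrite !big_nil expr0n; case: m m0.
rewrite !big_cons; have S0 : 0 <= \sum_(j <- s) z j by exact: sumr_ge0.
apply: (@le_trans _ _ (z i ^+ m + (\sum_(j <- s) z j) ^+ m)); first by rewrite lerD2l.
move: (\sum_(j <- s) z j) S0 (z i) (z0 i) {IH} => x x0 {z0}w w0.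
case: m m0 => // m _; elim: m => [|m IH]; first by rewrite !expr1.
rewrite exprS [x ^+ _]exprS [leRHS]exprS.
have zx : 0 <= w + x by exact: addr_ge0.
apply: le_trans (ler_wpM2l zx IH); rewrite mulrDl !mulrDr.
have := exprn_ge0 m.+1 w0; have := exprn_ge0 m.+1 x0.
by move=> h1 h2; rewrite lerD// ?lerDl ?lerDr mulr_ge0.
Qed.

Section arbitrary_sets.
Context {R : realType} {d : measure_display} {T : measurableType d}.
Variable mu : {measure set T -> \bar R}.

(* The integral of a nonnegative function is a supremum over simple functions,
   hence is monotone in arbitrary, possibly nonmeasurable, sets. *)
Lemma wint_mono (u f : T -> R) (E F : set T) : (forall x, 0 <= u x) ->
  (forall x, u x <= f x) -> E `<=` F -> (wint mu u E <= wint mu f F)%E.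
Proof.
move=> u0 uf EF; rewrite /wint !ge0_integralE; last 2 first.
- by move=> x _; rewrite lee_fin (le_trans (u0 x)).
- by move=> x _; rewrite lee_fin.
apply: ge_ereal_sup => _ [h hu <-]; apply: ereal_sup_ubound; exists h => // x.
apply: (le_trans (hu x)); rewrite !patchE; case: ifPn => xE.
  by rewrite mem_set ?lee_fin//; apply: EF; rewrite -inE.
by case: ifP => // _; rewrite lee_fin (le_trans (u0 x)).
Qed.

Lemma wint_increasing_union (u : T -> R) (X : nat -> set T) (c : \bar R) :
  measurable_fun setT u -> (forall x, 0 <= u x) ->
  (forall k, measurable (X k)) -> (forall k k', (k <= k')%N -> X k `<=` X k') ->
  (forall k, (wint mu u (X k) <= c)%E) -> (wint mu u (\bigcup_k X k) <= c)%E.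
Proof.
move=> mfu u0 mX Xmono Xc.
have nX : nondecreasing_seq X by move=> k k' kk'; apply/subsetPset; exact: Xmono.
have mX' k : measurable_fun (X k) (EFin \o u).
  by apply/measurable_EFinP; exact: measurable_funTS.
have X0 k x : X k x -> (0 <= (EFin \o u) x)%E by rewrite lee_fin.
have cv := @ge0_nondecreasing_set_cvg_integral _ _ _ _ _ mu nX mX mX' X0.
rewrite /wint -(cvg_lim _ cv)//; apply: lime_le; first by apply/cvg_ex; eexists; exact: cv.
by apply: nearW => k; exact: Xc.
Qed.
End arbitrary_sets.

Definition oscillation_constant {R : realType} (U L A s eta kap : R) (l : nat) : R :=
  let eps := (4 * U * L)^-1 in let e := s * eps / 2 in
  5000 * (8 * U * (18 * l%:R * expR 1) * A) * (U / eta) *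
    (2 * U / (8^-1 `^ s^-1 / A) * (4 / eta) * 8) / e ^+ 3 *
    (2 ^+ 20 / (kap * eps) ^+ 4).

Section countable_families.
Context {R : realType} {d : measure_display} {T : measurableType d}.
Variable mu : {measure set T -> \bar R}.
Variables (cube : choiceType) (cs : cube -> set T) (vol : cube -> R) (N L : R).
Hypothesis cz : cz_system mu cs vol N.
Hypotheses (L1 : 1 <= L) (NL : N = 2 `^ L).
Variables (u : T -> R) (U : R).
Hypothesis uU : A1_bound mu cs vol u U.
Variables (W : T -> R) (Wb : cube -> R) (A s : R).
Hypotheses (mW : measurable_fun setT W) (W0 : forall x, 0 < W x).
Hypotheses (Wb0 : forall Q, 0 < Wb Q) (A1 : 1 <= A) (s0 : 0 < s) (s1 : s <= 1).
Hypothesis WbE : forall Q, wint mu W (cs Q) = (Wb Q * vol Q)%:E.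
Hypothesis WbN : forall Q,
  (wint mu (fun x => W x `^ (- s))%R (cs Q) <= (vol Q * (A / Wb Q) `^ s)%:E)%E.
Variables (sd : cube -> R) (eta : R) (D : set cube).
Hypothesis cD : countable D.
Hypothesis spD : forall S : seq cube, uniq S -> {in S, forall Q, D Q} ->
  sparse_seq mu cs vol sd eta S.
Variables (a : cube -> R) (Nn : R).
Hypotheses (a0 : forall Q, 0 <= a Q) (Nn0 : 0 <= Nn).
Hypothesis weakN : forall (S : seq cube) (sg : R), {in S, forall Q, D Q} -> 0 < sg ->
  (wint mu (fun x => (u x * W x)%R)
     [set x | exists2 Q, Q \in S & cs Q x /\ (sg * W x < a Q)%R] <= (Nn / sg)%:E)%E.
Variables (l : nat) (y : 'I_l -> cube -> T -> R) (kap : R).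
Hypotheses (l0 : (0 < l)%N) (kap0 : 0 < kap) (kap1 : kap <= 1).
Hypothesis my : forall i Q, measurable_fun setT (y i Q).
Hypothesis yexp : forall i Q,
  (wint mu (fun x => expR (kap * y i Q x))%R (cs Q) <= (6 * vol Q)%:E)%E.

(** A strict inequality for the infinite sum already holds for a finite list of the exhaustion. Thus
    Y is an increasing union of the sets handled by [oscillation_weak_bound], with the sizes [a]
    divided by kp, and no uniformity beyond the constant is lost. *)
Lemma countable_weak_bound (m : nat) (kp : R) : (0 < m)%N -> 0 < kp ->
  exists Y, [/\ measurable Y,
    [set x | ((kp ^+ m * W x ^+ m)%:E <
      \esum_(Q in D) ((a Q * oscillation y Q x) ^+ m * \1_(cs Q) x)%:E)%E] `<=` Y &
    (wint mu (fun x => u x * W x)%R Y <=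
      (oscillation_constant U L A s eta kap l * (Nn / kp))%:E)%E].
Proof.
move=> m0 kp0; have [S [uS SD Smono Scov]] := countable_exhaustion cD.
have mfu : measurable_fun setT u by exact: A1_measurable uU.
have u0 := A1_ge0 uU.
have mcs Q : measurable (cs Q) by exact: (cz_measurable cz).
pose ak Q := a Q / kp.
have ak0 Q : 0 <= ak Q by rewrite divr_ge0// ltW.
pose X k := [set x | W x < \sum_(Q <- S k) ak Q * (oscillation y Q x * \1_(cs Q) x)]%R.
have mosc Q : measurable_fun setT (oscillation y Q) := measurable_oscillation my Q.
have osc0 Q x : 0 <= oscillation y Q x by exact: le_trans (oscillation_ge1 _ _ _).
have term0 Q x : 0 <= ak Q * (oscillation y Q x * \1_(cs Q) x).
  by apply: mulr_ge0 => //; exact: mulr_ge0.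
have mX k : measurable (X k).
  pose f x := \sum_(Q <- S k) ak Q * (oscillation y Q x * \1_(cs Q) x).
  have mf : measurable_fun setT f.
    apply: measurable_sum => Q; apply: measurable_funM => //.
    by apply: measurable_funM => //; exact: measurable_indic.
  have -> : X k = [set x | 0 < f x - W x].
    by apply/seteqP; split => x; rewrite /X/= subr_gt0.
  by apply: measurable_gt; exact: measurable_funB.
exists (\bigcup_k X k); split; first exact: bigcupT_measurable.
  move=> x /= h; have [|k hk] := esum_exhaustion _ uS Smono Scov h.
    by move=> Q; rewrite mulr_ge0// exprn_ge0// mulr_ge0.
  exists k => //; rewrite /X/=.
  have s0' : 0 <= \sum_(Q <- S k) ak Q * (oscillation y Q x * \1_(cs Q) x).
    exact: sumr_ge0.
  rewrite -(ltr_pXn2r m0) ?nnegrE ?(ltW (W0 x))//.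
  apply: (@lt_le_trans _ _ (\sum_(Q <- S k) (ak Q * (oscillation y Q x * \1_(cs Q) x)) ^+ m)).
    rewrite -(ltr_pM2l (exprn_gt0 m kp0)); apply: (lt_le_trans hk).
    rewrite mulr_sumr; apply: ler_sum => Q _; rewrite -exprMn /ak.
    have -> : kp * (a Q / kp * (oscillation y Q x * \1_(cs Q) x)) =
      (a Q * oscillation y Q x) * \1_(cs Q) x by field; rewrite gt_eqF.
    rewrite !indicE; case: (x \in cs Q); first by rewrite !mulr1.
    by rewrite !mulr0 exprn_ge0.
  exact: sum_expr_le.
apply: wint_increasing_union.
- exact: measurable_funM.
- by move=> x; rewrite mulr_ge0// ltW.
- exact: mX.
- move=> k k' kk' x; rewrite /X/= => /lt_le_trans; apply.
  rewrite [leRHS](bigID (mem (S k)))/=; apply: ler_wpDr; first exact: sumr_ge0.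
  rewrite -[leRHS]big_filter le_eqVlt; apply/orP; left; apply/eqP/perm_big.
  apply: uniq_perm; rewrite ?filter_uniq// => Q.
  by rewrite mem_filter; case: (boolP (Q \in _)) => //= iA; rewrite (Smono _ _ kk').
move=> k; have Nk0 : 0 <= Nn / kp by rewrite divr_ge0// ltW.
apply: (oscillation_weak_bound cz L1 NL uU mW W0 Wb0 A1 s0 s1 WbE WbN
  (spD (uS k) (@SD k)) ak0 Nk0 _ l0 kap0 kap1 my yexp) => sg sg0.
have sk0 : 0 < sg * kp by rewrite mulr_gt0.
have := weakN (@SD k) sk0; congr (wint _ _ _ <= _)%E.
  apply/seteqP; split => x [Q QS [Qx h]]; exists Q => //; split => //.
    by rewrite /ak ltr_pdivlMr// mulrAC.
  by move: h; rewrite /ak ltr_pdivlMr// mulrAC.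
by congr EFin; field; rewrite !gt_eqF.
Qed.
End countable_families.

(** * Sparse families of cubes of R^n *)

Section lebesgue_cubes.
Context {R : realType} {n : nat}.
Local Notation mu := (@lebesgue R n).
Implicit Types P Q : cube R n.

Lemma lebesgue_cz_system : cz_system mu (@cset R n) (@vol R n) (2 ^+ n.+1).
Proof.
split; [exact: measurable_cset|exact: lebesgue_cset|exact: vol_gt0| |].
- by apply: exprn_ege1; rewrite ler1n.
- exact: dyadic_calderon_zygmund.
Qed.

Lemma sparse_lattice_seq (eta : R) (D S : set (cube R n)) (s : seq (cube R n)) :
  (0 < n)%N -> 0 < eta < 1 -> dyadic_lattice D -> S `<=` D -> sparse eta S ->
  uniq s -> {in s, forall Q, S Q} ->
  sparse_seq mu (@cset R n) (@vol R n) (@side R n) eta s.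
Proof.
move=> n0 /andP[eta0 eta1] lD SD spS us sS.
split => //; first by rewrite eta0 ltW.
  by move=> P Q x Ps Qs Px Qx PQ; apply: (dyadic_lattice_nested lD _ _ PQ Qx Px); apply/SD/sS.
pose U Q := \bigcup_(P in [set P | P \in s /\ cset P `<` cset Q]) cset P.
have mU Q : measurable (U Q).
  rewrite /U bigcup_mkcond.
  have -> : \bigcup_P (if P \in [set P | P \in s /\ cset P `<` cset Q] then cset P else set0) =
    \big[setU/set0]_(P <- s) (if `[< cset P `<` cset Q >] then cset P else set0).
    rewrite -bigcup_seq; apply/seteqP; split => x [P].
      move=> _; case: ifPn => //; rewrite inE => -[Ps PQ] Px.
      by exists P => //; case: ifPn => // /asboolP.
    move=> /= Ps; case: ifPn => // /asboolP PQ Px; exists P => //.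
    by rewrite mem_set.
  apply: bigsetU_measurable => P _; case: ifP => _; last exact: measurable0.
  exact: measurable_cset.
exists (fun Q => cset Q `\` U Q); split.
- by move=> Q; apply: measurableD => //; exact: measurable_cset.
- by move=> Q x [].
- move=> Q Qs.
  have mD : measurable (cset Q `\` U Q) by apply: measurableD => //; exact: measurable_cset.
  have mI : measurable (cset Q `&` U Q) by apply: measurableI => //; exact: measurable_cset.
  have h1 : ((vol Q)%:E <= mu (cset Q `&` U Q) + mu (cset Q `\` U Q))%E.
    by rewrite -lebesgue_cset -{1}(setUIDK (cset Q) (U Q)); exact: measureU2.
  have h2 : (mu (cset Q `&` U Q) <= (1 - eta)%:E * mu (cset Q))%E.
    (* The major subset is defined with the cubes of the list only, so that it is measurable; the
       union in [sparse] runs over the whole family and is compared through the outer measure. *)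
    apply: le_trans (spS Q (sS _ Qs)).
    apply: (@le_outer_measure R _ (@lebesgue_outer R n)).
    by move=> x [_ [P [Ps PQ] Px]]; exists P => //; split => //; exact: sS.
  have key (v : R) (a c : \bar R) : (v%:E <= a + c -> a <= ((1 - eta) * v)%:E ->
      (eta * v)%:E <= c)%E.
    case: a c => [a| |] [c| |]//; rewrite ?leey//; rewrite -?EFinD ?lee_fin//; nra.
  by apply: key h1 _; apply: (le_trans h2); rewrite EFinM lebesgue_cset.
- move=> P Q x Ps Qs.
  wlog PQ : P Q Ps Qs / side P <= side Q.
    move=> H; have [PQ|/ltW QP] := leP (side P) (side Q); first exact: H.
    by move=> *; apply/esym; exact: H.
  move=> [Px _] [Qx nU].
  have sub := dyadic_lattice_nested lD (SD _ (sS _ Qs)) (SD _ (sS _ Ps)) PQ Qx Px.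
  apply: (dyadic_lattice_eq lD (SD _ (sS _ Qs)) (SD _ (sS _ Ps)) _ Qx Px).
  have QP : cset Q `<=` cset P.
    by apply: contrapT => nQP; apply: nU; exists P => //; split => //; split.
  have : mu (cset Q) = mu (cset P) by congr (mu _); apply/seteqP.
  rewrite !lebesgue_cset => -[] /eqP; rewrite /vol eqrXn2 ?(ltW (side_gt0 _))//.
  by move=> /eqP.
Qed.

Lemma avgE Q (g : Rn R n -> R) :
  avg Q g = (wint mu g (cset Q) * ((vol Q)^-1)%:E)%E.
Proof. by rewrite /avg lebesgue_cset inver gt_eqF// vol_gt0. Qed.

Lemma avg_leP Q (g : Rn R n -> R) (c : R) :
  (avg Q g <= c%:E)%E = (wint mu g (cset Q) <= (c * vol Q)%:E)%E.
Proof.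
have v0 := vol_gt0 Q.
by rewrite avgE lee_pdivrMr// -EFinM.
Qed.

Lemma avg_ge0 Q (g : Rn R n -> R) : (forall x, 0 <= g x) -> (0 <= avg Q g)%E.
Proof.
move=> g0; rewrite avgE mule_ge0//; first exact: wint_ge0.
by rewrite lee_fin invr_ge0 ltW// vol_gt0.
Qed.

Lemma avg_fin Q (g : Rn R n -> R) (c : R) : avg Q g = c%:E ->
  wint mu g (cset Q) = (c * vol Q)%:E.
Proof.
have v0 := vol_gt0 Q; rewrite avgE => h.
have : (wint mu g (cset Q) * ((vol Q)^-1)%:E * (vol Q)%:E = (c * vol Q)%:E)%E by rewrite h.
by rewrite -muleA -EFinM mulVf ?mule1// gt_eqF.
Qed.

End lebesgue_cubes.

(** * Weights on R^n *)

Section means.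
Context {R : realType} {d : measure_display} {T : measurableType d}.
Variable mu : {measure set T -> \bar R}.
Implicit Types (E : set T) (f g h : T -> R).

Lemma wint_ae_eq g h E : measurable_fun setT g -> measurable_fun setT h ->
  measurable E -> {ae mu, forall x, g x = h x} -> wint mu g E = wint mu h E.
Proof.
move=> mg mh mE gh; apply: ae_eq_integral => //.
- by apply/measurable_EFinP; exact: measurable_funTS.
- by apply/measurable_EFinP; exact: measurable_funTS.
- by apply: filterS gh => x ->.
Qed.

Lemma wint_ae_le g h E : measurable_fun setT g -> measurable_fun setT h ->
  (forall x, 0 <= g x) -> (forall x, 0 <= h x) -> measurable E ->
  {ae mu, forall x, E x -> g x <= h x} -> (wint mu g E <= wint mu h E)%E.
Proof.
move=> mg mh g0 h0 mE gh; apply: ae_ge0_le_integral => //.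
- by move=> x _; rewrite lee_fin.
- by apply/measurable_EFinP; exact: measurable_funTS.
- by move=> x _; rewrite lee_fin.
- by apply/measurable_EFinP; exact: measurable_funTS.
Qed.

Lemma wint_gt0 g E : measurable_fun setT g -> (forall x, 0 <= g x) -> measurable E ->
  {ae mu, forall x, 0 < g x} -> (0 < mu E)%E -> (0 < wint mu g E)%E.
Proof.
move=> mg g0 mE gpos E0; rewrite lt_neqAle wint_ge0// andbT; apply/negP => /eqP w0.
have mgE : measurable_fun E (EFin \o g).
  by apply/measurable_EFinP; exact: measurable_funTS.
have : ae_eq mu E (EFin \o g) (cst 0%E).
  apply/(ae_eq_integral_abs mu mE mgE).
  rewrite [RHS]w0; apply: eq_integral => x _ /=.
  by rewrite ger0_norm.
move=> [N1 [mN1 N10 sub1]]; case: gpos => N2 [mN2 N20 sub2].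
have : (mu E <= 0)%E.
  rewrite -N10 -(measureU0 mN1 mN2 N20); apply: le_measure; rewrite ?inE//.
    exact: measurableU.
  move=> x Ex; have [gx|gx] := pselect (0 < g x); last by right; exact: sub2.
  left; apply: sub1 => /= /(_ Ex) [] gx0.
  by rewrite gx0 ltxx in gx.
by rewrite leNgt E0.
Qed.

Section power_means.
Variables (E : set T) (V : R).
Hypotheses (mE : measurable E) (muE : mu E = V%:E) (V0 : 0 < V).

(** Jensen's inequality for the concave power, by integrating the tangent at the mean G. *)
Lemma wint_powR_le g (G a : R) : measurable_fun setT g -> (forall x, 0 <= g x) ->
  0 < G -> 0 <= a <= 1 -> wint mu g E = (G * V)%:E ->
  (wint mu (fun x => g x `^ a)%R E <= (G `^ a * V)%:E)%E.
Proof.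
move=> mg g0 G0 /andP[a0 a1] gE; have Ga := powR_ge0 G a.
pose c1 := G `^ a * (1 - a); pose c2 := G `^ a * a / G.
have c10 : 0 <= c1 by rewrite mulr_ge0// subr_ge0.
have c20 : 0 <= c2 by rewrite divr_ge0 ?mulr_ge0// ltW.
have m2 : measurable_fun setT (fun x => c2 * g x) by exact: measurable_funM.
apply: (@le_trans _ _ (wint mu (fun x => c1 * 1 + c2 * g x)%R E)).
  apply: wint_le => //.
  - exact: measurable_powRf.
  - exact: measurable_funD.
  - by move=> x; exact: powR_ge0.
  move=> x _.
  have gG : 0 <= g x / G by rewrite divr_ge0// ltW.
  have -> : g x `^ a = G `^ a * (g x / G) `^ a.
    by rewrite -powRM ?(ltW G0)// mulrC divfK// gt_eqF.
  have : 0 <= a <= 1 by rewrite a0.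
  move=> /(powR_le_tangent gG) /(ler_wpM2l Ga) /le_trans; apply.
  by rewrite le_eqVlt /c1 /c2; apply/orP; left; apply/eqP; ring.
rewrite wintD//; last 2 first.
- by move=> x; rewrite mulr_ge0.
- by move=> x; rewrite mulr_ge0.
rewrite !wintZ// gE wint_cst1// muE -!EFinM -EFinD lee_fin.
rewrite le_eqVlt /c1 /c2; apply/orP; left; apply/eqP; field.
by rewrite gt_eqF.
Qed.

(** Jensen's inequality for the convex power. The linear term is moved to the other side before
    integration, so that only nonnegative functions are integrated. *)
Lemma wint_powRN_ge g (G a : R) : measurable_fun setT g -> (forall x, 0 < g x) ->
  0 < G -> 0 <= a -> wint mu g E = (G * V)%:E ->
  ((G `^ (- a) * V)%:E <= wint mu (fun x => g x `^ (- a))%R E)%E.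
Proof.
move=> mg g0 G0 a0 gE; have Ga : 0 <= G `^ (- a) := powR_ge0 G _.
pose c1 := G `^ (- a) * (1 + a); pose c2 := G `^ (- a) * a / G.
have c10 : 0 <= c1 by rewrite mulr_ge0// addr_ge0.
have c20 : 0 <= c2 by rewrite divr_ge0 ?mulr_ge0// ltW.
have mp : measurable_fun setT (fun x => g x `^ (- a)) by exact: measurable_powRf.
have m2 : measurable_fun setT (fun x => c2 * g x) by exact: measurable_funM.
have : (wint mu (fun x => c1 * 1)%R E <= wint mu (fun x => g x `^ (- a) + c2 * g x)%R E)%E.
  apply: wint_le => //.
  - exact: measurable_funD.
  - by move=> x; rewrite mulr1.
  move=> x _; have gG : 0 < g x / G by rewrite divr_gt0.
  have -> : g x `^ (- a) = G `^ (- a) * (g x / G) `^ (- a).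
    by rewrite -powRM ?(ltW G0) ?(ltW gG)// mulrC divfK// gt_eqF.
  have := ler_wpM2l Ga (powRN_ge_tangent gG a0); rewrite -subr_ge0 => h.
  rewrite -subr_ge0; move: h; congr (_ <= _); rewrite /c1 /c2; ring.
rewrite wintZ// wintD//; last 2 first.
- by move=> x; exact: powR_ge0.
- by move=> x; rewrite mulr_ge0// ltW.
rewrite (wintZ _ mg) ?gE ?wint_cst1 ?muE//; last by move=> x; exact: ltW.
case: (wint _ _ _) => [z| |]//; last by move=> _; rewrite leey.
rewrite -!EFinM -EFinD !lee_fin /c1 /c2 => h.
rewrite -(lerD2r (G `^ (- a) * a / G * (G * V))); apply: le_trans h.
rewrite le_eqVlt; apply/orP; left; apply/eqP; field.
by rewrite gt_eqF.
Qed.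

Lemma wint_ae_lower g (e : R) F : measurable_fun setT g -> (forall x, 0 <= g x) ->
  0 <= e -> measurable F -> {ae mu, forall x, F x -> e <= g x} ->
  (e%:E * mu F <= wint mu g F)%E.
Proof.
move=> mg g0 e0 mF eg.
have -> : (e%:E * mu F = wint mu (fun=> e * 1)%R F)%E by rewrite wintZ// wint_cst1.
by apply: wint_ae_le => // [x|]; [rewrite mulr_ge0|apply: filterS eg => x + /[dup] => /[apply]; rewrite mulr1].
Qed.

End power_means.

(** A weight is positive almost everywhere only; this changes it on a null set so that powers and
    quotients behave at every point. *)
Definition fill1 g x : R := if 0 < g x then g x else 1.

Lemma fill1_gt0 g x : 0 < fill1 g x.
Proof. by rewrite /fill1; case: ifP. Qed.

Lemma measurable_fill1 g : measurable_fun setT g -> measurable_fun setT (fill1 g).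
Proof.
by move=> mg; apply: measurable_fun_ifT => //; exact: measurable_fun_ltr.
Qed.

Lemma fill1_ae g : {ae mu, forall x, 0 < g x} -> {ae mu, forall x, fill1 g x = g x}.
Proof. by apply: filterS => x gx; rewrite /fill1 gx. Qed.

(** Where g is not positive this rests on default values: the power is 0 at 0, and it is 1 at
    negative arguments because [ln] is 0 there. A pointwise inequality is wanted, since it is used
    on sets that may not be measurable. *)
Lemma powR_le_fill1 g (a : R) x : a != 0 -> g x `^ a <= fill1 g x `^ a.
Proof.
move=> a0; rewrite /fill1; case: ltgtP => //; last by move=> <-; rewrite powR0// powR_ge0.
by move=> gx; rewrite powR1 /powR lt_eqF// ln0 ?mulr0 ?expR0// ltW.
Qed.

End means.

Section weights.
Context {R : realType} {n : nat}.
Local Notation mu := (@lebesgue R n).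
Implicit Types (Q : cube R n) (g h w : Rn R n -> R).

Definition unit_cube : cube R n :=
  exist (fun Q : 'rV[R]_n * R => is_true (0 < Q.2)) (0, 1) ltr01.

Lemma mu_cset_gt0 Q : (0 < mu (cset Q))%E.
Proof. by rewrite lebesgue_cset lte_fin vol_gt0. Qed.

Lemma ess_inf_cube_ae Q g :
  {ae mu, forall x, cset Q x -> (ess_inf_cube Q g <= (g x)%:E)%E}.
Proof.
have := ess_inf_le mu (fun x => if x \in cset Q then (g x)%:E else +oo%E).
by apply: filterS => x h Qx; move: h; rewrite mem_set.
Qed.

Lemma le_ess_inf_cube Q g (c : \bar R) :
  {ae mu, forall x, cset Q x -> (c <= (g x)%:E)%E} -> (c <= ess_inf_cube Q g)%E.
Proof.
move=> h; apply/ess_infP; apply: filterS h => x h.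
by case: ifPn => [|_]; [rewrite inE|rewrite leey].
Qed.

Lemma ess_inf_cube_fin Q g : {ae mu, forall x, 0 < g x} ->
  exists2 e : R, 0 <= e & ess_inf_cube Q g = e%:E.
Proof.
move=> g0; apply: fin_num_real.
  by apply: le_ess_inf_cube; apply: filterS g0 => x gx _; rewrite lee_fin ltW.
rewrite ltey; apply/eqP => oo.
have := ess_inf_cube_ae Q g; rewrite oo => -[N [mN N0 sub]].
have : (mu (cset Q) <= mu N)%E.
  apply: (@le_outer_measure R _ (@lebesgue_outer R n)) => x Qx.
  by apply: sub => /= /(_ Qx).
by rewrite N0 leNgt mu_cset_gt0.
Qed.

Lemma avg_gt0 Q g : measurable_fun setT g -> (forall x, 0 <= g x) ->
  {ae mu, forall x, 0 < g x} -> (0 < avg Q g)%E.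
Proof.
move=> mg g0 gpos; rewrite avgE mule_gt0 ?lte_fin ?invr_gt0 ?vol_gt0//.
exact: (wint_gt0 mg g0 (measurable_cset Q) gpos (mu_cset_gt0 Q)).
Qed.

Lemma avg_ae_eq Q g h : measurable_fun setT g -> measurable_fun setT h ->
  {ae mu, forall x, g x = h x} -> avg Q g = avg Q h.
Proof.
move=> mg mh gh; rewrite !avgE; congr (_ * _)%E.
exact: (wint_ae_eq mg mh (measurable_cset Q) gh).
Qed.

Lemma measurable_powR_prod m (w : 'I_m -> Rn R n -> R) (p : R) :
  (forall i, measurable_fun setT (w i)) ->
  measurable_fun setT (fun x => \prod_(i < m) w i x `^ p).
Proof.
move=> mw; apply: measurable_prod => i _.
exact: (measurable_powRf _ (mw i)).
Qed.

Section A1.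
Variables (m : nat) (w : 'I_m -> Rn R n -> R).
Hypothesis wA1 : A1_vec w.
Let u := geometric_mean w.

Lemma measurable_geometric_mean : measurable_fun setT u.
Proof. by apply: measurable_powR_prod => i; have [/(_ i)[]] := wA1. Qed.
Let mfu := measurable_geometric_mean.

Lemma geometric_mean_ge0 x : 0 <= u x.
Proof. by apply: prodr_ge0 => i _; exact: powR_ge0. Qed.
Let u0 := geometric_mean_ge0.

Let w0 : {ae mu, forall x, forall i, 0 < w i x}.
Proof. by apply: filter_forall => i; have [/(_ i)[]] := wA1. Qed.

Lemma geometric_mean_gt0 : {ae mu, forall x, 0 < u x}.
Proof.
by apply: filterS w0 => x wx; apply: prodr_gt0 => i _; exact: powR_gt0.
Qed.

(** The vector condition implies the scalar A_1 condition for u, because the product of the powers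
    of the essential infima bounds u from below almost everywhere on Q. *)
Lemma A1_vec_avg : exists2 M : R, 0 <= M &
  forall Q, (avg Q u <= M%:E * ess_inf_cube Q u)%E.
Proof.
have [ww wfin] := wA1.
have ub Q : (avg Q u * \prod_(i < m) (ess_inf_cube Q (w i) `^ m%:R^-1)^-1 <=
   ereal_sup [set avg Q (geometric_mean w) *
     \prod_(i < m) (ess_inf_cube Q (w i) `^ m%:R^-1)^-1 | Q in [set: cube R n]])%E.
  by apply: ereal_sup_ubound; exists Q.
set Mo := ereal_sup _ in wfin ub.
have inv0 (z : \bar R) : (0 <= z -> 0 <= z^-1)%E by rewrite inve_ge0.
have Mo0 : (0 <= Mo)%E.
  apply: le_trans (ub unit_cube); apply: mule_ge0; first exact: avg_ge0.
  by apply: prode_ge0 => i _; apply: inv0; exact: poweR_ge0.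
have [M M0 ME] := fin_num_real Mo0 wfin.
exists M => // Q.
have [e eP] : exists e : 'I_m -> R, forall i, 0 <= e i /\ ess_inf_cube Q (w i) = (e i)%:E.
  exists (fun i => fine (ess_inf_cube Q (w i))) => i.
  by have [|r r0 ->] := @ess_inf_cube_fin Q (w i); [have [] := ww i|].
pose t i := e i `^ m%:R^-1.
have t0 i : 0 <= t i by exact: powR_ge0.
have a0 : (0 < avg Q u)%E := avg_gt0 Q mfu u0 geometric_mean_gt0.
have := ub Q; under eq_bigr do rewrite (eP _).2 poweR_EFin -/(t _).
rewrite ME => uQ.
have invt i : (0 < ((t i)%:E)^-1)%E.
  by rewrite inver; case: eqP => // /eqP ti; rewrite lte_fin invr_gt0 lt_neqAle eq_sym ti t0.
(* A vanishing infimum would have inverse [+oo], and the supremum would be infinite since the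
   average of u is positive. *)
have tpos i : 0 < t i.
  rewrite lt_neqAle t0 andbT; apply/negP => /eqP ti.
  move: uQ; rewrite (bigD1 i)//= -ti inver eqxx gt0_mulye ?gt0_muley//.
  by apply: (big_ind (fun z => 0 < z)%E) => // x y; exact: mule_gt0.
have P0 : 0 < \prod_(i < m) t i by exact: prodr_gt0.
have tE i : ((t i)%:E^-1 = ((t i)^-1)%:E)%E by rewrite inver gt_eqF.
move: uQ; under eq_bigr do rewrite tE.
rewrite prodEFin prodfV lee_pdivrMr// -EFinM => /le_trans; apply.
rewrite EFinM; apply: lee_wpmul2l; first by rewrite lee_fin.
apply: le_ess_inf_cube.
have : {ae mu, forall x i, cset Q x -> (ess_inf_cube Q (w i) <= (w i x)%:E)%E}.
  by apply: filter_forall => i; exact: ess_inf_cube_ae.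
apply: filterS => x h Qx; rewrite lee_fin; apply: ler_prod => i _.
rewrite t0; have := h i Qx; rewrite (eP i).2 lee_fin => ewi.
by apply: powR_homo => //; have [] := eP i.
Qed.

(** [A1_const] is an infimum; instead of showing that it is attained, an admissible constant below
    [2 a] is used, hence the factor 2. *)
Lemma A1_vec_bound : exists a : R, [/\ 1 <= a, A1_const u = a%:E &
  A1_bound mu (@cset R n) (@vol R n) u (2 * a)].
Proof.
have mc := @measurable_cset R n.
have fin c Q : (avg Q u <= c%:E * ess_inf_cube Q u)%E ->
    exists e, [/\ 0 <= e, ess_inf_cube Q u = e%:E & (wint mu u (cset Q) <= (c * e * vol Q)%:E)%E].
  have [e e0 eE] := ess_inf_cube_fin Q geometric_mean_gt0.
  by rewrite eE -EFinM avg_leP; exists e.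
have low e Q F : 0 <= e -> ess_inf_cube Q u = e%:E -> measurable F -> F `<=` cset Q ->
    (e%:E * mu F <= wint mu u F)%E.
  move=> e0 eE mF FQ; apply: (wint_ae_lower mfu u0 e0 mF).
  by have := ess_inf_cube_ae Q u; rewrite eE; apply: filterS => x h /FQ/h; rewrite lee_fin.
have c_ge1 (c : R) : (forall Q, (avg Q u <= c%:E * ess_inf_cube Q u)%E) -> 1 <= c.
  move=> cA; have [e [e0 eE ce]] := fin c _ (cA unit_cube).
  have v0 := vol_gt0 unit_cube.
  have pos := wint_gt0 mfu u0 (mc unit_cube) geometric_mean_gt0 (mu_cset_gt0 unit_cube).
  have := le_trans (low e _ _ e0 eE (mc unit_cube) (fun _ => id)) ce.
  have := lt_le_trans pos ce.
  rewrite lebesgue_cset -EFinM lte_fin lee_fin pmulr_lgt0// ler_pM2r// => ce0.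
  have {}e0 : 0 < e by rewrite lt_neqAle e0 andbT; apply/eqP => e00; rewrite -e00 mulr0 ltxx in ce0.
  by rewrite ler_pMl.
have [M M0 MA] := A1_vec_avg.
have a1 : (1 <= A1_const u)%E.
  by apply: le_ereal_inf_tmp => _ [c cA <-]; rewrite lee_fin; exact: c_ge1.
have aM : (A1_const u <= M%:E)%E by apply: ereal_inf_lbound; exists M.
have [a _ aE] := fin_num_real (le_trans lee01 a1) (le_lt_trans aM (ltry M)).
have {}a1 : 1 <= a by rewrite -lee_fin -aE.
exists a; split => //.
have : (A1_const u < (2 * a)%:E)%E by rewrite aE lte_fin; lra.
move=> /ereal_inf_lt[_ [c cA <-]]; rewrite lte_fin => ca.
have c1 := c_ge1 c cA.
split => //.
- by move=> Q; have [e [_ _ /le_lt_trans]] := fin c _ (cA Q); apply; exact: ltry.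
- lra.
move=> Q E mE EQ; have [e [e0 eE ce]] := fin c _ (cA Q).
have v0 := vol_gt0 Q.
apply: (le_trans (lee_wpmul2l (measure_ge0 mu E) ce)).
have -> : (mu E * (c * e * vol Q)%:E = (c * vol Q)%:E * (e%:E * mu E))%E.
  by rewrite muleA -EFinM muleC; congr (_%:E * _)%E; ring.
have cv0 : 0 <= c * vol Q by rewrite mulr_ge0 ?(ltW v0)//; lra.
apply: (@le_trans _ _ ((c * vol Q)%:E * wint mu u E)%E).
  by apply: lee_wpmul2l; [rewrite lee_fin|exact: (low e Q)].
apply: lee_wpmul2r; first exact: wint_ge0.
by rewrite lee_fin ler_pM2r// ltW.
Qed.

End A1.

End weights.

Section weights.
Context {R : realType} {n : nat}.
Local Notation mu := (@lebesgue R n).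
Implicit Types (Q : cube R n) (g h w : Rn R n -> R).
Section Ap.
Implicit Types (t p : R).

Lemma Ap_const_ae_eq t g h : measurable_fun setT g -> measurable_fun setT h ->
  {ae mu, forall x, g x = h x} -> Ap_const t g = Ap_const t h.
Proof.
move=> mg mh gh.
have gh' : {ae mu, forall x, g x `^ (1 - conj_exponent t) = h x `^ (1 - conj_exponent t)}.
  by apply: filterS gh => x ->.
have E : (fun Q => avg Q g *
    (avg Q (fun x => g x `^ (1 - conj_exponent t))%R) `^ (t - 1))%E =
  (fun Q => avg Q h * (avg Q (fun x => h x `^ (1 - conj_exponent t))%R) `^ (t - 1))%E.
  apply/funext => Q; rewrite (avg_ae_eq Q mg mh gh).
  by rewrite (avg_ae_eq Q (measurable_powRf _ mg) (measurable_powRf _ mh) gh').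
exact: (congr1 (fun F => ereal_sup [set F Q | Q in [set: cube R n]]) E).
Qed.

Lemma conj_exponentE t : 1 < t -> 1 - conj_exponent t = - (t - 1)^-1.
Proof. by move=> t1; rewrite /conj_exponent; field; rewrite subr_eq0 gt_eqF. Qed.

(** Both averages are positive, so if either were infinite the product would be infinite too. *)
Lemma Ap_cube t g Q : 1 < t -> measurable_fun setT g -> (forall x, 0 < g x) ->
  (Ap_const t g < +oo)%E -> exists X Z : R, [/\ 0 < X, 0 < Z, avg Q g = X%:E,
    avg Q (fun x => g x `^ (- (t - 1)^-1))%R = Z%:E & ((X * Z `^ (t - 1))%:E <= Ap_const t g)%E].
Proof.
move=> t1 mg g0 Afin.
have pg0 : {ae mu, forall x, 0 < g x} by apply: filterE.
have X0 : (0 < avg Q g)%E := avg_gt0 Q mg (fun x => ltW (g0 x)) pg0.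
have Z0 : (0 < avg Q (fun x => g x `^ (- (t - 1)^-1))%R)%E.
  apply: (avg_gt0 Q (measurable_powRf _ mg)) => [x|]; first exact: powR_ge0.
  by apply: filterE => x; exact: powR_gt0.
have ub : (avg Q g * avg Q (fun x => g x `^ (- (t - 1)^-1))%R `^ (t - 1) <= Ap_const t g)%E.
  by rewrite -(conj_exponentE t1); apply: ereal_sup_ubound; exists Q.
have t10 : t - 1 != 0 by rewrite subr_eq0 gt_eqF.
move: X0 Z0 ub; case: (avg Q g) => [X| |]//.
  case: (avg Q _) => [Z| |]//; first by rewrite !lte_fin => X0 Z0 ub; exists X, Z.
  by move=> X0 _; rewrite poweRyr// gt0_muley// leye_eq => /eqP AE; rewrite AE in Afin.
move=> _ Z0; rewrite gt0_mulye; last exact: poweR_gt0.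
by rewrite leye_eq => /eqP AE; rewrite AE in Afin.
Qed.

Lemma avg_powR_le g Q (X a : R) : measurable_fun setT g -> (forall x, 0 <= g x) ->
  0 < X -> 0 <= a <= 1 -> avg Q g = X%:E ->
  (avg Q (fun x => g x `^ a)%R <= (X `^ a)%:E)%E.
Proof.
move=> mg g0 X0 a01 /avg_fin gX; rewrite avg_leP.
exact: (wint_powR_le (measurable_cset Q) (lebesgue_cset Q) mg g0 X0 a01 gX).
Qed.

(** Jensen's inequality twice: with exponent a for v, and with [c = a (p-1)/(t-1)] for the dual
    weight [v^(-1/(p-1))]. The powers are matched so that the A_p product reappears with exponent
    a. *)
Lemma Ap_powR p t (a : R) (v : Rn R n -> R) : Ap p v -> 1 < p -> p <= t -> 2 <= t -> 0 < a <= 1 ->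
  Ap t (fun x => v x `^ a).
Proof.
move=> [[mv v0] vfin] p1 pt t2 /andP[a0 a1].
have mv1 := measurable_fill1 mv.
have t1 : 1 < t by exact: lt_le_trans pt.
split.
  split; first exact: (measurable_powRf _ mv).
  by apply: filterS v0 => x vx; exact: powR_gt0.
have vE := fill1_ae v0.
rewrite -(Ap_const_ae_eq t (measurable_powRf a mv1) (measurable_powRf a mv)); last first.
  by apply: filterS vE => x ->.
rewrite -(Ap_const_ae_eq p mv1 mv vE) in vfin.
have fp x : 0 < fill1 v x by exact: fill1_gt0.
set f := fill1 v in mv1 vfin fp *.
have f0 x : 0 <= f x by exact: ltW.
have [M MA] : exists M, Ap_const p f = M%:E.
  have [X [Z [X0 Z0 _ _ h]]] := Ap_cube unit_cube p1 mv1 fp vfin.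
  have h0 : (0 <= Ap_const p f)%E.
    by apply: le_trans h; rewrite lee_fin mulr_ge0 ?powR_ge0// ltW.
  by have [M _ ->] := fin_num_real h0 vfin; exists M.
apply: (@le_lt_trans _ _ (M `^ a)%:E); last exact: ltry.
apply: ge_ereal_sup => _ [Q _ <-].
have [X [Z [X0 Z0 XE ZE XZ]]] := Ap_cube Q p1 mv1 fp vfin.
have tp0 : 0 < t - 1 by rewrite subr_gt0.
have pp0 : 0 < p - 1 by rewrite subr_gt0.
pose c := a * (p - 1) / (t - 1).
have c0 : 0 <= c by rewrite divr_ge0 ?mulr_ge0// ltW.
have c1 : c <= 1.
  rewrite /c ler_pdivrMr// mul1r; apply: (@le_trans _ _ (p - 1)); last by rewrite lerD2r.
  by rewrite ler_piMl// ltW.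
have h1 : (avg Q (fun x => f x `^ a)%R <= (X `^ a)%:E)%E.
  by apply: (avg_powR_le mv1 f0 X0 _ XE); rewrite a1 ltW.
have h2 : (avg Q (fun x => (f x `^ a) `^ (1 - conj_exponent t))%R <= (Z `^ c)%:E)%E.
  rewrite (_ : (fun x => _) = (fun x => (f x `^ (- (p - 1)^-1)) `^ c)).
    apply: (avg_powR_le (measurable_powRf _ mv1) _ Z0 _ ZE) => [x|]; first exact: powR_ge0.
    by rewrite c0.
  apply/funext => x; rewrite (conj_exponentE t1) -!powRrM /c; congr (_ `^ _).
  by field; rewrite !gt_eqF.
have g1 : (0 <= avg Q (fun x => f x `^ a)%R)%E by apply: avg_ge0 => x; exact: powR_ge0.
have g2 : (0 <= avg Q (fun x => (f x `^ a) `^ (1 - conj_exponent t))%R)%E.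
  by apply: avg_ge0 => x; exact: powR_ge0.
have [x x0 xE] := fin_num_real g1 (le_lt_trans h1 (ltry _)).
have [z z0 zE] := fin_num_real g2 (le_lt_trans h2 (ltry _)).
rewrite xE in h1; rewrite zE in h2; rewrite xE zE poweR_EFin -EFinM lee_fin.
rewrite lee_fin in h1; rewrite lee_fin in h2.
apply: (@le_trans _ _ (X `^ a * (Z `^ c) `^ (t - 1))).
  by apply: ler_pM => //; [exact: powR_ge0|apply: powR_homo => //; exact: ltW].
rewrite MA lee_fin in XZ.
have -> : (Z `^ c) `^ (t - 1) = (Z `^ (p - 1)) `^ a.
  by rewrite -!powRrM; congr (_ `^ _); rewrite /c; field; rewrite gt_eqF.
rewrite -powRM ?(ltW X0) ?powR_ge0//; apply: powR_homo => //; first exact: ltW.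
by rewrite mulr_ge0 ?powR_ge0// ltW.
Qed.

(** The A_t condition in the shape of the hypotheses [WbE] and [WbN], with [s = 1/(t-1)]; [1 <= A]
    is Jensen's inequality for the negative power. *)
Lemma Ap_bound t g : 1 < t -> measurable_fun setT g -> (forall x, 0 < g x) ->
  (Ap_const t g < +oo)%E -> let A := fine (Ap_const t g) in
  [/\ 1 <= A, forall Q, 0 < mean Q g,
    forall Q, wint mu g (cset Q) = (mean Q g * vol Q)%:E &
    forall Q, (wint mu (fun x => g x `^ (- (t - 1)^-1))%R (cset Q) <=
      (vol Q * (A / mean Q g) `^ (t - 1)^-1)%:E)%E].
Proof.
move=> t1 mg g0 Afin A.
have H Q := Ap_cube Q t1 mg g0 Afin.
have t10 : 0 < t - 1 by rewrite subr_gt0.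
have s0 : 0 < (t - 1)^-1 by rewrite invr_gt0.
have AE : Ap_const t g = A%:E.
  have [X [Z [X0 Z0 _ _ XZ]]] := H unit_cube.
  have A0 : (0 <= Ap_const t g)%E.
    by apply: le_trans XZ; rewrite lee_fin mulr_ge0 ?powR_ge0// ltW.
  by rewrite /A; have [r r0 ->] := fin_num_real A0 Afin.
have meanE Q X : avg Q g = X%:E -> mean Q g = X by rewrite /mean => ->.
split.
- have [X [Z [X0 Z0 XE ZE XZ]]] := H unit_cube.
  have v0 := vol_gt0 (@unit_cube R n).
  rewrite AE lee_fin in XZ; apply: le_trans XZ.
  have := wint_powRN_ge (measurable_cset unit_cube) (lebesgue_cset unit_cube) mg g0 X0 (ltW s0) (avg_fin XE).
  rewrite (avg_fin ZE) lee_fin ler_pM2r// => XZ.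
  have e1 : X * (X `^ (- (t - 1)^-1)) `^ (t - 1) = 1.
    by rewrite -powRrM mulNr mulVf ?gt_eqF// powR_inv1 ?(ltW X0)// mulfV// gt_eqF.
  rewrite -[leLHS]e1 ler_pM2l//; apply: powR_homo => //; [exact: ltW|exact: powR_ge0].
- by move=> Q; have [X [Z [X0 Z0 /meanE -> _ _]]] := H Q.
- by move=> Q; have [X [Z [X0 Z0 XE _ _]]] := H Q; rewrite (meanE _ _ XE) (avg_fin XE).
move=> Q; have [X [Z [X0 Z0 XE ZE XZ]]] := H Q.
rewrite (meanE _ _ XE) (avg_fin ZE) lee_fin mulrC ler_pM2l ?vol_gt0//.
rewrite AE lee_fin in XZ.
have -> : Z = (Z `^ (t - 1)) `^ (t - 1)^-1.
  by rewrite -powRrM mulfV ?gt_eqF// powRr1// ltW.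
apply: powR_homo; [exact: ltW|exact: powR_ge0|].
by rewrite ler_pdivlMr// mulrC.
Qed.

End Ap.

End weights.

(** * L(log L) averages *)

Section young.
Context {R : realType}.

(** Young's inequality for the conjugate pair [x ln x - x] and [exp y], from [1 + z <= exp z] at
    [z = y - ln x]. *)
Lemma llogl_young (x y : R) : 0 <= x -> x * y <= llogl x + expR y.
Proof.
rewrite le_eqVlt => /predU1P[<-|x0].
  by rewrite /llogl !mul0r add0r expR_ge0.
have h1 : x * (1 + (y - ln x)) <= expR y.
  have -> : expR y = x * expR (y - ln x) by rewrite expRD expRN lnK// mulrCA mulfV ?mulr1// gt_eqF.
  by rewrite ler_pM2l// expR_ge1Dx.
have h2 : x * ln x <= llogl x.
  by rewrite ler_pM2l// ler_ln ?posrE ?addr_gt0 ?expR_gt0// lerDr expR_ge0.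
by rewrite mulrDr mulrBr mulr1 in h1; lra.
Qed.

Lemma le_llogl (x : R) : 0 <= x -> x <= llogl x.
Proof.
move=> x0; rewrite /llogl ler_peMr// -[leLHS]expRK ler_ln ?posrE ?expR_gt0//.
  by rewrite lerDl.
by rewrite ltr_wpDr// expR_gt0.
Qed.

Lemma llogl_half (x : R) : 0 <= x <= 2^-1 -> llogl x <= 1.
Proof.
move=> /andP[x0 x2]; have e1 : 2 <= expR 1 :> R by have := expR_ge1Dx (1 : R); lra.
have ex : 0 < expR 1 + x by rewrite ltr_wpDr// expR_gt0.
have : ln (expR 1 + x) <= 2.
  rewrite -[leRHS]expRK ler_ln ?posrE ?expR_gt0//.
  have -> : expR 2 = expR 1 * expR 1 :> R by rewrite -expRD; congr expR; ring.
  nra.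
by rewrite /llogl => ?; nra.
Qed.

Lemma llogl_ge0 (x : R) : 0 <= x -> 0 <= llogl x.
Proof. by move=> x0; exact: le_trans (le_llogl x0). Qed.

Context {d : measure_display} {T : measurableType d}.
Variable mu : {measure set T -> \bar R}.
Variables (E : set T) (V : R).
Hypotheses (mE : measurable E).
Variables (f : T -> R) (lam : R).
Hypotheses (mf : measurable_fun setT f) (lam0 : 0 < lam).
Hypothesis fV : (wint mu (fun x => llogl (`|f x| / lam)) E <= V%:E)%E.

Let phi x := llogl (`|f x| / lam).
Let mabs : measurable_fun setT (fun x => `|f x| / lam).
Proof. by apply: measurable_funM => //; exact: measurableT_comp. Qed.
Let mphi : measurable_fun setT phi.
Proof.
apply: measurable_funM => //; apply: measurableT_comp; first exact: measurable_ln.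
exact: measurable_funD.
Qed.
Let fl0 x : 0 <= `|f x| / lam. Proof. by rewrite divr_ge0// ltW. Qed.
Let phi0 x : 0 <= phi x. Proof. exact: llogl_ge0. Qed.

Lemma wint_le_llogl : (wint mu (fun x => `|f x|)%R E <= (lam * V)%:E)%E.
Proof.
have l0 : (0 <= lam%:E)%E by rewrite lee_fin ltW.
rewrite EFinM; apply: le_trans (lee_wpmul2l l0 fV).
rewrite -(wintZ mu mphi phi0 mE (ltW lam0)); apply: wint_le => //.
- exact: measurableT_comp.
- exact: measurable_funM.
by move=> x _; rewrite mulrC -ler_pdivrMr// le_llogl.
Qed.

Lemma wint_young_llogl (g : T -> R) (k c : R) : measurable_fun setT g -> 0 < k ->
  (wint mu (fun x => expR (k * `|g x|)) E <= (c * V)%:E)%E ->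
  (wint mu (fun x => `|g x * f x|)%R E <= ((1 + c) / k * lam * V)%:E)%E.
Proof.
move=> mg k0 gV.
have me : measurable_fun setT (fun x => expR (k * `|g x|)).
  apply: measurableT_comp => //; apply: measurable_funM => //.
  exact: measurableT_comp.
have lk : 0 <= lam / k by rewrite divr_ge0// ltW.
have ms : measurable_fun setT (fun x => phi x + expR (k * `|g x|)) by exact: measurable_funD.
have s0 x : 0 <= phi x + expR (k * `|g x|) by rewrite addr_ge0// expR_ge0.
apply: (@le_trans _ _ (wint mu (fun x => lam / k * (phi x + expR (k * `|g x|)))%R E)).
  apply: wint_le => //.
  - by apply: measurableT_comp => //; exact: measurable_funM.
  - exact: measurable_funM.
  move=> x _; have := llogl_young (k * `|g x|) (fl0 x) => /(ler_wpM2l lk).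
  apply: le_trans; rewrite normrM le_eqVlt; apply/orP; left; apply/eqP; field.
  by rewrite !gt_eqF.
rewrite wintZ// wintD//.
have lk' : (0 <= (lam / k)%:E)%E by rewrite lee_fin.
apply: (le_trans (lee_wpmul2l lk' (leeD fV gV))).
rewrite -EFinD -EFinM lee_fin le_eqVlt; apply/orP; left; apply/eqP; field.
by rewrite gt_eqF.
Qed.

Lemma wint_bounded_llogl (g : T -> R) (M : R) : measurable_fun setT g -> 0 < M ->
  (forall x, `|g x| <= M) ->
  (wint mu (fun x => llogl (`|g x| / (2 * M)))%R E <= mu E)%E.
Proof.
move=> mg M0 gM; have g0 x : 0 <= `|g x| / (2 * M) by rewrite divr_ge0// mulr_ge0// ltW.
have mg' : measurable_fun setT (fun x => `|g x| / (2 * M)).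
  by apply: measurable_funM => //; exact: measurableT_comp.
rewrite -(wint_cst1 mu mE); apply: wint_le => //.
- apply: measurable_funM => //; apply: measurableT_comp; first exact: measurable_ln.
  exact: measurable_funD.
- by move=> x; exact: llogl_ge0.
move=> x _; apply: llogl_half; rewrite g0/= ler_pdivrMr ?mulr_gt0//.
by rewrite mulrA mulVf// mul1r.
Qed.

End young.

Section llogl_norms.
Context {R : realType} {n : nat}.
Local Notation mu := (@lebesgue R n).
Implicit Types (Q : cube R n) (f b g : Rn R n -> R).

Lemma llogl_norm_fin Q f : bounded_compact_support f ->
  exists2 F : R, 0 <= F & llogl_norm Q f = F%:E.
Proof.
move=> [mf [M fM] _]; pose M' := `|M| + 1.
have M'0 : 0 < M' by rewrite ltr_wpDl.
have fM' x : `|f x| <= M'.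
  by apply: le_trans (fM x) _; apply: le_trans (ler_norm M) _; rewrite lerDl.
apply: fin_num_real.
  by apply: le_ereal_inf_tmp => _ [lam [lam0 _] <-]; rewrite lee_fin ltW.
apply: (@le_lt_trans _ _ (2 * M')%:E); last exact: ltry.
apply: ereal_inf_lbound; exists (2 * M') => //; split; first by rewrite mulr_gt0.
rewrite -[1%E]/(1%:E) avg_leP mul1r -lebesgue_cset.
exact: (wint_bounded_llogl mu (measurable_cset Q) mf M'0 fM').
Qed.

(** The norm is an infimum, so a linear bound for admissible [lam] passes to it with an error;
    dividing the error by [c + 1] instead of c covers the case [c = 0]. *)
Lemma avg_le_llogl_norm Q f g (c F : R) : 0 <= c -> llogl_norm Q f = F%:E ->
  (forall lam, 0 < lam -> (avg Q (fun x => llogl (`|f x| / lam))%R <= 1%:E)%E ->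
     (avg Q g <= (c * lam)%:E)%E) ->
  (avg Q g <= (c * F)%:E)%E.
Proof.
move=> c0 FE H; apply/lee_addgt0Pr => e e0.
have c1 : 0 < c + 1 by rewrite ltr_wpDl.
have : (llogl_norm Q f < (F + e / (c + 1))%:E)%E by rewrite FE lte_fin ltrDl divr_gt0.
move=> /ereal_inf_lt[_ [lam [lam0 lamA] <-]]; rewrite lte_fin => lamF.
apply: (le_trans (H _ lam0 lamA)); rewrite -EFinD lee_fin.
apply: (@le_trans _ _ (c * (F + e / (c + 1)))); first by rewrite ler_wpM2l// ltW.
rewrite mulrDr lerD2l mulrCA -[leRHS]mulr1 ler_wpM2l ?(ltW e0)//.
by rewrite ler_pdivrMr// mul1r lerDl.
Qed.

Lemma avg_norm_le_llogl Q f (F : R) : measurable_fun setT f -> llogl_norm Q f = F%:E ->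
  (avg Q (fun x => `|f x|)%R <= F%:E)%E.
Proof.
move=> mf FE; rewrite -[F]mul1r; apply: (avg_le_llogl_norm ler01 FE) => lam lam0 h.
rewrite avg_leP mul1r in h; rewrite avg_leP mul1r.
exact: (wint_le_llogl (measurable_cset Q) mf lam0 h).
Qed.

Lemma avg_mul_le_llogl Q f g (k c F : R) : measurable_fun setT f -> measurable_fun setT g ->
  0 < k -> 0 <= c -> (wint mu (fun x => expR (k * `|g x|))%R (cset Q) <= (c * vol Q)%:E)%E ->
  llogl_norm Q f = F%:E -> (avg Q (fun x => `|g x * f x|)%R <= ((1 + c) / k * F)%:E)%E.
Proof.
move=> mf mg k0 c0 gQ FE.
have ck : 0 <= (1 + c) / k by rewrite divr_ge0 ?addr_ge0// ltW.
apply: (avg_le_llogl_norm ck FE) => lam lam0 h.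
rewrite avg_leP mul1r in h; rewrite avg_leP.
exact: (wint_young_llogl (measurable_cset Q) mf lam0 h mg k0 gQ).
Qed.

End llogl_norms.

(** * The constants *)

(** The part of [oscillation_constant] that does not involve the weights, at [L = n + 1], since the
    stopping constant is [2^(n+1)]. *)
Definition constant_factor {R : realType} (n l : nat) (eta kap : R) : R :=
  5000 * (8 * 2 * (18 * l%:R * expR 1)) * (2 / eta) * (2 * 2 * (4 / eta) * 8) *
    (16 * n.+1%:R) ^+ 3 * (2 ^+ 20 * (8 * n.+1%:R) ^+ 4 / kap ^+ 4).

Section constants.
Context {R : realType}.
Implicit Types (n l : nat) (t a A eta kap : R).

(** The ten powers of [a]: one each from the reverse Holder constant, the Carleson constant and the
    core mass, three from [e^-3], four from the layer decay. One A comes from [rho], the other from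
    [1/h]. *)
Lemma oscillation_constantE n l t a A eta kap : 1 < t -> 0 < a -> 0 < A -> 0 < eta -> 0 < kap ->
  oscillation_constant (2 * a) n.+1%:R A (t - 1)^-1 eta kap l =
  constant_factor n l eta kap * (a ^+ 10 * (t - 1) ^+ 3 * 8 `^ (t - 1) * A ^+ 2).
Proof.
move=> t1 a0 A0 eta0 kap0; rewrite /oscillation_constant /constant_factor invrK.
have -> : 8^-1 `^ (t - 1) = (8 `^ (t - 1))^-1 by rewrite -powR_inv1// -powRrM mulN1r powRN.
have t0 : t - 1 != 0 by rewrite subr_eq0 gt_eqF.
have key (P s L l' e : R) : P != 0 -> s != 0 -> L != 0 ->
    5000 * (8 * (2 * a) * (18 * l' * e) * A) * (2 * a / eta) *
    (2 * (2 * a) / (P^-1 / A) * (4 / eta) * 8) / (s^-1 * (4 * (2 * a) * L)^-1 / 2) ^+ 3 *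
    (2 ^+ 20 / (kap * (4 * (2 * a) * L)^-1) ^+ 4) =
    5000 * (8 * 2 * (18 * l' * e)) * (2 / eta) * (2 * 2 * (4 / eta) * 8) *
    (16 * L) ^+ 3 * (2 ^+ 20 * (8 * L) ^+ 4 / kap ^+ 4) * (a ^+ 10 * s ^+ 3 * P * A ^+ 2).
  move=> P0 s0 L0; field.
  by rewrite ?s0 ?P0 ?L0 ?(gt_eqF a0) ?(gt_eqF A0) ?(gt_eqF eta0) ?(gt_eqF kap0).
by apply: key; rewrite ?pnatr_eq0// gt_eqF// powR_gt0.
Qed.

Lemma constant_factor_ge0 n l eta kap : 0 < eta -> 0 < kap -> 0 <= constant_factor n l eta kap.
Proof.
move=> eta0 kap0; rewrite /constant_factor.
have h1 : 0 <= 2 / eta by rewrite divr_ge0// ltW.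
have h2 : 0 <= 4 / eta by rewrite divr_ge0// ltW.
have h3 : 0 <= kap ^+ 4 by rewrite exprn_ge0// ltW.
apply: mulr_ge0; last by apply: divr_ge0 => //; apply: mulr_ge0; apply: exprn_ge0 => //; exact: mulr_ge0.
apply: mulr_ge0; last by apply: exprn_ge0; exact: mulr_ge0.
apply: mulr_ge0; last by apply: mulr_ge0 => //; apply: mulr_ge0.
apply: (mulr_ge0 _ h1); apply: mulr_ge0; first exact: ler0n.
by rewrite mulr_ge0 ?mulr_ge0 ?expR_ge0.
Qed.

Lemma le_powR2 (z : R) : 1 <= z -> z <= 2 `^ z.
Proof.
move=> z1; have z0 : 0 <= z by exact: le_trans z1.
have h2 : 2 * 2 `^ (z - 1) = 2 `^ z.
  by rewrite -[X in X * _]powRr1// -powRD ?subrKC// ?(addrC 1) ?subrK// pnatr_eq0 implybT.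
have := @powRN_ge_tangent R 2^-1 (z - 1).
rewrite invr_gt0 ltr0n subr_ge0 => /(_ isT z1).
rewrite -powR_inv1// -powRrM mulrN mulNr mul1r opprK powR_inv1// => h3.
rewrite -h2; lra.
Qed.

(** With [z = (t-1) a] the polynomial part is at most [z^13 <= 2^(13 z)], while
    [p0 - 1 = 2^(n+3) z >= 16 z] as [n >= 1]. The choice [Cn = 8] turns [8^(t-1)] into part of
    [Cn^t]. *)
Lemma K0_ge n t a A : (0 < n)%N -> 2 <= t -> 1 <= a -> 1 <= A ->
  a ^+ 10 * (t - 1) ^+ 3 * 8 `^ (t - 1) * A ^+ 2 <= K0 n 8 t a A.
Proof.
move=> n0 t2 a1 A1; pose z := (t - 1) * a.
have t1 : 1 <= t - 1 by lra.
have z1 : 1 <= z by rewrite /z -[leLHS]mulr1 ler_pM.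
have z0 : 0 <= z by exact: le_trans z1.
have a0 : 0 <= a by exact: le_trans a1.
have A2 : 0 <= A ^+ 2 by exact: sqr_ge0.
have p1 : p0 n t a - 1 = 2 ^+ (n + 3) * z by rewrite /p0 addrK mulrA.
have p16 : 16 * z <= p0 n t a - 1.
  rewrite p1 ler_wpM2r//; have -> : (16 : R) = 2 ^+ 4 by rewrite !exprS expr0; ring.
  by rewrite ler_eXn2l ?ltr1n// (leq_add2r 3 1).
have p0z : 0 <= p0 n t a - 1 by apply: le_trans p16; rewrite mulr_ge0.
have h1 : a ^+ 10 * (t - 1) ^+ 3 <= 2 `^ (p0 n t a - 1).
  apply: (@le_trans _ _ (z ^+ 10 * z ^+ 3)).
    have az : a <= z by rewrite /z ler_peMl.
    have tz : t - 1 <= z by rewrite /z ler_peMr// (le_trans _ t1).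
    have tz0 : 0 <= t - 1 by exact: le_trans t1.
    by apply: ler_pM; rewrite ?exprn_ge0// lerXn2r ?nnegrE.
  rewrite -exprD; apply: (@le_trans _ _ ((2 `^ z) ^+ 13)).
    by rewrite lerXn2r ?nnegrE ?powR_ge0// le_powR2.
  rewrite -powR_mulrn ?powR_ge0// -powRrM; apply: ler_powR; first by rewrite ler1n.
  by apply: le_trans p16; rewrite mulrC ler_wpM2r// ler_nat.
have h2 : 8 `^ (t - 1) <= 8 `^ t :> R by apply: ler_powR; [rewrite ler1n|lra].
have h3 : 1 <= a `^ (p0 n t a - 1).
  by rewrite -[leLHS](powRr0 a); apply: ler_powR.
have P2 := powR_ge0 2 (p0 n t a - 1); have P8 := powR_ge0 8 t.
have B0 : 0 <= 2 `^ (p0 n t a - 1) * 8 `^ t * A ^+ 2 by rewrite mulr_ge0// mulr_ge0.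
apply: (@le_trans _ _ (2 `^ (p0 n t a - 1) * 8 `^ t * A ^+ 2)).
  rewrite ler_wpM2r//; apply: (ler_pM _ (powR_ge0 _ _) h1 h2).
  by rewrite mulr_ge0 ?exprn_ge0// (le_trans _ t1).
have p1' : 1 < p0 n t a by rewrite -subr_gt0; apply: lt_le_trans p16; rewrite mulr_gt0 ?(lt_le_trans _ z1).
have cp : 1 <= conj_exponent (p0 n t a).
  by rewrite /conj_exponent ler_pdivlMr ?subr_gt0// mul1r gerBl.
rewrite /K0 -/(p0 n t a); set X := _ * a `^ _.
have X0 : 2 `^ (p0 n t a - 1) * 8 `^ t * A ^+ 2 <= X by rewrite /X ler_peMr.
set c := 4 * 8 * _ * _; have c1 : 1 <= c.
  by rewrite /c -[leLHS]mulr1 ler_pM// -[leLHS]mulr1 ler_pM ?(ltW p1')//; lra.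
apply: (@le_trans _ _ (a + X)); first by apply: ler_wpDl.
apply: (@le_trans _ _ (c * (a + X))); last by rewrite lerDl.
by rewrite ler_peMl// addr_ge0// (le_trans _ X0).
Qed.

Lemma K0_ge1 n t a A : (0 < n)%N -> 2 <= t -> 1 <= a -> 1 <= A -> 1 <= K0 n 8 t a A.
Proof.
move=> n0 t2 a1 A1; apply: le_trans (K0_ge n0 t2 a1 A1).
have t1 : 1 <= t - 1 by lra.
rewrite -[leLHS]mulr1 ler_pM ?exprn_ege1// -[leLHS]mulr1 ler_pM//.
  by rewrite -[leLHS]mulr1 ler_pM ?exprn_ege1.
by rewrite -[leLHS](powRr0 8); apply: ler_powR; [rewrite ler1n|lra].
Qed.

End constants.

(** * The weak-type estimate *)

Lemma prode_bounds (R : realType) (I : Type) (r : seq I) (P : pred I)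
    (x : I -> \bar R) (y : I -> R) :
  (forall i, P i -> (0 <= x i)%E /\ (x i <= (y i)%:E)%E) ->
  (0 <= \prod_(i <- r | P i) x i)%E /\
  (\prod_(i <- r | P i) x i <= (\prod_(i <- r | P i) y i)%:E)%E.
Proof.
move=> H; elim/big_ind2: _ => //.
move=> x1 y1 x2 y2 [x10 xy1] [x20 xy2]; split; first exact: mule_ge0.
by rewrite EFinM; exact: lee_pmul.
Qed.

Section almost_covers.
Context {R : realType} {d : measure_display} {T : measurableType d}.
Variable mu : {measure set T -> \bar R}.

Lemma wint_ae_subset (h k : T -> R) (X Z : set T) : measurable_fun setT h ->
  measurable_fun setT k -> (forall x, 0 <= k x) -> {ae mu, forall x, h x = k x} ->
  measurable X -> {ae mu, forall x, X x -> Z x} -> (wint mu h X <= wint mu k Z)%E.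
Proof.
move=> mh mk k0 hk mX [N [mN N0 sub]].
rewrite (wint_ae_eq mh mk mX hk).
have mD : measurable (X `\` N) by exact: measurableD.
apply: (@le_trans _ _ (wint mu k ((X `\` N) `|` N))).
  by apply: wint_mono => // x Xx; have [Nx|Nx] := pselect (N x); [right|left].
apply: (le_trans (wint_setUle mu mk k0 mD mN)).
rewrite (wint_null N0 mN mk k0) adde0; apply: wint_mono => // x [Xx Nx].
by apply: contrapT => nZ; apply: Nx; apply: sub => /= /(_ Xx).
Qed.

Lemma wint_ae_cover (I : finType) (h k : T -> R) (X : set T) (Y : I -> set T) (c : R) :
  measurable_fun setT h -> (forall x, 0 <= k x) -> (forall x, k x <= h x) ->
  (forall i, measurable (Y i)) -> (forall i, (wint mu h (Y i) <= c%:E)%E) ->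
  {ae mu, forall x, X x -> exists i, Y i x} ->
  (wint mu k X <= (#|I|%:R * c)%:E)%E.
Proof.
move=> mh k0 kh mY Yc [N [mN N0 sub]].
have h0 x : 0 <= h x by exact: le_trans (k0 x) (kh x).
have mU (r : seq I) : measurable (\big[setU/set0]_(i <- r) Y i).
  exact: bigsetU_measurable.
have H (r : seq I) : (wint mu h (\big[setU/set0]_(i <- r) Y i) <= ((size r)%:R * c)%:E)%E.
  elim: r => [|i r IH].
    by rewrite big_nil mul0r /wint integral_set0.
  rewrite big_cons/=; apply: (le_trans (wint_setUle mu mh h0 (mY i) (mU r))).
  apply: (le_trans (leeD (Yc i) IH)); rewrite -EFinD lee_fin.
  by rewrite -natr1 mulrDl mul1r addrC.
apply: (@le_trans _ _ (wint mu h (\big[setU/set0]_(i <- enum I) Y i `|` N))).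
  apply: wint_mono => // x Xx; have [Nx|Nx] := pselect (N x); [by right|left].
  have [i Yix] : exists i, Y i x.
    by apply: contrapT => nY; apply: Nx; apply: sub => /= /(_ Xx).
  by rewrite -bigcup_seq; exists i => //=; rewrite mem_enum.
apply: (le_trans (wint_setUle mu mh h0 (mU _) mN)).
by rewrite (wint_null N0 mN mh h0) adde0 cardE.
Qed.

Lemma measurable_normalized (h : T -> R) (c B : R) : measurable_fun setT h ->
  measurable_fun setT (fun x => `|h x - c| / B).
Proof.
move=> mh; apply: measurable_funM => //; apply: measurableT_comp => //.
exact: measurable_funB.
Qed.

Lemma measurable_level (cube : choiceType) (cs : cube -> set T) (W : T -> R) (a : cube -> R)
    (sg : R) (S : seq cube) : (forall Q, measurable (cs Q)) -> measurable_fun setT W ->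
  measurable [set x | exists2 Q, Q \in S & cs Q x /\ sg * W x < a Q].
Proof.
move=> mcs mW.
have -> : [set x | exists2 Q, Q \in S & cs Q x /\ sg * W x < a Q] =
    \big[setU/set0]_(Q <- S) (cs Q `&` [set x | 0 < a Q - sg * W x]).
  rewrite -bigcup_seq; apply/seteqP; split => x.
    by move=> [Q QS [Qx h]]; exists Q => //; split => //=; rewrite subr_gt0.
  by move=> [Q QS [Qx /=]]; rewrite subr_gt0 => h; exists Q.
apply: bigsetU_measurable => Q _; apply: measurableI => //; apply: measurable_gt.
by apply: measurable_funB => //; exact: measurable_funM.
Qed.

End almost_covers.

Section sparse_bounds.
Context {R : realType} {n : nat}.
Local Notation mu := (@lebesgue R n).
Local Notation func := (Rn R n -> R).
Implicit Types (Q : cube R n) (x : Rn R n).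

(* [bmo_exp / B] is an admissible exponent in the John-Nirenberg inequality
   for a function of BMO norm B. *)
Definition bmo_exp : R := (3 * (2 * 2 ^+ n.+1 + 4))^-1.
(** 7 is 1 + 6 in Young's inequality: the normalized L(log L) average plus the John-Nirenberg
    bound. *)
Definition bmo_factor : R := 7 / bmo_exp.

Lemma bmo_exp_gt0 : 0 < bmo_exp.
Proof. by rewrite invr_gt0 mulr_gt0// addr_gt0// mulr_gt0// exprn_gt0. Qed.

Lemma bmo_exp_le1 : bmo_exp <= 1.
Proof.
have N0 : 0 < 2 ^+ n.+1 :> R by rewrite exprn_gt0.
by rewrite invf_le1; lra.
Qed.

Lemma bmo_factor_ge1 : 1 <= bmo_factor.
Proof.
rewrite /bmo_factor ler_pdivlMr ?bmo_exp_gt0// mul1r.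
by have := bmo_exp_le1; lra.
Qed.

Section commutator.
Variables (m l : nat) (lm : (l <= m)%N) (b : 'I_l -> func) (B : 'I_l -> R).
Hypotheses (m0 : (0 < m)%N) (B0 : forall s, 0 < B s).
Hypothesis mb : forall s, measurable_fun setT (b s).
Hypothesis bB : forall s, bmo_norm (b s) = (B s)%:E.
Variable f : 'I_m -> func.
Hypothesis bf : forall i, bounded_compact_support (f i).

Definition normalized_oscillation s Q x := `|b s x - mean Q (b s)| / B s.
Local Notation y := normalized_oscillation.

Let mf i : measurable_fun setT (f i). Proof. by have [] := bf i. Qed.

Lemma bmo_cube s Q :
  (wint mu (fun x => `|b s x - mean Q (b s)|)%R (cset Q) <= (B s * vol Q)%:E)%E.
Proof. by rewrite -avg_leP -bB; apply: ereal_sup_ubound; exists Q. Qed.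

Lemma bmo_exp_cube s Q :
  (wint mu (fun x => expR (bmo_exp * y s Q x))%R (cset Q) <= (6 * vol Q)%:E)%E.
Proof.
have := john_nirenberg_exp lebesgue_cz_system (mb s) (B0 s) (bmo_cube s) Q.
congr (_ <= _)%E; congr wint; apply/funext => x; congr expR.
rewrite /normalized_oscillation /bmo_exp [RHS]mulrCA -invfM; congr (_ / _); ring.
Qed.

Lemma measurable_normalized_oscillation s Q : measurable_fun setT (y s Q).
Proof. exact: (measurable_normalized _ _ (mb s)). Qed.

Definition llogl_real Q i := fine (llogl_norm Q (f i)).

Lemma llogl_realE Q i : llogl_norm Q (f i) = (llogl_real Q i)%:E.
Proof. by rewrite /llogl_real; have [F _ ->] := llogl_norm_fin Q (bf i). Qed.

Lemma llogl_real_ge0 Q i : 0 <= llogl_real Q i.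
Proof. by rewrite /llogl_real; have [F ? ->] := llogl_norm_fin Q (bf i). Qed.

Definition term_factor : R := bmo_factor ^+ l * \prod_(s < l) B s.
(** The BMO norms are put under the root; the m-th power at the end restores them to the first
    power. *)
Definition term_size Q : R := (term_factor * \prod_(i < m) llogl_real Q i) `^ m%:R^-1.

Lemma term_factor_gt0 : 0 < term_factor.
Proof.
by rewrite mulr_gt0 ?prodr_gt0// exprn_gt0// (lt_le_trans ltr01 bmo_factor_ge1).
Qed.

Lemma term_sizeX Q : term_size Q ^+ m = term_factor * \prod_(i < m) llogl_real Q i.
Proof.
have h : 0 <= term_factor * \prod_(i < m) llogl_real Q i.
  by rewrite mulr_ge0 ?(ltW term_factor_gt0)// prodr_ge0// => i _; exact: llogl_real_ge0.
by rewrite /term_size -powR_mulrn ?powR_ge0// -powRrM mulVf ?powRr1// pnatr_eq0 -lt0n.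
Qed.

Lemma sparse_factor_bounds s Q g x : (0 <= sparse_factor (b s) (f (widen_ord lm s)) Q g x)%E /\
  (sparse_factor (b s) (f (widen_ord lm s)) Q g x <=
    (bmo_factor * B s * oscillation y Q x * llogl_real Q (widen_ord lm s))%:E)%E.
Proof.
set F := llogl_real _ _; set fs := f _; set o := oscillation y Q x.
have F0 : 0 <= F := llogl_real_ge0 _ _.
have o1 : 1 <= o := oscillation_ge1 _ _ _.
have c1 := bmo_factor_ge1; have Bs := B0 s.
have cB0 : 0 <= bmo_factor * B s by apply: mulr_ge0; [exact: le_trans c1|exact: ltW].
rewrite /sparse_factor; case: g; split.
- exact: avg_ge0.
- have mc : measurable_fun setT (fun _ : Rn R n => mean Q (b s)) by exact: measurable_cst.
  have mg := measurable_funB (mb s) mc.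
  have k0 : 0 < bmo_exp / B s by rewrite divr_gt0// bmo_exp_gt0.
  have h : (wint mu (fun x => expR (bmo_exp / B s * `|b s x - mean Q (b s)|))%R (cset Q) <=
      (6 * vol Q)%:E)%E.
    have := bmo_exp_cube s Q; congr (_ <= _)%E; congr wint; apply/funext => z.
    by congr expR; rewrite /normalized_oscillation; field; rewrite gt_eqF.
  have := avg_mul_le_llogl (mf (widen_ord lm s)) mg k0 _ h (llogl_realE Q _).
  move=> /(_ (ler0n _ _)) /le_trans; apply; rewrite lee_fin -/F.
  have -> : (1 + 6) / (bmo_exp / B s) = bmo_factor * B s.
    by rewrite /bmo_factor; field; rewrite !gt_eqF// bmo_exp_gt0.
  by rewrite ler_wpM2r// ler_peMr.
- by apply: mule_ge0; [rewrite lee_fin|exact: avg_ge0].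
have b0 : (0 <= `|b s x - mean Q (b s)|%:E)%E by rewrite lee_fin.
have := avg_norm_le_llogl (mf (widen_ord lm s)) (llogl_realE Q (widen_ord lm s)).
move=> /(lee_wpmul2l b0) /le_trans; apply; rewrite -EFinM lee_fin -/F ler_wpM2r//.
have := le_oscillation y s Q x; rewrite -/o {1}/normalized_oscillation ler_pdivrMr// => h.
apply: (le_trans h); rewrite mulrC ler_wpM2r ?(le_trans ler01)//.
by rewrite ler_peMl// ltW.
Qed.

Lemma sparse_term_le Q (g : {ffun 'I_l -> bool}) x :
  ((\prod_(s < l) sparse_factor (b s) (f (widen_ord lm s)) Q (g s) x) *
     (\prod_(i < m | (l <= i)%N) avg Q (fun y => `|f i y|)%R) *
     (\1_(cset Q) x)%:E <=
   ((term_size Q * oscillation y Q x) ^+ m * \1_(cset Q) x)%:E)%E.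
Proof.
set o := oscillation y Q x; have o1 : 1 <= o := oscillation_ge1 _ _ _.
have [p0 p1] := @prode_bounds R _ (index_enum 'I_l) xpredT
  (fun s => sparse_factor (b s) (f (widen_ord lm s)) Q (g s) x) _
  (fun s _ => sparse_factor_bounds s Q (g s) x).
have [q0 q1] := @prode_bounds R _ (index_enum 'I_m) (fun i => (l <= i)%N)
  (fun i => avg Q (fun y => `|f i y|)%R) (llogl_real Q)
  (fun i _ => conj (avg_ge0 Q (fun x => normr_ge0 (f i x)))
     (avg_norm_le_llogl (mf i) (llogl_realE Q i))).
have i0 : (0 <= (\1_(cset Q) x : R)%:E)%E by rewrite lee_fin.
rewrite EFinM; apply: lee_wpmul2r => //.
apply: (le_trans (lee_pmul p0 q0 p1 q1)); rewrite -EFinM lee_fin.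
have prodE (c z : R) (B' F : 'I_l -> R) : \prod_(s < l) (c * B' s * z * F s) =
    c ^+ l * (\prod_(s < l) B' s) * z ^+ l * \prod_(s < l) F s.
  by rewrite !big_split/= !prodr_const card_ord.
rewrite prodE [X in _ <= X]exprMn term_sizeX.
rewrite -/o -/term_factor -(@big_ord_narrow _ _ _ _ _ (llogl_real Q) lm).
rewrite [X in _ <= _ * X * _](bigID (fun i : 'I_m => (i < l)%N))/=.
have -> : \prod_(i < m | ~~ (i < l)%N) llogl_real Q i = \prod_(i < m | (l <= i)%N) llogl_real Q i.
  by apply: eq_bigl => i; rewrite -leqNgt.
set X := \prod_(i < m | (i < l)%N) _; set Y := \prod_(i < m | (l <= i)%N) _.
have X0 : 0 <= X by apply: prodr_ge0 => i _; exact: llogl_real_ge0.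
have Y0 : 0 <= Y by apply: prodr_ge0 => i _; exact: llogl_real_ge0.
have := term_factor_gt0; move: term_factor => c tf.
have -> : c * o ^+ l * X * Y = c * (X * Y) * o ^+ l by ring.
(* The oscillation is at least 1, so its power l may be raised to m; this makes the whole term an
   m-th power. *)
rewrite ler_wpM2l ?mulr_ge0 ?(ltW tf)//.
exact: ler_weXn2l.
Qed.

End commutator.
End sparse_bounds.

Lemma le_of_weak_level (R : realType) (m : nat) (lam N : R) (I : \bar R) : (0 < m)%N ->
  0 < lam -> 0 <= N -> (0 <= I)%E -> (lam%:E * I `^ m%:R <= N%:E)%E ->
  (I <= ((N / lam) `^ m%:R^-1)%:E)%E.
Proof.
move=> m0 lam0 N0; have mR : m%:R != 0 :> R by rewrite pnatr_eq0 -lt0n.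
case: I => [z| |]//; last first.
  by move=> _; rewrite poweRyr// gt0_muley ?lte_fin// leye_eq.
rewrite poweR_EFin -EFinM !lee_fin => z0 h.
have -> : z = (z `^ m%:R) `^ m%:R^-1 by rewrite -powRrM mulfV// powRr1.
apply: powR_homo.
- by rewrite invr_ge0.
- exact: powR_ge0.
- by rewrite ler_pdivlMr// mulrC.
Qed.

Lemma exponent_bounds (R : realType) (t : R) : 2 <= t ->
  [/\ 1 < t, 0 < (t - 1)^-1 & (t - 1)^-1 <= 1].
Proof. by move=> t2; split; [|rewrite invr_gt0|rewrite invf_le1]; lra. Qed.

(* The level [lam] cancels: the thresholds were scaled by [(lam / K) ^ (1 / m)]. *)
Lemma weak_level_arith (R : realType) (m : nat) (lam K k cc N z : R) : (0 < m)%N ->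
  0 < lam -> 0 < K -> 0 <= N -> 0 <= z ->
  z <= k * (cc * (N `^ m%:R^-1 / (lam / K) `^ m%:R^-1)) ->
  lam * z `^ m%:R <= (k * cc) ^+ m * (K * N).
Proof.
move=> m0 lam0 K0 N0 z0 zr.
have mR : m%:R != 0 :> R by rewrite pnatr_eq0 -lt0n.
have rootX (x : R) : 0 <= x -> (x `^ m%:R^-1) ^+ m = x.
  by move=> x0; rewrite -powR_mulrn ?powR_ge0// -powRrM mulVf// powRr1.
rewrite powR_mulrn//; apply: (@le_trans _ _ (lam * (k * (cc * (N `^ m%:R^-1 / (lam / K) `^ m%:R^-1))) ^+ m)).
  by rewrite ler_pM2l// lerXn2r ?nnegrE// (le_trans z0).
have lK : 0 <= lam / K by rewrite divr_ge0// ltW.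
rewrite !exprMn exprVn !rootX// le_eqVlt; apply/orP; left; apply/eqP; field.
by rewrite !gt_eqF.
Qed.

Definition weak_factor (R : realType) (n m l : nat) (C cc cB : R) : R :=
  ((3 ^ n)%:R * cc) ^+ m * (C * (3 ^ n)%:R * (2 ^ l)%:R * cB).

Section weak_estimate.
Context {R : realType} {n : nat}.
Local Notation mu := (@lebesgue R n).
Local Notation func := (Rn R n -> R).
Implicit Types (Q : cube R n) (x : Rn R n).
Hypothesis n0 : (0 < n)%N.
Variables (m l : nat) (lm : (l <= m)%N) (b : 'I_l -> func).
Hypothesis l0 : (0 < l)%N.
Variable f : 'I_m -> func.
Hypothesis bf : forall i, bounded_compact_support (f i).
Variables (C eta : R) (S : 'I_(3 ^ n) -> set (cube R n)).
Hypotheses (C0 : 0 < C) (eta01 : 0 < eta < 1).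
Hypothesis SD : forall j, exists D, [/\ dyadic_lattice D, S j `<=` D & sparse eta (S j)].
Variables (y : 'I_l -> cube R n -> func) (kap : R).
Hypotheses (kap0 : 0 < kap) (kap1 : kap <= 1).
Hypothesis my : forall s Q, measurable_fun setT (y s Q).
Hypothesis yexp : forall s Q,
  (wint mu (fun x => expR (kap * y s Q x))%R (cset Q) <= (6 * vol Q)%:E)%E.
Variables (cB : R) (aQ : cube R n -> R).
Hypotheses (cB0 : 0 < cB) (aQ0 : forall Q, 0 <= aQ Q).
Hypothesis aQX : forall Q, aQ Q ^+ m = cB * \prod_(i < m) llogl_real f Q i.
Hypothesis term_le : forall Q (g : {ffun 'I_l -> bool}) x,
  ((\prod_(s < l) sparse_factor (b s) (f (widen_ord lm s)) Q (g s) x) *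
     (\prod_(i < m | (l <= i)%N) avg Q (fun y => `|f i y|)%R) *
     (\1_(cset Q) x)%:E <=
   ((aQ Q * oscillation y Q x) ^+ m * \1_(cset Q) x)%:E)%E.

Let m0 : (0 < m)%N. Proof. exact: leq_trans lm. Qed.

(** Pigeonhole over the [3^n] families: the bound [term_le] is the same for all [2^l] choices of
    gamma, so if no family exceeded tau the whole sum would be too small. *)
Lemma sparse_bound_large x (tau : R) :
  ((C * (3 ^ n)%:R * (2 ^ l)%:R * tau)%:E < C%:E * sparse_bound lm b f S x)%E ->
  exists j, (tau%:E < \esum_(Q in S j)
    ((aQ Q * oscillation y Q x) ^+ m * \1_(cset Q) x)%:E)%E.
Proof.
move=> h; apply: contrapT => none; move: h; apply/negP; rewrite -leNgt.
have -> : ((C * (3 ^ n)%:R * (2 ^ l)%:R * tau)%:E = C%:E *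
    \sum_(j < 3 ^ n) \sum_(g : {ffun 'I_l -> bool}) tau%:E)%E.
  under eq_bigr do rewrite sumEFin sumr_const.
  rewrite sumEFin sumr_const card_ffun card_bool !card_ord.
  by rewrite -EFinM; congr EFin; rewrite -mulr_natr -[tau *+ _]mulr_natr; ring.
apply: lee_wpmul2l; first by rewrite lee_fin ltW.
apply: lee_sum => j _; apply: lee_sum => g _.
have : ~ (tau%:E < \esum_(Q in S j)
    ((aQ Q * oscillation y Q x) ^+ m * \1_(cset Q) x)%:E)%E.
  by move=> h; apply: none; exists j.
move=> /negP; rewrite -leNgt; apply: le_trans; apply: le_esum => Q _.
exact: term_le.
Qed.

Variables (v : func) (w : 'I_m -> func) (t a : R).
Let u := geometric_mean w.
Let vm x := v x `^ m%:R^-1.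
Let uv x := u x * vm x.
Hypotheses (vw : weight v) (t2 : 2 <= t) (Afin : (Ap_const t vm < +oo)%E).
Hypotheses (wA1 : A1_vec w) (ua : A1_bound mu (@cset R n) (@vol R n) u (2 * a)).
Let A := fine (Ap_const t vm).
Variable Nw : R.
Hypothesis Nw0 : 0 <= Nw.
Hypothesis hNw : (weak_norm m%:R^-1 uv
  (fun x => llogl_maximal f x / (v x)%:E) <= Nw%:E)%E.

Let mv : measurable_fun setT v. Proof. by case: vw. Qed.
Let mR : m%:R != 0 :> R. Proof. by rewrite pnatr_eq0 -lt0n. Qed.
Let W x := fill1 v x `^ m%:R^-1.
Let fill0 x : 0 < fill1 v x. Proof. exact: fill1_gt0. Qed.
Let mW : measurable_fun setT W.
Proof. exact: (measurable_powRf _ (measurable_fill1 mv)). Qed.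
Let W0 x : 0 < W x. Proof. exact: powR_gt0. Qed.
Let WX x : W x ^+ m = fill1 v x.
Proof. by rewrite -powR_mulrn ?(ltW (W0 x))// -powRrM mulVf// powRr1// ltW. Qed.
Let mvm : measurable_fun setT vm. Proof. exact: (measurable_powRf _ mv). Qed.
Let Wvm : {ae mu, forall x, W x = vm x}.
Proof. by have [_ v0] := vw; apply: filterS (fill1_ae v0) => x; rewrite /W => ->. Qed.
Let vm_le x : vm x <= W x.
Proof. by apply: powR_le_fill1; rewrite invr_eq0. Qed.
Let u0 x : 0 <= u x. Proof. exact: geometric_mean_ge0. Qed.
Let mfu : measurable_fun setT u. Proof. exact: measurable_geometric_mean. Qed.
Let uv0 x : 0 <= uv x. Proof. by rewrite mulr_ge0// powR_ge0. Qed.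
Let muv : measurable_fun setT uv. Proof. exact: (measurable_funM mfu mvm). Qed.
Let muW : measurable_fun setT (fun x => u x * W x).
Proof. exact: (measurable_funM mfu mW). Qed.
Let AW : Ap_const t W = Ap_const t vm. Proof. exact: (Ap_const_ae_eq t mW mvm Wvm). Qed.
Let Nn := (Nw * cB) `^ m%:R^-1.

Let level_maximal (sg : R) Q x : 0 < sg -> 0 < v x -> cset Q x -> sg * W x < aQ Q ->
  ((sg ^+ m / cB)%:E < `| llogl_maximal f x / (v x)%:E |)%E.
Proof.
move=> sg0 vx Qx h.
have sW : 0 <= sg * W x := mulr_ge0 (ltW sg0) (ltW (W0 x)).
have {}h : sg ^+ m / cB * v x < \prod_(i < m) llogl_real f Q i.
  move: h; rewrite -(ltr_pXn2r m0); [|by rewrite nnegrE; exact: sW|by rewrite nnegrE; exact: aQ0].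
  rewrite exprMn WX {1}/fill1 vx aQX => h.
  by rewrite mulrAC (ltr_pdivrMr _ _ cB0) [X in _ < X]mulrC.
have {}h : ((sg ^+ m / cB * v x)%:E < llogl_maximal f x)%E.
  apply: (@lt_le_trans _ _ (\prod_(i < m) llogl_norm Q (f i))%E); last first.
    by apply: ereal_sup_ubound; exists Q.
  under eq_bigr do rewrite (llogl_realE bf).
  by rewrite prodEFin lte_fin.
have lam0 : 0 < sg ^+ m / cB := divr_gt0 (exprn_gt0 m sg0) cB0.
have M0 : (0 <= llogl_maximal f x)%E.
  apply: le_trans (ltW h); rewrite lee_fin; exact: (mulr_ge0 (ltW lam0) (ltW vx)).
have vi0 : (0 <= ((v x)^-1)%:E)%E by rewrite lee_fin invr_ge0; exact: ltW.
rewrite inver (gt_eqF vx) (gee0_abs (mule_ge0 M0 vi0)) (lte_pdivlMr _ _ vx).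
by rewrite -EFinM; exact: h.
Qed.

Let Nn_div (sg : R) : 0 < sg -> Nn / sg = (Nw / (sg ^+ m / cB)) `^ m%:R^-1.
Proof.
move=> sg0; have sgi : 0 <= sg^-1 by rewrite invr_ge0; exact: ltW.
have -> : Nw / (sg ^+ m / cB) = (Nw * cB) * sg^-1 ^+ m by rewrite invf_div mulrA exprVn.
rewrite (powRM _ (mulr_ge0 Nw0 (ltW cB0)) (exprn_ge0 m sgi)); congr (_ * _).
by rewrite -(powR_mulrn _ sgi) -powRrM (mulfV mR) (powRr1 sgi).
Qed.

(** The level sg for the m-th roots corresponds to the level [sg^m / cB] of the maximal function
    over v. The set on the left is measurable, whereas the level set that contains it almost
    everywhere may not be. *)
Let weakN (s : seq (cube R n)) (sg : R) : 0 < sg ->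
  (wint mu (fun x => u x * W x)%R
     [set x | exists2 Q, Q \in s & cset Q x /\ (sg * W x < aQ Q)%R] <= (Nn / sg)%:E)%E.
Proof.
move=> sg0; have lam0 : 0 < sg ^+ m / cB := divr_gt0 (exprn_gt0 m sg0) cB0.
pose Z := [set x | ((sg ^+ m / cB)%:E < `| llogl_maximal f x / (v x)%:E |)%E].
have uWE : {ae mu, forall x, u x * W x = uv x}.
  by apply: filterS Wvm => x Wx; rewrite /uv Wx.
have XZ : {ae mu, forall x, (exists2 Q, Q \in s & cset Q x /\ (sg * W x < aQ Q)%R) -> Z x}.
  by have [_ v0] := vw; apply: filterS v0 => x vx [Q _ [Qx h]]; exact: (level_maximal sg0 vx Qx h).
have mX := measurable_level aQ sg s (@measurable_cset R n) mW.
apply: (le_trans (wint_ae_subset muW muv uv0 uWE mX XZ)).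
rewrite (Nn_div sg0); apply: (le_of_weak_level m0 lam0 Nw0 (wint_ge0 _ _ uv0)).
apply: le_trans hNw; apply: ereal_sup_ubound; exists (sg ^+ m / cB); first exact: lam0.
by rewrite invrK.
Qed.

Lemma weak_level_estimate (g : func) (lam : R) :
  {ae mu, forall x, (`|g x|%:E <= C%:E * sparse_bound lm b f S x)%E} -> 0 < lam ->
  (lam%:E * (\int[mu]_(x in [set x | (lam%:E < `|(g x / v x)%:E|)%E]) (uv x)%:E) `^ m%:R <=
    (weak_factor n m l C
      (oscillation_constant (2 * a) n.+1%:R A (t - 1)^-1 eta kap l) cB * Nw)%:E)%E.
Proof.
move=> gS lam0; rewrite -/(wint mu uv _).
have [t1 s0 s1] := exponent_bounds t2.
have AfinW : (Ap_const t W < +oo)%E by rewrite AW.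
have [A1 Wb0 WbE WbN] := Ap_bound t1 mW W0 AfinW.
rewrite AW -/A in A1 WbN.
pose K : R := C * (3 ^ n)%:R * (2 ^ l)%:R.
have K0 : 0 < K.
  by apply: mulr_gt0; [apply: (mulr_gt0 C0)|]; rewrite ltr0n expn_gt0.
(* [K kp^m = lam]: where [|g| > lam v], [sparse_bound_large] with [tau = (kp W)^m] then yields a
   family whose sum exceeds [(kp W)^m]. *)
pose kp := (lam / K) `^ m%:R^-1.
have lK : 0 < lam / K := divr_gt0 lam0 K0.
have kp0 : 0 < kp by exact: powR_gt0.
have kpX : kp ^+ m = lam / K.
  by rewrite -(powR_mulrn _ (powR_ge0 _ _)) -powRrM (mulVf mR) (powRr1 (ltW lK)).
have Nn0 : 0 <= Nn by exact: powR_ge0.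
have NL : 2 ^+ n.+1 = 2 `^ n.+1%:R :> R by rewrite powR_mulrn.
have L1 : 1 <= n.+1%:R :> R by rewrite ler1n.
set CC := oscillation_constant (2 * a) n.+1%:R A (t - 1)^-1 eta kap l.
have Yex j : exists Y, [/\ measurable Y,
    [set x | ((kp ^+ m * W x ^+ m)%:E <
      \esum_(Q in S j) ((aQ Q * oscillation y Q x) ^+ m * \1_(cset Q) x)%:E)%E] `<=` Y &
    (wint mu (fun x => u x * W x)%R Y <= (CC * (Nn / kp))%:E)%E].
  have [D [lD SDj spS]] := SD j.
  have cS : countable (S j).
    exact: (sub_countable (subset_card_le SDj) (dyadic_lattice_countable lD)).
  apply: (@countable_weak_bound R _ _ mu _ (@cset R n) (@vol R n) _ _ lebesgue_cz_system
    L1 NL u _ ua W (fun Q => mean Q W) A _ mW W0 Wb0 A1 s0 s1 WbE WbN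
    (@side R n) eta (S j) cS _ aQ Nn _ Nn0 _ l y kap l0 kap0 kap1
    _ _ m kp m0 kp0).
  - by move=> s us sS; exact: (sparse_lattice_seq n0 eta01 lD SDj spS us sS).
  - exact: aQ0.
  - by move=> s sg _; exact: weakN.
  - exact: my.
  - exact: yexp.
have [Y HY] := fin_all_exists Yex.
have cover : {ae mu, forall x, (lam%:E < `|(g x / v x)%:E|)%E -> exists j, Y j x}.
  have [_ v0] := vw; apply: filterS2 v0 gS => x vx gx h.
  have [j hj] : exists j, ((kp ^+ m * W x ^+ m)%:E < \esum_(Q in S j)
    ((aQ Q * oscillation y Q x) ^+ m * \1_(cset Q) x)%:E)%E.
    apply: sparse_bound_large; apply: lt_le_trans gx; rewrite lte_fin.
    move: h; rewrite /= lte_fin normrM normfV (gtr0_norm vx) (ltr_pdivlMr _ _ vx).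
    rewrite kpX WX {1}/fill1 vx -/K mulrA [K * _]mulrC (divfK (lt0r_neq0 K0)); exact.
  by exists j; case: (HY j) => _ sub _; exact: (sub x hj).
have uvW x : uv x <= u x * W x := ler_wpM2l (u0 x) (vm_le x).
have := wint_ae_cover muW uv0 uvW (fun j => let: And3 h _ _ := HY j in h)
  (fun j => let: And3 _ _ h := HY j in h) cover.
rewrite card_ord; set I := wint _ _ _; set r := _%:R * _ => Ir.
have I0 : (0 <= I)%E := wint_ge0 _ _ uv0.
have [z z0 zE] := fin_num_real I0 (le_lt_trans Ir (ltry _)).
move: Ir; rewrite zE poweR_EFin -EFinM !lee_fin => zr.
have -> : weak_factor n m l C CC cB * Nw = ((3 ^ n)%:R * CC) ^+ m * (K * (Nw * cB)).
  by rewrite [Nw * cB]mulrC [K * (cB * _)]mulrA [_ ^+ m * _]mulrA.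
exact: (weak_level_arith m0 lam0 K0 (mulr_ge0 Nw0 (ltW cB0)) z0 zr).
Qed.

End weak_estimate.

(** * The case of a vanishing BMO norm, where oscillations cannot be normalized *)

Section vanishing.
Context {R : realType} {d : measure_display} {T : measurableType d}.
Variable mu : {measure set T -> \bar R}.

Lemma wint_norm_eq0 (h : T -> R) (E : set T) : measurable_fun setT h -> measurable E ->
  (wint mu (fun x => `|h x|)%R E <= 0)%E -> {ae mu, forall x, E x -> h x = 0}.
Proof.
move=> mh mE h0.
have mhE : measurable_fun E (EFin \o h) by apply/measurable_EFinP; exact: measurable_funTS.
have : ae_eq mu E (EFin \o h) (cst 0%E).
  apply/(ae_eq_integral_abs mu mE mhE); apply/eqP; rewrite eq_le h0/=.
  by apply: integral_ge0 => x _; rewrite lee_fin.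
by apply: filterS => x hx Ex; have [] := hx Ex.
Qed.

Lemma wint_norm_ae0 (h : T -> R) (E : set T) : measurable_fun setT h -> measurable E ->
  {ae mu, forall x, E x -> h x = 0} -> wint mu (fun x => `|h x|)%R E = 0%E.
Proof.
move=> mh mE h0; apply/eqP; rewrite eq_le wint_ge0// andbT.
have <- : wint mu (fun=> 0) E = 0%E by rewrite /wint integral0.
apply: wint_ae_le => //; first exact: measurableT_comp.
by apply: filterS h0 => x hx Ex; rewrite hx// normr0.
Qed.

Lemma measurable_subM (h k : T -> R) (c : R) : measurable_fun setT h ->
  measurable_fun setT k -> measurable_fun setT (fun x => (h x - c) * k x).
Proof. by move=> mh mk; apply: measurable_funM => //; exact: measurable_funB. Qed.

Lemma ae_seq_forall (I : eqType) (s : seq I) (P : I -> T -> Prop) :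
  (forall i, {ae mu, forall x, P i x}) -> {ae mu, forall x i, i \in s -> P i x}.
Proof.
move=> H; elim: s => [|i s IH]; first by apply: filterE.
apply: filterS2 (H i) IH => x Pi Ps j; rewrite inE => /predU1P[->|]; first exact: Pi.
exact: Ps.
Qed.

Lemma ae_countable_forall (I : choiceType) (D : set I) (P : I -> T -> Prop) : countable D ->
  (forall i, {ae mu, forall x, P i x}) -> {ae mu, forall x i, D i -> P i x}.
Proof.
move=> /countable_exhaustion[s [_ _ _ cover]] H.
have : {ae mu, forall x k i, i \in s k -> P i x}.
  by apply: ae_foralln => k; exact: ae_seq_forall.
by apply: filterS => x Hx i /cover[k]; exact: Hx.
Qed.

End vanishing.

Section degenerate_commutator.
Context {R : realType} {n : nat}.
Local Notation mu := (@lebesgue R n).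
Local Notation func := (Rn R n -> R).

Lemma bmo_norm_ge0 (h : func) : (0 <= bmo_norm h)%E.
Proof.
apply: le_trans (avg_ge0 (@unit_cube R n) (fun x => normr_ge0 (h x - mean unit_cube h))) _.
by apply: ereal_sup_ubound; exists unit_cube.
Qed.

Lemma bmo_norm_fine (h : func) : bmo h ->
  0 <= fine (bmo_norm h) /\ bmo_norm h = (fine (bmo_norm h))%:E.
Proof.
by move=> [_ _ hfin]; have [B B0 ->] := fin_num_real (bmo_norm_ge0 h) hfin.
Qed.

Variables (m l : nat) (lm : (l <= m)%N) (b : 'I_l -> func) (s0 : 'I_l).
Hypotheses (mb : measurable_fun setT (b s0)) (b0 : bmo_norm (b s0) = 0%E).
Variables (f : 'I_m -> func) (S : 'I_(3 ^ n) -> set (cube R n)).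
Hypothesis mf : forall i, measurable_fun setT (f i).
Hypothesis cS : forall j, countable (S j).

Let oscillation0 Q : {ae mu, forall x, cset Q x -> b s0 x - mean Q (b s0) = 0}.
Proof.
have mc : measurable_fun setT (fun _ : Rn R n => mean Q (b s0)) by exact: measurable_cst.
apply: (wint_norm_eq0 (measurable_funB mb mc) (measurable_cset Q)).
rewrite -[0%E]/(0%:E) -[X in X%:E](mul0r (vol Q)) -avg_leP -[X in (_ <= X)%E]b0.
by apply: ereal_sup_ubound; exists Q.
Qed.

(** On each cube [b s0] equals its mean almost everywhere; the families are countable, so one null
    set serves all cubes, and every term contains a factor from [s0]. *)
Lemma sparse_bound_eq0 : {ae mu, forall x, sparse_bound lm b f S x = 0%E}.
Proof.
have : {ae mu, forall x j Q, S j Q -> cset Q x -> b s0 x - mean Q (b s0) = 0}.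
  by apply: filter_forall => j; exact: (ae_countable_forall (cS j) oscillation0).
apply: filterS => x Hx; apply: big1 => j _; apply: big1 => g _; apply: esum1 => Q SQ.
have [Qx|nQx] := pselect (cset Q x); last by rewrite indicE memNset// mule0.
rewrite (bigD1 s0)//=; suff -> : sparse_factor (b s0) (f (widen_ord lm s0)) Q (g s0) x = 0%E.
  by rewrite !mul0e.
rewrite /sparse_factor; case: (g s0); last by rewrite (Hx j Q)// normr0 mul0e.
rewrite avgE (wint_norm_ae0 (measurable_subM _ mb (mf _)) (measurable_cset Q)) ?mul0e//.
by apply: filterS (oscillation0 Q) => z hz /hz ->; rewrite mul0r.
Qed.

End degenerate_commutator.

Lemma weak_norm_ae0 (R : realType) (n m : nat) (h : Rn R n -> R) (g : Rn R n -> \bar R) :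
  (0 < m)%N -> measurable_fun setT h -> (forall x, 0 <= h x) ->
  {ae @lebesgue R n, forall x, g x = 0%E} -> (weak_norm m%:R^-1 h g <= 0)%E.
Proof.
move=> m0 mh h0 g0; apply: ge_ereal_sup => _ [lam /= lam0 <-].
have I0 : (wint (@lebesgue R n) h [set x | (lam%:E < `|g x|)%E] <= (#|'I_0|%:R * 0)%:E)%E.
  (* Almost no point lies in the level set, so the empty family, indexed by ['I_0], is an almost
     cover. *)
  apply: (wint_ae_cover (Y := fun=> set0) mh h0 (fun=> lexx _)) => [i|i|].
  - exact: measurable0.
  - by rewrite /wint integral_set0.
  - by apply: filterS g0 => x gx /=; rewrite gx abse0 lte_fin ltNge (ltW lam0).
rewrite mulr0 in I0; set I := (\int[_]_(_ in _) _)%E.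
have -> : I = 0%E by apply/eqP; rewrite eq_le I0/=; exact: wint_ge0.
by rewrite invrK poweR0r ?mule0// pnatr_eq0 -lt0n.
Qed.

Lemma weak_norm_ge0 (R : realType) (n : nat) (q : R) (h : Rn R n -> R)
  (g : Rn R n -> \bar R) : (0 <= weak_norm q h g)%E.
Proof.
pose I := (\int[@lebesgue R n]_(x in [set x | (1%:E < `|g x|)%E]) (h x)%:E)%E.
apply: (@le_trans _ _ (1%:E * I `^ q^-1)%E); first by rewrite mul1e poweR_ge0.
by apply: ereal_sup_ubound; exists 1 => //=; rewrite ltr01.
Qed.

Lemma Ap_const_ge1 (R : realType) (n : nat) (t : R) (g : Rn R n -> R) : 1 < t ->
  Ap t g -> 1 <= fine (Ap_const t g).
Proof.
move=> t1 [[mg g0] gfin].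
have E := Ap_const_ae_eq t (measurable_fill1 mg) mg (fill1_ae g0).
rewrite -E in gfin *.
by have [] := Ap_bound t1 (measurable_fill1 mg) (fill1_gt0 g) gfin.
Qed.

(** Only [K^m] is produced; since K and A are at least 1, larger powers may be put in. The terms
    [|c1| + 1] and [|C| + 1] keep the constant positive for arbitrary real parameters. *)
Lemma weak_factor_le (R : realType) (n m l p q : nat) (C cc c1 K A beta P : R) :
  0 < C -> 0 <= cc -> cc <= c1 * K -> 1 <= K -> 1 <= A -> 0 <= beta -> 0 <= P ->
  (m <= p)%N ->
  weak_factor n m l C cc (beta ^+ l * P) <=
    ((3 ^ n)%:R * (`|c1| + 1)) ^+ m * ((`|C| + 1) * (3 ^ n)%:R * (2 ^ l)%:R * beta ^+ l) *
      K ^+ p * A ^+ q * P.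
Proof.
move=> C0 cc0 ccK K1 A1 beta0 P0 mp; rewrite /weak_factor.
have K0 : 0 <= K by exact: le_trans K1.
set k := (3 ^ n)%:R; set h := (2 ^ l)%:R.
have k0 : 0 <= k :> R by exact: ler0n.
have h0 : 0 <= h :> R by exact: ler0n.
have c10 : 0 <= `|c1| + 1 by rewrite addr_ge0.
have ccK' : cc <= (`|c1| + 1) * K.
  apply: (le_trans ccK); rewrite ler_wpM2r//.
  by apply: (le_trans (ler_norm c1)); rewrite lerDl.
have e1 : (k * cc) ^+ m <= (k * (`|c1| + 1)) ^+ m * (K ^+ p * A ^+ q).
  apply: (@le_trans _ _ ((k * (`|c1| + 1)) ^+ m * K ^+ m)).
    rewrite -exprMn lerXn2r ?nnegrE ?mulr_ge0//.
    by rewrite -mulrA ler_wpM2l.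
  rewrite ler_wpM2l ?exprn_ge0 ?mulr_ge0// -[leLHS]mulr1 ler_pM ?exprn_ge0//.
    exact: ler_weXn2l.
  exact: exprn_ege1.
have e2 : C * k * h * (beta ^+ l * P) <= (`|C| + 1) * k * h * beta ^+ l * P.
  rewrite -[leRHS]mulrA ler_wpM2r ?mulr_ge0 ?exprn_ge0//.
  rewrite ler_wpM2r// ler_wpM2r//.
  by apply: (le_trans (ler_norm C)); rewrite lerDl.
have a0 : 0 <= (k * cc) ^+ m by rewrite exprn_ge0// mulr_ge0.
have a1 : 0 <= C * k * h * (beta ^+ l * P).
  by rewrite mulr_ge0// ?mulr_ge0// ?exprn_ge0// ltW.
apply: (le_trans (ler_pM a0 a1 e1 e2)).
by rewrite le_eqVlt; apply/orP; left; apply/eqP; ring.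
Qed.

Theorem theorem1p10 (R : realType) (n : nat) (n_gt0 : (0 < n)%N) :
  exists Cn : R, 0 < Cn /\
  exists C' : nat -> nat -> R -> R -> R,
    (forall m l C eta, 0 < C' m l C eta) /\
  forall v : Rn R n -> R, Ainfty v ->
  exists t : R, 1 < t /\
    (forall m : nat, (0 < m)%N -> Ap t (fun x => v x `^ m%:R^-1)) /\
  forall (m l : nat) (l_gt0 : (0 < l)%N) (lm : (l <= m)%N)
    (C eta : R) (b : 'I_l -> Rn R n -> R)
    (D : 'I_m -> set (Rn R n -> R))
    (T : ('I_m -> Rn R n -> R) -> Rn R n -> R)
    (w : 'I_m -> Rn R n -> R),
    0 < C -> 0 < eta < 1 ->
    (forall s, bmo (b s)) ->
    multilinear_operator D T ->
    suitable_domain lm D b ->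
    sparse_domination lm C eta b T ->
    A1_vec w ->
    let u := geometric_mean w in
    let vm := fun x => v x `^ m%:R^-1 in
    let uv := fun x => u x * vm x in
    let K := K0 n Cn t (fine (A1_const u)) (fine (Ap_const t vm)) in
  forall f : 'I_m -> Rn R n -> R,
    (forall i, bounded_compact_support (f i)) ->
    (weak_norm m%:R^-1 uv
       (fun x => (iterated_commutator lm T b f x / v x)%:E)
     <= (C' m l C eta * K ^+ (2 * l + 6 * m)
           * fine (Ap_const t vm) ^+ (2 * l + 4 * m))%:E
        * (\prod_(s < l) bmo_norm (b s))
        * weak_norm m%:R^-1 uv
            (fun x => llogl_maximal f x / (v x)%:E))%E.
Proof.
(* With [Cn = 8], [K0] dominates [8 ^ t * [v^(1/m)]_{A_t} ^ 2 * 2 ^ (16 (t - 1) [u]_{A_1})]. *)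
exists 8; split; first by [].
pose kap : R := bmo_exp (n := n); pose beta : R := bmo_factor (n := n).
have kap0 : 0 < kap := bmo_exp_gt0; have beta1 : 1 <= beta := bmo_factor_ge1.
have N3 : 0 < (3 ^ n)%:R :> R by rewrite ltr0n expn_gt0.
have N2 l : 0 < (2 ^ l)%:R :> R by rewrite ltr0n expn_gt0.
have C'0 m l (C eta : R) : 0 < ((3 ^ n)%:R * (`|constant_factor n l eta kap| + 1)) ^+ m *
    ((`|C| + 1) * (3 ^ n)%:R * (2 ^ l)%:R * beta ^+ l).
  have p1 (x : R) : 0 < `|x| + 1 by rewrite ltr_wpDl.
  have bl : 0 < beta ^+ l by rewrite exprn_gt0// (lt_le_trans _ beta1).
  apply: mulr_gt0; first exact: exprn_gt0 (mulr_gt0 N3 (p1 _)).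
  exact: mulr_gt0 (mulr_gt0 (mulr_gt0 (p1 _) N3) (N2 _)) bl.
eexists; split; first exact: C'0.
(* [t >= 2] makes the dual exponent [(t - 1)^-1] at most 1. *)
move=> v [p [p1 vp]]; pose t := Num.max p 2.
have pt : p <= t by rewrite le_max lexx.
have t2 : 2 <= t by rewrite le_max lexx orbT.
have t1 : 1 < t by exact: lt_le_trans pt.
have vA m : (0 < m)%N -> Ap t (fun x => v x `^ m%:R^-1).
  move=> m0; apply: (Ap_powR vp p1 pt t2).
  by rewrite invr_gt0 ltr0n m0 invf_le1 ?ltr0n// ler1n.
exists t; split; first exact: t1.
split; first exact: vA.
move=> m l l0 lm C eta b D T w C0 eta01 bb _ _ sd wA1 u vm uv K f bf.
have m0 : (0 < m)%N := leq_trans l0 lm.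
have [S [SD gS]] := sd f bf.
set g := iterated_commutator lm T b f in gS *.
have mb s : measurable_fun setT (b s) by have [] := bb s.
have mf i : measurable_fun setT (f i) by have [] := bf i.
have [B BE] : exists B : 'I_l -> R, forall s, 0 <= B s /\ bmo_norm (b s) = (B s)%:E.
  by exists (fun s => fine (bmo_norm (b s))) => s; exact: bmo_norm_fine.
have vw : weight v by case: vp.
have mvm : measurable_fun setT vm by have [[]] := vA m m0.
have muv : measurable_fun setT uv := measurable_funM (measurable_geometric_mean wA1) mvm.
have uv0 x : 0 <= uv x := mulr_ge0 (geometric_mean_ge0 w x) (powR_ge0 _ _).
(* If some norm is 0, the right-hand side is 0 even when the weak norm of the maximal function is
   infinite, as [0 * +oo = 0]; so the commutator has to vanish almost everywhere. *)
have [[s Bs]|Bpos] := pselect (exists s, B s = 0).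
  have b0 : bmo_norm (b s) = 0%E by rewrite (BE s).2 Bs.
  have cS j : countable (S j).
    have [D' [lD SDj _]] := SD j.
    exact: (sub_countable (subset_card_le SDj) (dyadic_lattice_countable lD)).
  rewrite (bigD1 s)//= b0 mul0e mule0 mul0e.
  apply: (weak_norm_ae0 m0 muv uv0).
  apply: filterS2 gS (sparse_bound_eq0 lm (mb s) b0 mf cS) => x gx s0.
  move: gx; rewrite s0 mule0 lee_fin normr_le0 => /eqP ->.
  by rewrite mul0r.
have B0 s : 0 < B s.
  by rewrite lt_neqAle (BE s).1 andbT eq_sym; apply/eqP => Bs; apply: Bpos; exists s.
have bB s : bmo_norm (b s) = (B s)%:E by exact: (BE s).2.
have [a [a1 aE ua]] := A1_vec_bound wA1.
set A := fine (Ap_const t vm).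
have A1 : 1 <= A := Ap_const_ge1 t1 (vA m m0).
have KE : K = K0 n 8 t a A by rewrite /K aE.
have K1 : 1 <= K by rewrite KE; exact: K0_ge1.
have eta0 : 0 < eta by case/andP: eta01.
set cc := oscillation_constant (2 * a) n.+1%:R A (t - 1)^-1 eta kap l.
have a0 : 0 < a := lt_le_trans ltr01 a1.
have A0 : 0 < A := lt_le_trans ltr01 A1.
have ccE := oscillation_constantE n l t1 a0 A0 eta0 kap0.
have c10 := constant_factor_ge0 n l eta0 kap0.
have Z0 : 0 <= a ^+ 10 * (t - 1) ^+ 3 * 8 `^ (t - 1) * A ^+ 2.
  have tp : 0 <= t - 1 by rewrite subr_ge0; exact: ltW.
  apply: mulr_ge0; last exact: exprn_ge0 (ltW A0).
  apply: mulr_ge0; last exact: powR_ge0.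
  exact: mulr_ge0 (exprn_ge0 10 (ltW a0)) (exprn_ge0 3 tp).
have cc0 : 0 <= cc by rewrite /cc ccE; exact: mulr_ge0.
have ccK : cc <= constant_factor n l eta kap * K.
  rewrite /cc ccE KE; apply: (ler_wpM2l c10); exact: K0_ge.
have P0 : 0 < \prod_(s < l) B s by apply: prodr_gt0 => s _; exact: B0.
under eq_bigr do rewrite bB.
rewrite prodEFin -EFinM.
set weakM := weak_norm _ _ (fun x => llogl_maximal f x / (v x)%:E)%E.
set cF := _ * A ^+ _ * _.
have cFle : weak_factor n m l C cc (beta ^+ l * \prod_(s < l) B s) <= cF.
  apply: (@weak_factor_le R n m l (2 * l + 6 * m) (2 * l + 4 * m) _ _ _ _ _ _ _ C0 cc0 ccK K1 A1 (le_trans ler01 beta1) (ltW P0)).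
  by rewrite (leq_trans (leq_pmull m (isT : 0 < 6)%N))// leq_addl.
have cF0 : 0 < cF.
  apply: mulr_gt0 P0; apply: mulr_gt0; last exact: exprn_gt0.
  by apply: mulr_gt0; [exact: C'0|exact: exprn_gt0 (lt_le_trans ltr01 K1)].
have weakM0 : (0 <= weakM)%E := weak_norm_ge0 _ _ _.
(* The factor [cF] is positive now, so an infinite weak norm makes the right-hand side infinite. *)
have [Minf|Mfin] := eqVneq weakM +oo%E.
  by rewrite Minf gt0_muley ?leey// lte_fin.
have weakMfin : (weakM < +oo)%E by rewrite ltey.
have [Nw Nw0 NwE] := fin_num_real weakM0 weakMfin.
rewrite NwE; apply: ge_ereal_sup => _ [lam lam0 <-]; rewrite invrK.
have hNw : (weakM <= Nw%:E)%E by rewrite NwE.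
have := weak_level_estimate n_gt0 l0 bf C0 eta01 SD kap0 bmo_exp_le1
  (measurable_normalized_oscillation B mb) (bmo_exp_cube B0 mb bB)
  (term_factor_gt0 B0) (fun Q => powR_ge0 _ _) (term_sizeX m0 B0 bf)
  (sparse_term_le lm m0 B0 mb bB bf) vw t2 (vA m m0).2 wA1 ua Nw0 hNw gS lam0.
move=> /le_trans; apply; rewrite -EFinM lee_fin.
exact: (ler_wpM2r Nw0 cFle).
Qed.
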